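(* Let $0<q<1$ and let $C$ be a constant. The inequality $$\eta(v)^2\ge C\left(\int_\Omega|v|^{1-q}\,dx\right)^{\frac{2}{1-q}}$$ holds for every $v\in\mathcal{X}^{1,2}_{\mathcal{D}}(U)$ if and only if $C\le\Re(U)$. Moreover, if this inequality is an equality for some $w\in\mathcal{X}^{1,2}_{\mathcal{D}}(U)\setminus\{0\}$, then $w=k\hat u$ for some constant $k>0$.
   Context: Let $N>2$, $s\in(0,1)$. Let $\Omega\subseteq\mathbb{R}^N$ be a nonempty open set, and let $\mathcal{D},\mathcal{N}$ be open subsets of $\mathbb{R}^N\setminus\overline{\Omega}$ with $\mathcal{D}\cap\mathcal{N}=\emptyset$ and $\mathcal{D}\cup\mathcal{N}=\mathbb{R}^N\setminus\overline{\Omega}$, such that $\Omega\cup\mathcal{N}$ is bounded with smooth boundary. Put $U=\Omega\cup\mathcal{N}\cup(\partial\Omega\cap\overline{\mathcal{N}})$, $U^c=\mathbb{R}^N\setminus U$ and $\Omega^c=\mathbb{R}^N\setminus\Omega$. Space: $\mathcal{X}^{1,2}_{\mathcal{D}}(U)=\{u\in H^1(\mathbb{R}^N): u|_U\in H^1_0(U),\ u\equiv0\text{ a.e. in }U^c\}$. With $Q=\mathbb{R}^{2N}\setminus(\Omega^c\times\Omega^c)$, it carries the inner product $\langle u,v\rangle=\int_\Omega\nabla u\cdot\nabla v\,dx+\int_Q\frac{(u(x)-u(y))(v(x)-v(y))}{|x-y|^{N+2s}}dx\,dy$ and norm $\eta(u)=\langle u,u\rangle^{1/2}$. $\Re(U)=\inf\{\eta(v)^2: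 v\in\mathcal{X}^{1,2}_{\mathcal{D}}(U)\setminus\{0\},\ \int_\Omega|v|^{1-q}dx=1\}$. The function $\hat u$: for $n\in\mathbb{N}$ let $u_n\in\mathcal{X}^{1,2}_{\mathcal{D}}(U)\cap L^\infty(U)$ be the unique function with $u_n>0$ a.e. in $\Omega$ and $\langle u_n,\varphi\rangle=\int_\Omega\frac{\varphi}{(u_n+1/n)^q}dx$ for all $\varphi\in\mathcal{X}^{1,2}_{\mathcal{D}}(U)$. The sequence $\{u_n\}$ is nondecreasing a.e., and $\hat u$ denotes its pointwise a.e. limit; $\hat u\in\mathcal{X}^{1,2}_{\mathcal{D}}(U)$ and $\hat u$ is a weak solution of $(-\Delta+(-\Delta)^s)u=u^{-q}$, $u>0$ in $\Omega$, with $u=0$ in $U^c$, $\int_\Omega\frac{u(x)-u(y)}{|x-y|^{N+2s}}dy=0$ for $x\in\mathcal{N}$, and zero normal derivative on $\partial\Omega\cap\overline{\mathcal{N}}$; that is, $\hat u>0$ a.e. in $\Omega$ and $\langle\hat u,\varphi\rangle=\int_\Omega\hat u^{-q}\varphi\,dx$ for all $\varphi\in C_0^\infty(\Omega)$.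
   Formalization: Both sides are even in v, so with C = Re(U) equality also holds at w = -û, which is not kû with k>0; the formal conclusion is w = kû or w = -kû a.e. with k>0, and the equality case assumes that the inequality holds for every v. *)

(* Defs.v *)
From HB Require Import structures.
From mathcomp Require Import all_boot all_order all_algebra.
From mathcomp Require Import all_classical all_reals all_analysis.

Set Implicit Arguments.
Unset Strict Implicit.
Unset Printing Implicit Defensive.

Import Order.TTheory GRing.Theory Num.Theory.
Import numFieldNormedType.Exports.

Local Open Scope classical_set_scope.
Local Open Scope ring_scope.

Definition rV_display : measure_display -> measure_display.
Proof. exact. Qed.

(* R^n carries the product sigma-algebra, generated by the coordinate maps,
   as does n.-tuple R in the library; it is the Borel sigma-algebra. *)
Section measurable_rV.
Context (R : realType) (n : nat).

Let coors : 'I_n -> 'rV[R]_n -> R := fun i x => x ord0 i.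

Let rV_set0 : g_sigma_preimage coors set0.
Proof. exact: sigma_algebra0. Qed.

Let rV_setC A : g_sigma_preimage coors A -> g_sigma_preimage coors (~` A).
Proof. exact: sigma_algebraC. Qed.

Let rV_bigcup (F : _^nat) : (forall i, g_sigma_preimage coors (F i)) ->
  g_sigma_preimage coors (\bigcup_i (F i)).
Proof. exact: sigma_algebra_bigcup. Qed.

HB.instance Definition _ := @isMeasurable.Build
  (rV_display (measure_tuple_display default_measure_display))
  'rV[R]_n (g_sigma_preimage coors) rV_set0 rV_setC rV_bigcup.

End measurable_rV.

Section measurable_cons_rV.
Context (R : realType).

Lemma measurable_rV_coord n (i : 'I_n) :
  measurable_fun [set: 'rV[R]_n] (fun x => x ord0 i).
Proof.
move=> _ Y mY; rewrite setTI; apply: sub_sigma_algebra => /=.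
rewrite -bigcup_seq/=; exists i => /=; first by rewrite mem_index_enum.
by exists Y => //; rewrite setTI.
Qed.

Lemma measurable_fun_rVP d (T : measurableType d) n (f : T -> 'rV[R]_n) :
  (forall i, measurable_fun [set: T] (fun t => f t ord0 i)) ->
  measurable_fun [set: T] f.
Proof.
case: n f => [|n] f mf; first by
  rewrite (_ : f = cst 0)//; apply/funext => t; exact: thinmx0.
pose G : set_system 'rV[R]_n.+1 := \big[setU/set0]_(i < n.+1)
  preimage_set_system setT (fun x : 'rV[R]_n.+1 => x ord0 i) measurable.
apply: (measurability G) => //= _ [B GB <-]; rewrite setTI; move: GB.
rewrite /G -bigcup_mkord_ord => -[i Ii [C mC <-]].
by rewrite setTI; have := mf (inord i) measurableT C mC; rewrite setTI.
Qed.

Definition cons_rV n (p : R * 'rV[R]_n) : 'rV[R]_n.+1 :=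
  row_mx (const_mx p.1 : 'rV[R]_1) p.2.

Lemma cons_rV0 n (p : R * 'rV[R]_n) : cons_rV p ord0 ord0 = p.1.
Proof.
by rewrite /cons_rV mxE; case: splitP => k; rewrite ?mxE//= add1n.
Qed.

Lemma cons_rVS n (p : R * 'rV[R]_n) j : cons_rV p ord0 (lift ord0 j) = p.2 ord0 j.
Proof.
rewrite /cons_rV mxE; case: splitP => k /=.
  by rewrite /bump leq0n add1n (ord1 k).
by rewrite /bump leq0n => -[/val_inj ->].
Qed.

Lemma measurable_cons_rV n : measurable_fun setT (@cons_rV n).
Proof.
apply: measurable_fun_rVP => i; case: (unliftP ord0 i) => [j|] ->.
  under eq_fun do rewrite cons_rVS.
  exact: (measurableT_comp (measurable_rV_coord j)).
under eq_fun do rewrite cons_rV0; exact: measurable_fst.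
Qed.

Definition uncons_rV n (y : 'rV[R]_n.+1) : R * 'rV[R]_n :=
  (y ord0 ord0, \row_j y ord0 (lift ord0 j)).

Lemma cons_rVK n : cancel (@cons_rV n) (@uncons_rV n).
Proof.
move=> [t x]; rewrite /uncons_rV cons_rV0; congr pair.
by apply/rowP => j; rewrite mxE cons_rVS.
Qed.

Lemma measurable_uncons_rV n : measurable_fun setT (@uncons_rV n).
Proof.
apply: measurable_fun_pair => /=; first exact: measurable_rV_coord.
apply: measurable_fun_rVP => i; under eq_fun do rewrite mxE.
exact: measurable_rV_coord.
Qed.

End measurable_cons_rV.

Section lebesgue_rV_cons.
Context (R : realType) (n : nat).
Variable m : {sigma_finite_measure set 'rV[R]_n -> \bar R}.
Local Open Scope ereal_scope.

Let pr : {measure set (measurableTypeR R * 'rV[R]_n)%type -> \bar R} :=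
  @lebesgue_measure R \x m.
Let nu := pushforward pr (@cons_rV R n).

Let preim_meas A : measurable A -> measurable (@cons_rV R n @^-1` A).
Proof.
by move=> mA; rewrite -[X in measurable X]setTI; exact: measurable_cons_rV.
Qed.

Let nu0 : nu set0 = 0.
Proof. by rewrite /nu /pushforward preimage_set0 measure0. Qed.

Let nu_ge0 A : 0 <= nu A.
Proof. exact: (measure_ge0 pr). Qed.

Let nu_sigma_additive : semi_sigma_additive nu.
Proof.
move=> F mF tF mUF; rewrite /nu /pushforward preimage_bigcup.
apply: measure_semi_sigma_additive.
- by move=> k; exact: preim_meas.
- apply/trivIsetP => /= i j _ _ ij; rewrite -preimage_setI.
  by move/trivIsetP : tF => /(_ _ _ _ _ ij) ->//; rewrite preimage_set0.
- by rewrite -preimage_bigcup; exact: preim_meas.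
Qed.

HB.instance Definition _ := isMeasure.Build _ _ _ nu
  nu0 nu_ge0 nu_sigma_additive.

Let pr_sigma_finite : sigma_finite setT pr.
Proof.
have /sigma_finiteP[F [TF ndF Foo]] := sigma_finiteT (@lebesgue_measure R).
have /sigma_finiteP[G [TG ndG Goo]] := sigma_finiteT m.
exists (fun k => F k `*` G k).
  rewrite -setXTT TF TG predeqE => -[x y]; split.
    move=> [/= [i _ Fnx] [k _ Gky]]; exists (maxn i k) => //; split.
    - by move: x Fnx; exact/subsetPset/ndF/leq_maxl.
    - by move: y Gky; exact/subsetPset/ndG/leq_maxr.
  by move=> [i _ []/= ? ?]; split; exists i.
move=> k; have [? ?] := Foo k; have [? ?] := Goo k.
split; first exact: measurableX.
by rewrite /= product_measure1E// lte_mul_pinfty// ge0_fin_numE.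
Qed.

Let nu_sigma_finite : sigma_finite setT nu.
Proof.
have [F TF Foo] := pr_sigma_finite.
exists (fun k => @uncons_rV R n @^-1` F k).
  by rewrite -preimage_bigcup -TF preimage_setT.
move=> k; have [mF Fk] := Foo k; split.
  by rewrite -[X in measurable X]setTI; exact: measurable_uncons_rV.
rewrite /nu /pushforward [X in pr X](_ : _ = F k)//.
by apply/seteqP; split=> p; rewrite /= cons_rVK.
Qed.

HB.instance Definition _ := Measure_isSigmaFinite.Build _ _ _ nu
  nu_sigma_finite.

Definition lebesgue_rV_cons : {sigma_finite_measure set 'rV[R]_n.+1 -> \bar R}
  := nu.

End lebesgue_rV_cons.

Fixpoint lebesgue_rV (R : realType) (n : nat) :
    {sigma_finite_measure set 'rV[R]_n -> \bar R} :=
  match n with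
  | 0 => \d_ (0 : 'rV[R]_0)
  | k.+1 => lebesgue_rV_cons (lebesgue_rV R k)
  end.

Lemma lebesgue_rV_box (R : realType) n (A : 'I_n -> set R) :
  (forall i, measurable (A i)) ->
  lebesgue_rV R n [set x | forall i, A i (x ord0 i)] =
  (\prod_(i < n) lebesgue_measure (A i))%E.
Proof.
elim: n A => [|n IH] A mA.
  by rewrite big_ord0 /= diracE mem_set// => -[].
have mB : measurable
    [set x : 'rV[R]_n | forall i, A (lift ord0 i) (x ord0 i)].
  rewrite [X in measurable X](_ : _ = \big[setI/setT]_(i < n)
      ((fun x : 'rV[R]_n => x ord0 i) @^-1` A (lift ord0 i))).
    apply: bigsetI_measurable => i _; rewrite -[X in measurable X]setTI.
    exact: measurable_rV_coord.
  apply/seteqP; split=> x /=; rewrite -bigcap_seq.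
    by move=> xA i _; exact: xA.
  by move=> xA i; apply: xA; rewrite /= mem_index_enum.
rewrite big_ord_recl -IH//= /pushforward -product_measure1E//;
  last exact: mA.
congr (_ _); apply/seteqP; split => -[t x] /=.
  move=> Ax; split; first by have := Ax ord0; rewrite cons_rV0.
  by move=> i; have := Ax (lift ord0 i); rewrite cons_rVS.
move=> [At Ax] i; case: (unliftP ord0 i) => [j|] ->.
  by rewrite cons_rVS.
by rewrite cons_rV0.
Qed.

Section smooth.
Context (R : realType) (N : nat).
Implicit Types (f phi : 'rV[R]_N -> R) (A V : set 'rV[R]_N) (i : 'I_N).

Definition partial i f : 'rV[R]_N -> R := fun x => 'D_(delta_mx ord0 i) f x.

Definition iter_partial (l : seq 'I_N) f := foldr partial f l.

(* C^oo on V (meant for V open): the partial derivatives of all orders exist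
   and are continuous at every point of V. *)
Definition smooth_on V f := forall (l : seq 'I_N) (x : 'rV[R]_N), V x ->
  {for x, continuous (iter_partial l f)} /\
  forall i, derivable (iter_partial l f) x (delta_mx ord0 i).

(* C_c^oo(A): smooth functions on R^N with compact support contained in A. *)
Definition test_function A phi := [/\ smooth_on setT phi,
  compact (closure [set x | phi x != 0]) &
  closure [set x | phi x != 0] `<=` A].

Definition boundary A := closure A `\` interior A.

(* The boundary of A is an embedded C^oo hypersurface, i.e. locally the zero
   set of a smooth function with nonvanishing gradient. A is not required to
   lie on one side of it: for A = Omega `|` NN both sides of the hypersurface
   boundary Omega `&` closure NN belong to A. *)
Definition smooth_boundary A := forall p, boundary A p ->
  exists (V : set 'rV[R]_N) (psi : 'rV[R]_N -> R),
    [/\ open V, V p, smooth_on V psi,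
        (forall x, V x -> exists i, partial i psi x != 0) &
        forall x, V x -> (boundary A x <-> psi x = 0)].

End smooth.

Section function_space.
Context (R : realType) (N : nat).
Local Notation mu := (lebesgue_rV R N).
Implicit Types (u v g phi w : 'rV[R]_N -> R) (U Omega : set 'rV[R]_N).

Definition weak_partial i u g := g \in Lfun mu 2%:E /\
  forall phi, test_function setT phi ->
    \int[mu]_x (u x * partial i phi x) = - \int[mu]_x (g x * phi x).

Definition H1 u := u \in Lfun mu 2%:E /\ forall i, exists g, weak_partial i u g.

(* The i-th component of the weak gradient, which is unique almost
   everywhere. *)
Definition wpartial i u : 'rV[R]_N -> R :=
  xget (cst 0) [set g | weak_partial i u g].

(* For u in H^1(R^N): the restriction of u to U belongs to H^1_0(U), the
   closure of C_c^oo(U) in H^1(U). The weak gradient of the restriction is the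
   restriction of the weak gradient. *)
Definition restr_H10 U u := forall e : R, 0 < e ->
  exists2 phi, test_function U phi &
    (\int[mu]_(x in U) ((u x - phi x) ^+ 2 +
       \sum_(i < N) (wpartial i u x - partial i phi x) ^+ 2)%:E < e%:E)%E.

Definition X12D U u :=
  [/\ H1 u, restr_H10 U u & {ae mu, forall x, (~` U) x -> u x = 0}].

Definition ae_zero u := {ae mu, forall x, u x = 0}.

(* `|x| on row vectors is the sup norm, hence the Euclidean norm. *)
Definition enorm (x : 'rV[R]_N) : R := Num.sqrt (\sum_(i < N) x ord0 i ^+ 2).

Definition Q_set Omega : set ('rV[R]_N * 'rV[R]_N) :=
  ~` (~` Omega `*` ~` Omega).

Definition inner Omega (s : R) u v : R :=
  \int[mu]_(x in Omega) (\sum_(i < N) wpartial i u x * wpartial i v x) +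
  \int[(mu \x mu)%E]_(z in Q_set Omega)
    ((u z.1 - u z.2) * (v z.1 - v z.2) /
     enorm (z.1 - z.2) `^ (N%:R + 2 * s)).

Definition eta_norm Omega (s : R) u : R := Num.sqrt (inner Omega s u u).

Definition U_set Omega NN := Omega `|` NN `|` (boundary Omega `&` closure NN).

(* The constant \Re(U); it also depends on Omega, s and q. *)
Definition Re_const Omega U (s q : R) : \bar R :=
  ereal_inf [set (eta_norm Omega s v ^+ 2)%:E | v in
    [set v | [/\ X12D U v, ~ ae_zero v &
                 \int[mu]_(x in Omega) (`|v x| `^ (1 - q)) = 1]]].

Definition ess_bounded_on U u :=
  exists M : R, {ae mu, forall x, U x -> `|u x| <= M}.

Definition ae_pos_on Omega u := {ae mu, forall x, Omega x -> 0 < u x}.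

(* u is the function u_n of the n-th regularized problem, n > 0. *)
Definition regularized_solution Omega U (s q : R) (n : nat) u :=
  [/\ X12D U u, ess_bounded_on U u, ae_pos_on Omega u &
      forall phi, X12D U phi -> inner Omega s u phi =
        \int[mu]_(x in Omega) (phi x / (u x + n%:R^-1) `^ q)].

Definition regularized_limit Omega U (s q : R) u :=
  exists un : nat -> 'rV[R]_N -> R,
    [/\ forall n, (0 < n)%N -> regularized_solution Omega U s q n (un n),
        forall n, (0 < n)%N -> {ae mu, forall x, un n x <= un n.+1 x} &
        {ae mu, forall x, un n x @[n --> \oo] --> u x}].

Definition weak_solution Omega (s q : R) u := ae_pos_on Omega u /\
  forall phi, test_function Omega phi ->
    mu.-integrable Omega (fun x => (u x `^ (- q) * phi x)%:E) /\
    inner Omega s u phi = \int[mu]_(x in Omega) (u x `^ (- q) * phi x).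

End function_space.

(* Main.v *)
Require Import Defs.
From HB Require Import structures.
From mathcomp Require Import all_boot all_order all_algebra.
From mathcomp Require Import all_classical all_reals all_analysis measurable_realfun.
From mathcomp Require Import ring lra.
Set Implicit Arguments.
Unset Strict Implicit.
Unset Printing Implicit Defensive.
Import Order.TTheory GRing.Theory Num.Theory.
Import numFieldNormedType.Exports.
Local Open Scope classical_set_scope.
Local Open Scope ring_scope.

(** The inequality is homogeneous of degree two in [v], so it holds for all [v]
    if and only if it holds for those with [power_mass v = 1], that is, if and
    only if [C] is at most the infimum [Re_const] ([sharp_constantP]).

    For the equality case write [p = 1 - q], [I v] for the integral of
    [`|v| `^ p] over [Omega], [J = I uhat], and let [K] be such that
    [I w = K `^ p * J]. If [w] attains equality, then formally
    [inner w w = K ^+ 2 * C * J `^ (2 / p) <= K ^+ 2 * inner uhat uhat], where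
    [inner uhat uhat = J] by the equation for [uhat]. Testing this equation with
    [`|w|] and using that the concave function [fun t => t `^ p] lies below its
    tangent gives [K * J <= inner uhat `|w|]. Hence
    [inner w w + K ^+ 2 * inner uhat uhat - 2 * K * inner uhat `|w| <= 0].
    The left side is the integral of a non-negative function: its nonlocal part
    is, for differences [D] between two points, the integral of
    [(K * D uhat - D `|w|) ^+ 2 + ((D w) ^+ 2 - (D `|w|) ^+ 2)] against the
    kernel. So at almost all pairs of points that are not both outside [Omega]
    the values of [K * uhat - `|w|] agree and [w] does not change sign. Fixing
    one point in [Omega] shows that [K * uhat - `|w|] is constant; it vanishes
    outside [U], which has positive measure, so [`|w| = K * uhat] and [w] has a
    constant sign ([minimizer_multiple]).

    The weak equation for [uhat] admits only test functions supported in
    [Omega], so the argument is run for the regularized solutions, which can be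
    tested with the whole energy space. Moreover [w] is replaced by test
    functions [phi k] that converge to it quickly, and [`|w|] by
    [sabs_fun e (phi k)], a smooth function with smaller differences and a
    smaller gradient. The integrated gain is then bounded by quantities with a
    non-positive limit, and Fatou's lemma ([fatou_ae0]) gives the pointwise
    conclusion; the convergence of the power masses comes from monotonicity and
    domination by [uhat].

    The test functions approximate [w] in the norm of [H^1] on [U], while the
    nonlocal energy involves [w] on the whole space. This is bridged by the
    embedding of [H^1] into [H^s] ([gag_le]), proved with translations: in square
    mean a translate of a function differs from it by at most a multiple of the
    length of the shift times the norm of the gradient, and trivially by at most
    twice the norm of the function; the square of the smaller bound is integrable
    against the kernel ([integral_gkern_lty]). The uniqueness of weak
    derivatives, needed to compare the chosen weak gradient of a test function
    with its classical one, follows from the fundamental lemma [Lfun2_eq0]. *)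

(** * Boxes, Borel sets and translations *)

Lemma ge0_integral_invariant d (T : measurableType d) (R : realType)
    (m : {measure set T -> \bar R}) (phi : T -> T) (f : T -> \bar R) :
  measurable_fun setT phi ->
  (forall A, measurable A -> m (phi @^-1` A) = m A) ->
  measurable_fun setT f -> (forall x, 0 <= f x)%E ->
  (\int[m]_x f (phi x) = \int[m]_x f x)%E.
Proof.
move=> mphi inv mf f0.
have := ge0_integral_pushforward mphi m measurableT mf (fun x _ => f0 x).
rewrite preimage_setT /comp => <-.
pose m' : {measure set T -> \bar R} :=
  measure_function_pushforward__canonical__measure_function_Measure m mphi.
exact: (@eq_measure_integral _ _ _ setT m m' f (fun A mA _ => inv A mA)).
Qed.

Section rV_borel.
Context (R : realType) (n : nat).
Local Notation mu := (lebesgue_rV R n).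
Implicit Types (a b x h : 'rV[R]_n) (A : set 'rV[R]_n).

Definition box a b : set 'rV[R]_n :=
  [set x | forall i, a ord0 i < x ord0 i < b ord0 i].

Definition cube (r : R) : set 'rV[R]_n := box (const_mx (- r)) (const_mx r).

Lemma measurable_rV_forall (A : 'I_n -> set R) :
  (forall i, measurable (A i)) ->
  measurable [set x : 'rV[R]_n | forall i, A i (x ord0 i)].
Proof.
move=> mA.
rewrite [X in measurable X](_ : _ = \big[setI/setT]_(i < n)
    ((fun x : 'rV[R]_n => x ord0 i) @^-1` A i)).
  apply: bigsetI_measurable => i _; rewrite -[X in measurable X]setTI.
  exact: measurable_rV_coord.
apply/seteqP; split=> x /=; rewrite -bigcap_seq.
  by move=> xA i _; exact: xA.
by move=> xA i; apply: xA; rewrite /= mem_index_enum.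
Qed.

Lemma boxE a b :
  box a b = [set x | forall i, `]a ord0 i, b ord0 i[%classic (x ord0 i)].
Proof. by apply/seteqP; split => x /= h i; have := h i; rewrite /= in_itv. Qed.

Lemma measurable_box a b : measurable (box a b).
Proof.
rewrite boxE.
by apply: (measurable_rV_forall (A := fun i => `]a ord0 i, b ord0 i[%classic)).
Qed.

Lemma lebesgue_box a b :
  mu (box a b) = (\prod_(i < n) (Num.max 0 (b ord0 i - a ord0 i)))%:E.
Proof.
rewrite boxE (@lebesgue_rV_box R n (fun i => `]a ord0 i, b ord0 i[%classic)).
  rewrite -prodEFin; apply: eq_bigr => i _.
  rewrite lebesgue_measure_itv/= lte_fin -subr_gt0.
  by case: ltP => ab; rewrite -?EFinB.
by move=> i; exact: measurable_itv.
Qed.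

Lemma lebesgue_box_lty a b : (mu (box a b) < +oo)%E.
Proof. by rewrite lebesgue_box ltry. Qed.

Lemma ballE x (e : R) : 0 < e ->
  ball x e = [set y | forall i, `|x ord0 i - y ord0 i| < e].
Proof.
move=> e0; apply/seteqP; split => y /=.
  by move=> [_ xy] i; exact: xy.
by move=> xy; split => // i j; rewrite (ord1 i); exact: xy.
Qed.

(** The sigma-algebra is generated by coordinates, the topology by balls: they
    meet because boxes with rational data form a countable base. *)

Lemma open_measurable_rV A : open A -> measurable A.
Proof.
move=> oA.
pose B (c : 'rV[rat]_n * nat) : set 'rV[R]_n :=
  box (\row_i (ratr (c.1 ord0 i) - c.2.+1%:R^-1))
      (\row_i (ratr (c.1 ord0 i) + c.2.+1%:R^-1)).
rewrite [X in measurable X](_ : _ =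
    \bigcup_(c : 'rV[rat]_n * nat) (if `[< B c `<=` A >] then B c else set0)).
  apply: countable_bigcupT_measurable => // c.
  by case: ifP => _ //; exact: measurable_box.
apply/seteqP; split => [x Ax|x [c _]]; last by case: ifPn => [/asboolP H /H|_ []].
have /nbhs_ballP[e /= e0 xeA] := open_nbhs_nbhs (conj oA Ax).
have [k ke] : exists k, (k.+1%:R^-1 : R) < e / 2.
  have /ltr_add_invr[k] : 0 < e / 2 by rewrite divr_gt0.
  by rewrite add0r => ?; exists k.
have k0 : (0 : R) < k.+1%:R^-1 by rewrite invr_gt0.
set d : R := k.+1%:R^-1 in ke k0 *.
have /choice[c cx] : forall i, exists c : rat, `|ratr c - x ord0 i| < d.
  move=> i; have : x ord0 i - d < x ord0 i + d by lra.
  move=> /rat_in_itvoo[c]; rewrite in_itv/= => cx; exists c.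
  by rewrite ltr_distlC; lra.
exists (\row_i c i, k) => //=; rewrite -/d.
case: asboolP => [_ i|[]].
  by rewrite !mxE -/d; have := cx i; rewrite ltr_distlC.
move=> y By; apply: xeA; rewrite ballE//= => i.
have := By i; rewrite !mxE -/d => yi.
by have := cx i; rewrite ltr_distlC ltr_norml => ?; lra.
Qed.

Lemma closed_measurable_rV A : closed A -> measurable A.
Proof.
move=> cA; rewrite -(setCK A); apply: measurableC.
by apply: open_measurable_rV; exact: closed_openC.
Qed.

Lemma continuous_measurable_rV (f : 'rV[R]_n -> R) :
  continuous f -> measurable_fun setT f.
Proof.
move=> cf; apply: (measurability _ (@RGenOInfty.measurableE R)).
move=> _ [_ [r ->] <-]; rewrite setTI; apply: open_measurable_rV.
by apply: open_comp => // x _; exact: cf.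
Qed.

Definition boxes : set (set 'rV[R]_n) := [set A | exists a b, A = box a b].

Lemma cubeE (r : R) : cube r = [set x | forall i, - r < x ord0 i < r].
Proof. by apply/seteqP; split => x h i; have := h i; rewrite !mxE. Qed.

Lemma bigcup_cube : \bigcup_k cube k%:R = setT.
Proof.
apply/seteqP; split => // x _.
have [k xk] : exists k : nat, forall i, `|x ord0 i| < k%:R.
  exists (\max_i Num.Def.archi_bound `|x ord0 i|) => i.
  apply: lt_le_trans (_ : (Num.Def.archi_bound `|x ord0 i|)%:R <= _).
    by rewrite archi_boundP.
  by rewrite ler_nat (leq_bigmax i).
by exists k => //; rewrite cubeE => i; rewrite -ltr_norml.
Qed.

Lemma boxesI : setI_closed boxes.
Proof.
move=> _ _ [a [b ->]] [a' [b' ->]].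
exists (\row_i Num.max (a ord0 i) (a' ord0 i)).
exists (\row_i Num.min (b ord0 i) (b' ord0 i)).
apply/seteqP; split => x.
  move=> [h h'] i; rewrite !mxE; rewrite gt_max lt_min.
  by have := h i; have := h' i; lra.
by move=> h; split => i; have := h i; rewrite !mxE gt_max lt_min; lra.
Qed.

Lemma measurable_boxes : @measurable _ 'rV[R]_n = <<s boxes >>.
Proof.
apply/seteqP; split; last first.
  apply: smallest_sub; first exact: sigma_algebra_measurable.
  by move=> _ [a [b ->]]; exact: measurable_box.
have mcoord (i : 'I_n) : @measurable_fun _ _
    (g_sigma_algebraType boxes) R setT (fun x => x ord0 i).
  apply: (measurability _ (@RGenOInfty.measurableE R)).
  move=> _ [_ [r ->] <-]; rewrite setTI.
  rewrite [X in measurable X](_ : _ = \bigcup_k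
    (box (\row_j (if j == i then r else - k%:R)) (const_mx k%:R))).
    apply: bigcupT_measurable => k; apply: sub_sigma_algebra.
    by eexists; eexists; reflexivity.
  apply/seteqP; split => x /=.
    rewrite in_itv/= andbT => rx.
    have : [set: 'rV[R]_n] x by []. rewrite -bigcup_cube => -[k _].
    rewrite cubeE => xk; exists k => // j; rewrite !mxE.
    by have := xk j; case: eqP => [->|//]; lra.
  move=> [k _ /(_ i)]; rewrite !mxE eqxx in_itv/= andbT; lra.
apply: smallest_sub; first exact: smallest_sigma_algebra.
move=> A; rewrite -bigcup_seq => -[i _ [Y mY <-]].
exact: (mcoord i measurableT Y mY).
Qed.

(** Boxes form a pi-system that generates the sigma-algebra, and the space is a
    countable union of them. *)
Lemma measure_boxes_unique (m1 m2 : {measure set 'rV[R]_n -> \bar R}) :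
  (forall a b, m1 (box a b) = m2 (box a b)) ->
  (forall a b, (m1 (box a b) < +oo)%E) ->
  forall A, measurable A -> m1 A = m2 A.
Proof.
move=> m12 m1oo A mA.
apply: (@measure_unique _ _ _ boxes (fun k => cube k%:R) measurable_boxes
  boxesI _ bigcup_cube m1 m2) => //.
- by move=> i; eexists; eexists; reflexivity.
- by move=> _ [a [b ->]].
- by move=> k; exact: m1oo.
Qed.

Lemma measurable_shift h : measurable_fun setT (fun x => x + h).
Proof.
apply: measurable_fun_rVP => i; under eq_fun do rewrite mxE.
by apply: measurable_funD => //; exact: measurable_rV_coord.
Qed.

(** A translated box is a box with the same side lengths, so both measures
    agree on the pi-system of boxes. *)
Lemma lebesgue_shift h A : measurable A ->
  mu ((fun x => x + h) @^-1` A) = mu A.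
Proof.
move=> mA; rewrite -/(pushforward mu (fun x => x + h) A).
pose m : {measure set 'rV[R]_n -> \bar R} :=
  measure_function_pushforward__canonical__measure_function_Measure
    mu (measurable_shift h).
have pE a b : (fun x => x + h) @^-1` box a b = box (a - h) (b - h).
  by apply/seteqP; split => x /= H i; have := H i; rewrite !mxE; lra.
apply: (@measure_boxes_unique m mu) => // a b.
  rewrite /m /= /pushforward pE !lebesgue_box; congr (_%:E).
  by apply: eq_bigr => i _; rewrite !mxE opprB addrA subrK.
by rewrite /m /= /pushforward pE lebesgue_box_lty.
Qed.

Lemma ge0_integral_shift h (f : 'rV[R]_n -> \bar R) :
  measurable_fun setT f -> (forall x, 0 <= f x)%E ->
  (\int[mu]_x f (x + h)%R = \int[mu]_x f x)%E.
Proof.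
move=> mf f0.
apply: (ge0_integral_invariant (measurable_shift h)) => //.
exact: lebesgue_shift.
Qed.

End rV_borel.

(** * Derivatives along lines and flat functions *)

Section line_derivatives.
Context (R : realType) (n : nat).
Implicit Types (f g : 'rV[R]_n -> R) (x v : 'rV[R]_n).

(** A directional derivative is a derivative of a function of one variable,
    which is how the chain rule and the mean value theorem are applied here. *)
Lemma is_derive_line f x v (t df : R) :
  is_derive (t *: v + x) v f df <-> is_derive t 1 (fun h => f (h *: v + x)) df.
Proof.
have E : (fun h : R => h^-1 *: (f (h *: v + (t *: v + x)) - f (t *: v + x))) =
    (fun h : R => h^-1 *: (f ((h *: (1 : R^o) + t) *: v + x) - f (t *: v + x))).
  by apply/funext => h; rewrite scalerDl addrA [h *: (1 : R^o)]mulr1.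
have D : derivable f (t *: v + x) v =
    derivable (fun h : R => f (h *: v + x)) t 1.
  by rewrite /derivable E.
have D' : 'D_v f (t *: v + x) = 'D_1 (fun h : R => f (h *: v + x)) t.
  by rewrite /derive E.
split => -[d1 d2].
  by constructor; [rewrite -D|rewrite -D'].
by constructor; [rewrite D|rewrite D'].
Qed.

Lemma is_derive_line0 f x v (df : R) :
  is_derive x v f df <-> is_derive (0 : R) 1 (fun h : R => f (h *: v + x)) df.
Proof. by rewrite -is_derive_line scale0r add0r. Qed.

Lemma is_derive_comp_line (G : R -> R) f x v (dG df : R) :
  is_derive (f x) 1 G dG -> is_derive x v f df ->
  is_derive x v (fun y => G (f y)) (dG * df).
Proof.
move=> hG /is_derive_line0 hf; apply/is_derive_line0.
apply: (is_derive1_comp (f := G) (g := fun h : R => f (h *: v + x))) hf.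
by rewrite scale0r add0r.
Qed.

Lemma is_derive_coord (i j : 'I_n) x :
  is_derive x (delta_mx ord0 j : 'rV[R]_n) (fun y => y ord0 i) (i == j)%:R.
Proof.
apply/is_derive_line0.
have -> : (fun h : R => (h *: (delta_mx ord0 j : 'rV[R]_n) + x) ord0 i) =
    ((i == j)%:R \*: (@id R^o) + cst (x ord0 i)).
  apply/funext => h; rewrite !mxE eqxx/= fctE/= [in RHS]/GRing.scale/= mulrC.
  by rewrite eq_sym.
by apply: is_derive_eq; rewrite addr0 [_ *: _]mulr1.
Qed.

End line_derivatives.

Section flat.
Context (R : realType).

(** The classical function that vanishes to infinite order at the origin. The
    powers of the inverse make the family closed under differentiation. *)
Definition flat (k : nat) (t : R) : R :=
  if 0 < t then t^-1 ^+ k * expR (- t^-1) else 0.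

Lemma flat_ge0 k t : 0 <= flat k t.
Proof.
rewrite /flat; case: ifP => // t0.
by rewrite mulr_ge0 ?expR_ge0// exprn_ge0// invr_ge0 ltW.
Qed.

Lemma flat0_le1 t : flat 0 t <= 1.
Proof.
rewrite /flat; case: ifP => // t0; rewrite expr0 mul1r -expR0 ler_expR.
by rewrite oppr_le0 invr_ge0 ltW.
Qed.

(** Comparing the exponential with one term of its series makes the difference
    quotients at the origin tend to zero. *)
Lemma flat_le k (t : R) : 0 < t -> flat k t <= (k.+2)`!%:R * t ^+ 2.
Proof.
move=> t0; rewrite /flat t0 expRN.
have u0 : 0 < t^-1 by rewrite invr_gt0.
have := expR_ge1Dxn k.+1 (ltW u0); set u := t^-1 in u0 *.
have F0 : 0 < (k.+2)`!%:R :> R by rewrite ltr0n fact_gt0.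
move=> H; rewrite ler_pdivrMr ?expR_gt0//.
apply: le_trans (_ : (k.+2)`!%:R * t ^+ 2 * (u ^+ k.+2 / (k.+2)`!%:R) <= _);
  last first.
  rewrite ler_pM2l ?mulr_gt0 ?exprn_gt0//; apply: le_trans H.
  by rewrite lerDr.
have -> : (k.+2)`!%:R * t ^+ 2 * (u ^+ k.+2 / (k.+2)`!%:R) =
    u ^+ k * ((t * u) ^+ 2) * ((k.+2)`!%:R / (k.+2)`!%:R).
  by rewrite -addn2 exprD exprMn; ring.
by rewrite /u !mulfV ?gt_eqF// expr1n !mulr1.
Qed.

Lemma is_derive_flat k (t : R) :
  is_derive t 1 (flat k) (flat k.+2 t - k%:R * flat k.+1 t).
Proof.
have [t0|t0|t0] := ltgtP t 0.
- have -> : flat k.+2 t - k%:R * flat k.+1 t = 0.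
    by rewrite /flat ltNge (ltW t0)/= mulr0 subr0.
  have E : \near t, cst 0 t = flat k t.
    near=> y; rewrite /flat ltNge ltW//.
    by near: y; exact: lt_nbhsl.
  exact: (near_eq_is_derive E (is_derive_cst _ _ _)).
- have E : \near t, t^-1 ^+ k * expR (- t^-1) = flat k t.
    near=> y; rewrite /flat ifT//.
    by near: y; exact: lt_nbhsr.
  apply: (near_eq_is_derive E).
  have dV : is_derive t 1 (fun y : R => y^-1) (- t ^- 2).
    have := @is_deriveV R id t 1 1 (lt0r_neq0 t0) (is_derive_id _ _).
    by rewrite [_ *: _]mulr1.
  have d1 : is_derive t 1 (fun y : R => y^-1 ^+ k)
      ((k%:R * t^-1 ^+ k.-1) * (- t ^- 2)).
    by have := is_deriveX k dV; rewrite exprfctE.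
  have d2 : is_derive t 1 (fun y : R => expR (- y^-1)) (expR (- t^-1) * t ^- 2).
    have := is_derive1_comp (is_derive_expR _) (is_deriveN dV).
    by rewrite opprK.
  have := is_deriveM d1 d2; rewrite mulrfctE => /is_derive_eq; apply.
  rewrite /flat t0 /GRing.scale/= -exprVn; set e := expR _; set u := t^-1.
  clearbody e u.
  case: k {d1 E} => [|k] /=; first by ring.
  by rewrite !exprS; ring.
- rewrite t0 {2 3}/flat ltxx mulr0 subr0.
  have f0 : flat k 0 = 0 by rewrite /flat ltxx.
  have L : (h^-1 *: (flat k (h *: 1 + 0) - flat k 0)) @[h --> 0^'] --> (0 : R).
    apply/cvgr0Pnorm_le => e e0.
    near=> h.
    rewrite f0 subr0 addr0 [h *: _]mulr1 normrZ normfV.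
    have h0 : h != 0 by near: h; exact: nbhs_dnbhs_neq.
    rewrite ler_pdivrMl ?normr_gt0// ger0_norm ?flat_ge0//.
    have [hp|hn] := ltP 0 h; last by rewrite /flat ltNge hn/= mulr_ge0// ltW.
    apply: le_trans (flat_le k hp) _; rewrite gtr0_norm// expr2 mulrA mulrC.
    rewrite ler_pM2l// -ler_pdivlMl ?ltr0n ?fact_gt0// mulrC.
    apply: le_trans (ler_norm _) _.
    near: h; apply: dnbhs0_le.
    by rewrite divr_gt0// ltr0n fact_gt0.
  constructor; first by apply/cvg_ex; exists 0.
  by rewrite /derive; apply/cvg_lim.
Unshelve. all: by end_near. Qed.

End flat.

(** * A class of smooth functions closed under differentiation *)

Section smooth_class.
Context (R : realType) (n : nat).
Implicit Types (f g : 'rV[R]_n -> R) (x v : 'rV[R]_n).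

(** Iterated partial derivatives of sums, products and compositions are awkward
    to handle one by one. This class contains all smooth functions and the
    constructions needed below, and the partial derivatives of its members are
    again members, so membership gives smoothness by induction on the order. *)
Inductive elementary_smooth : ('rV[R]_n -> R) -> Prop :=
| es_smooth f : smooth_on setT f -> elementary_smooth f
| es_cst c : elementary_smooth (fun _ => c)
| es_coord i : elementary_smooth (fun x => x ord0 i)
| es_add f g : elementary_smooth f -> elementary_smooth g ->
    elementary_smooth (fun x => f x + g x)
| es_mul f g : elementary_smooth f -> elementary_smooth g ->
    elementary_smooth (fun x => f x * g x)
| es_powR f a : elementary_smooth f -> (forall x, 0 < f x) ->
    elementary_smooth (fun x => f x `^ a)
| es_flat f k : elementary_smooth f ->
    elementary_smooth (fun x => flat k (f x)).

Let deriv f df (i : 'I_n) := forall x, is_derive x (delta_mx ord0 i) f (df x).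

Let derivE f df i : deriv f df i -> partial i f = df.
Proof. by move=> d; apply/funext => x; have [_ <-] := d x. Qed.

Lemma is_derive1_continuous (G : R -> R) (t dG : R) :
  is_derive t 1 G dG -> {for t, continuous G}.
Proof. by move=> [d _]; apply: differentiable_continuous; exact/derivable1_diffP. Qed.

(** By induction on membership, the usual rules of differentiation compute the
    partial derivatives and exhibit them as members. *)
Lemma elementary_smooth_step f : elementary_smooth f -> continuous f /\
  forall i, exists2 df, elementary_smooth df & deriv f df i.
Proof.
elim=> {f}
  [f sf|c|i|f g _ [cf df] _ [cg dg]|f g sf [cf df] sg [cg dg]
  |f a sf [cf df] f0|f k sf [cf df]].
- split=> [x|i]; first exact: (sf [::] x I).1.
  exists (partial i f) => [|x].
    apply: es_smooth => l x _; have := sf (rcons l i) x I.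
    by rewrite /iter_partial foldr_rcons.
  apply: DeriveDef => //; exact: (sf [::] x I).2.
- split=> [|i]; first exact: cst_continuous.
  by exists (fun _ => 0); [exact: es_cst|move=> x; exact: is_derive_cst].
- split=> [|j]; first exact: coord_continuous.
  exists (fun _ => (i == j)%:R); first exact: es_cst.
  by move=> x; exact: is_derive_coord.
- split=> [x|i]; first exact: (continuousD (cf x) (cg x)).
  have [df' sdf hf] := df i; have [dg' sdg hg] := dg i.
  exists (fun x => df' x + dg' x); first exact: es_add.
  by move=> x; exact: (is_deriveD (hf x) (hg x)).
- split=> [x|i]; first exact: (continuousM (cf x) (cg x)).
  have [df' sdf hf] := df i; have [dg' sdg hg] := dg i.
  exists (fun x => f x * dg' x + g x * df' x).
    by apply: es_add; exact: es_mul.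
  by move=> x; exact: (is_deriveM (hf x) (hg x)).
- have D x := is_derive1_powR a (f0 x).
  split=> [x|i].
    exact: (continuous_comp (cf x) (is_derive1_continuous (D x))).
  have [df' sdf hf] := df i.
  exists (fun x => a * f x `^ (a - 1) * df' x).
    by apply: es_mul => //; apply: es_mul; [exact: es_cst|exact: es_powR].
  by move=> x; exact: is_derive_comp_line (D x) (hf x).
- have D (t : R) := @is_derive_flat R k t.
  split=> [x|i].
    have := continuous_comp (cf x) (is_derive1_continuous (D (f x))). exact.
  have [df' sdf hf] := df i.
  exists (fun x => (flat k.+2 (f x) + (- k%:R) * flat k.+1 (f x)) * df' x).
    apply: es_mul => //; apply: es_add; first exact: es_flat.
    by apply: es_mul; [exact: es_cst|exact: es_flat].
  by move=> x; rewrite mulNr; exact: is_derive_comp_line (D _) (hf x).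
Qed.

Lemma elementary_smooth_continuous f : elementary_smooth f -> continuous f.
Proof. by move=> /elementary_smooth_step[]. Qed.

Lemma elementary_smooth_is_partial f i x : elementary_smooth f ->
  is_derive x (delta_mx ord0 i) f (partial i f x).
Proof.
by move=> /elementary_smooth_step[_ /(_ i)[df _ hf]]; rewrite (derivE hf).
Qed.

Lemma elementary_smooth_partial f i :
  elementary_smooth f -> elementary_smooth (partial i f).
Proof.
by move=> /elementary_smooth_step[_ /(_ i)[df sdf hf]]; rewrite (derivE hf).
Qed.

Lemma elementary_smooth_on f : elementary_smooth f -> smooth_on setT f.
Proof.
move=> sf l x _.
have sl : elementary_smooth (iter_partial l f).
  by elim: l => //= i l IH; exact: elementary_smooth_partial.
split=> [|i]; first exact: elementary_smooth_continuous.
by have [] := elementary_smooth_is_partial i x sl.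
Qed.

Lemma elementary_smooth_prod (I : Type) (r : seq I) (F : I -> 'rV[R]_n -> R) :
  (forall i, elementary_smooth (F i)) ->
  elementary_smooth (fun x => \prod_(i <- r) F i x).
Proof.
move=> sF; elim: r => [|i r IH].
  by under eq_fun do rewrite big_nil; exact: es_cst.
by under eq_fun do rewrite big_cons; exact: es_mul.
Qed.

End smooth_class.

(** * Square integrable and compactly supported smooth functions *)

Lemma integrable_indic_lty d (T : measurableType d) (R : realType)
    (m : {measure set T -> \bar R}) (A : set T) :
  measurable A -> (m A < +oo)%E -> m.-integrable setT (fun x => (\1_A x)%:E).
Proof.
move=> mA Aoo; apply/integrableP; split; first exact/measurable_EFinP.
under eq_integral => x _ do rewrite gee0_abs ?lee_fin//.
by rewrite integral_indic// setIT.
Qed.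

Lemma integrable_cst1 d (T : measurableType d) (R : realType)
    (m : {measure set T -> \bar R}) (D : set T) :
  measurable D -> (m D < +oo)%E -> m.-integrable D (EFin \o (cst 1 : T -> R)).
Proof.
move=> mD Doo.
apply/integrableP; split; first by apply/measurable_EFinP.
by under eq_integral do rewrite /= normr1; rewrite integral_cst// mul1e.
Qed.

Lemma Lfun2_intro d (T : measurableType d) (R : realType)
    (m : {measure set T -> \bar R}) (f : T -> R) :
  measurable_fun setT f ->
  (\int[m]_x ((f x) ^+ 2)%:E < +oo)%E -> f \in Lfun m 2%:E.
Proof.
move=> mf f2; rewrite inE; apply/andP; split; rewrite inE//=.
rewrite /finite_norm (@lty_poweRy _ _ 2)// powR_Lnorm//.
under eq_integral => x _.
  by rewrite /= powR_mulrn// -normrX ger0_norm ?sqr_ge0//; over.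
exact: f2.
Qed.

Lemma Lfun2_measurable d (T : measurableType d) (R : realType)
    (m : {measure set T -> \bar R}) (f : T -> R) :
  f \in Lfun m 2%:E -> measurable_fun setT f.
Proof. by rewrite inE => /andP[/[!inE]/=]. Qed.

Lemma Lfun2_lty d (T : measurableType d) (R : realType)
    (m : {measure set T -> \bar R}) (f : T -> R) :
  f \in Lfun m 2%:E -> (\int[m]_x ((f x) ^+ 2)%:E < +oo)%E.
Proof.
move=> /Lfun2_integrable_sqr/integrableP[_].
by under eq_integral => x _ do rewrite gee0_abs ?lee_fin ?sqr_ge0//.
Qed.

Lemma sqr_sum_le (R : realFieldType) (k : nat) (a : 'I_k -> R) :
  (\sum_(i < k) a i) ^+ 2 <= k%:R * \sum_(i < k) (a i) ^+ 2.
Proof.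
elim: k a => [|k IH] a; first by rewrite !big_ord0 mulr0 expr0n.
rewrite !big_ord_recr/=; have := IH (fun i => a (widen_ord (leqnSn k) i)).
set s := \sum_(i < k) _; set S := \sum_(i < k) _; set b := a ord_max => H.
have S0 : 0 <= S by apply: sumr_ge0 => i _; exact: sqr_ge0.
rewrite -natr1; have : 0 <= k%:R :> R by [].
move: k%:R H => K; clearbody s S b => H.
rewrite le_eqVlt => /predU1P[K0|K0].
  move: H; rewrite -K0 mul0r => s0; have -> : s = 0.
    by apply/eqP; rewrite -sqrf_eq0 eq_le s0 sqr_ge0.
  by rewrite !add0r mul1r; lra.
have sq : 0 <= (s - K * b) ^+ 2 by exact: sqr_ge0.
have : K * (s + b) ^+ 2 <= K * ((K + 1) * (S + b ^+ 2)) by nra.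
by rewrite ler_pM2l.
Qed.

Section compactly_supported.
Context (R : realType) (n : nat).
Local Notation mu := (lebesgue_rV R n).
Implicit Types (f g : 'rV[R]_n -> R) (x v h : 'rV[R]_n).

(** The test functions, without reference to a domain: a set inside some cube
    has compact closure. *)
Definition Cc f := elementary_smooth f /\
  exists r, forall x, f x != 0 -> cube r x.

Lemma cube_bounded r : bounded_set (@cube R n r).
Proof.
exists (Num.max r 0); split; first exact: num_real.
move=> M; rewrite gt_max => /andP[rM M0] x; rewrite cubeE => xr.
have [n0|n0] := leP `|x| 0; first exact: le_trans n0 (ltW M0).
have /mx_norm_neq0[i xi] : mx_norm x != 0 by rewrite gt_eqF.
rewrite /= [`|x|]xi (ord1 i.1); apply: ltW; apply: lt_trans rM.
by rewrite ltr_norml.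
Qed.

Lemma bounded_cube (A : set 'rV[R]_n) : bounded_set A ->
  exists r, A `<=` cube r.
Proof.
move=> [M [_ MA]]; exists (M + 2) => x Ax; rewrite cubeE => i.
have xM : `|x| <= M + 1 by apply: MA => //; rewrite ltrDl.
rewrite -ltr_norml; apply: le_lt_trans (_ : M + 1 < _); last by lra.
apply: le_trans xM; rewrite [leRHS]mx_normrE.
by apply/bigmax_geP; right; exists (ord0, i).
Qed.

Definition ccube (r : R) : set 'rV[R]_n := [set x | forall i, `|x ord0 i| <= r].

Lemma cube_ccube r : cube r `<=` ccube r.
Proof. by move=> x; rewrite cubeE => xr i; rewrite ler_norml; have := xr i; lra. Qed.

Lemma ccube_cube r : ccube r `<=` cube (r + 1).
Proof. by move=> x xr; rewrite cubeE => i; have := xr i; rewrite ler_norml; lra. Qed.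

Lemma closed_ccube r : closed (ccube r).
Proof.
have -> : ccube r = \bigcap_(i in setT)
    ((fun x : 'rV[R]_n => x ord0 i) @^-1` [set t | `|t| <= r]).
  by apply/seteqP; split => [x xr i _|x xr i]; [exact: xr|exact: (xr i I)].
apply: closed_bigI => i _; apply: closed_comp => [x _|].
  exact: coord_continuous.
rewrite (_ : mkset _ = `[- r, r]%classic); first exact: itv_closed.
by apply/seteqP; split => t /=; rewrite in_itv/= ler_norml.
Qed.

Lemma compact_ccube r : compact (ccube r).
Proof.
apply: bounded_closed_compact; last exact: closed_ccube.
have [M [M1 M2]] := @cube_bounded (r + 1).
by exists M; split => // k /M2 H x /ccube_cube; exact: H.
Qed.

Lemma test_function_Cc A f : test_function A f -> Cc f.
Proof.
move=> [sf /compact_bounded/bounded_cube[r rf] _]; split; first exact: es_smooth.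
by exists r => x fx; apply: rf; exact: subset_closure.
Qed.

Lemma Cc_test_function f A : Cc f -> closure [set x | f x != 0] `<=` A ->
  test_function A f.
Proof.
move=> [sf [r rf]] fA; split => //; first exact: elementary_smooth_on.
apply: (@subclosed_compact _ _ (ccube r)) => //.
- exact: closed_closure.
- exact: compact_ccube.
rewrite [X in _ `<=` X](closure_id _).1; last exact: closed_ccube.
by apply: closureS => x fx; apply: cube_ccube; exact: rf.
Qed.

Lemma Cc_test_functionT f : Cc f -> test_function setT f.
Proof. by move=> cf; exact: Cc_test_function. Qed.

Lemma Cc_add f g : Cc f -> Cc g -> Cc (fun x => f x + g x).
Proof.
move=> [sf [r rf]] [sg [s sg']]; split; first exact: es_add.
exists (Num.max r s) => x fg.
have [f0|/rf] := eqVneq (f x) 0; last first.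
  by rewrite !cubeE => H i; have := H i; case: (leP r s); lra.
have /sg' : g x != 0 by apply: contra_neq fg => ->; rewrite f0 addr0.
by rewrite !cubeE => H i; have := H i; case: (leP r s); lra.
Qed.

Lemma Cc_mul f g : Cc f -> elementary_smooth g -> Cc (fun x => f x * g x).
Proof.
move=> [sf [r rf]] sg; split; first exact: es_mul.
by exists r => x; rewrite mulf_eq0 negb_or => /andP[/rf].
Qed.

Lemma Cc_scale (c : R) f : Cc f -> Cc (fun x => c * f x).
Proof.
move=> [sf [r rf]]; split; first by apply: es_mul => //; exact: es_cst.
by exists r => x; rewrite mulf_eq0 negb_or => /andP[_ /rf].
Qed.

Lemma Cc_sub f g : Cc f -> Cc g -> Cc (fun x => f x - g x).
Proof.
move=> cf cg; have := Cc_add cf (Cc_scale (-1) cg).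
by under eq_fun do rewrite mulN1r.
Qed.

Lemma partial_locally0 f i x : (\forall y \near x, f y = 0) -> partial i f x = 0.
Proof.
move=> f0; rewrite /partial (near_eq_derive (g := cst 0)) ?derive_cst//.
Qed.

(** Off the closed support the function vanishes near the point. *)
Lemma partial_support f i :
  [set x | partial i f x != 0] `<=` closure [set x | f x != 0].
Proof.
move=> x /= fx; apply: contrapT => nx; move/negP: fx; apply; apply/eqP.
apply: partial_locally0.
have : (~` closure [set x | f x != 0]) x by [].
have oC : open (~` closure [set x | f x != 0]).
  by apply: closed_openC; exact: closed_closure.
move=> /(conj oC)/open_nbhs_nbhs; apply: filterS => y /= ny.
by apply/eqP; apply: contrapT => /negP fy; apply: ny; exact: subset_closure.
Qed.

Lemma Cc_partial f i : Cc f -> Cc (partial i f).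
Proof.
move=> [sf [r rf]]; split; first exact: elementary_smooth_partial.
exists (r + 1) => x /partial_support fx; apply: ccube_cube.
rewrite [X in X x](closure_id _).1; last exact: closed_ccube.
by apply: closureS fx => y fy; apply: cube_ccube; exact: rf.
Qed.

Lemma Cc_continuous f : Cc f -> continuous f.
Proof. by move=> [sf _]; exact: elementary_smooth_continuous. Qed.

Lemma Cc_measurable f : Cc f -> measurable_fun setT f.
Proof. by move=> cf; apply: continuous_measurable_rV; exact: Cc_continuous. Qed.

Lemma Cc_le f : Cc f -> exists2 M, 0 <= M & forall x, `|f x| <= M.
Proof.
move=> cf; have [_ [r rf]] := cf.
have /compact_bounded[M [_ MA]] : compact (f @` ccube r).
  apply: continuous_compact; last exact: compact_ccube.
  by apply: continuous_subspaceT; exact: Cc_continuous.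
exists (`|M| + 1) => [|x]; first by rewrite addr_ge0.
have [->|fx] := eqVneq (f x) 0; first by rewrite normr0 addr_ge0.
apply: MA; last by exists x => //; apply: cube_ccube; exact: rf.
by rewrite ltr_pwDr// ler_norm.
Qed.

Lemma measurable_cube r : measurable (@cube R n r).
Proof. exact: measurable_box. Qed.

Lemma integrable_cube (M r : R) :
  mu.-integrable setT (fun x => (M * \1_(@cube R n r) x)%:E).
Proof.
have : mu.-integrable setT (fun x => M%:E * (\1_(@cube R n r) x)%:E)%E.
  apply: integrableZl => //; apply: integrable_indic_lty; [exact: measurable_cube|].
  exact: lebesgue_box_lty.
by under eq_fun do rewrite -EFinM.
Qed.

Lemma integrable_cube_le f (M r : R) : measurable_fun setT f ->
  (forall x, `|f x| <= M * \1_(@cube R n r) x) ->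
  mu.-integrable setT (EFin \o f).
Proof.
move=> mf fM; apply: (le_integrable _ _ _ (integrable_cube M r)) => //.
  exact/measurable_EFinP.
by move=> x _; rewrite /= lee_fin (le_trans (fM x))// ler_norm.
Qed.

Lemma Cc_le_cube f : Cc f ->
  exists M r, 0 <= M /\ forall x, `|f x| <= M * \1_(@cube R n r) x.
Proof.
move=> cf; have [M M0 fM] := Cc_le cf; have [_ [r rf]] := cf.
exists M, r; split=> // x; rewrite indicE.
have [->|/rf xr] := eqVneq (f x) 0; first by rewrite normr0 mulr_ge0.
by rewrite mem_set// mulr1.
Qed.

Lemma Cc_integrable f : Cc f -> mu.-integrable setT (EFin \o f).
Proof.
move=> cf; have [M [r [_ fM]]] := Cc_le_cube cf.
by apply: integrable_cube_le fM; exact: Cc_measurable.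
Qed.

Lemma Cc_sqr f : Cc f -> Cc (fun x => f x ^+ 2).
Proof. by move=> cf; have [sf _] := cf; exact: Cc_mul. Qed.

Lemma Cc_Lfun2 f : Cc f -> f \in Lfun mu 2%:E.
Proof.
move=> cf; apply: Lfun2_intro; first exact: Cc_measurable.
have /integrableP[_] := Cc_integrable (Cc_sqr cf).
congr (_ < _)%E; apply: eq_integral => x _.
by rewrite /= ger0_norm ?sqr_ge0.
Qed.

End compactly_supported.

(** * Difference quotients and translations *)

Lemma sume_cst_ge0 (R : realType) (k : nat) (a : \bar R) : (0 <= a)%E ->
  (\sum_(j < k) a = k%:R%:E * a)%E.
Proof.
move=> a0; elim: k => [|k IH]; first by rewrite big_ord0 mul0e.
by rewrite big_ord_recr/= IH -natr1 EFinD ge0_muleDl ?mul1e ?lee_fin.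
Qed.

Lemma EFin_cvg (R : realType) (u : nat -> R) (l : R) :
  u k @[k --> \oo] --> l -> ((u k)%:E @[k --> \oo] --> l%:E)%E.
Proof. by move=> ul; apply: cvg_EFin => //; exact: nearW. Qed.

Lemma Rintegral_invariant d (T : measurableType d) (R : realType)
    (m : {measure set T -> \bar R}) (phi : T -> T) (f : T -> R) :
  measurable_fun setT phi ->
  (forall A, measurable A -> m (phi @^-1` A) = m A) ->
  m.-integrable setT (EFin \o f) ->
  (m.-integrable setT (fun x => (f (phi x))%:E) /\
  \int[m]_x f (phi x) = \int[m]_x f x).
Proof.
move=> mphi inv intf; have /integrableP[mf foo] := intf.
have intfphi : m.-integrable setT (fun x => (f (phi x))%:E).
  apply/integrableP; split; first exact: (measurableT_comp mf mphi).
  rewrite (ge0_integral_invariant (f := fun x => `|(f x)%:E|%E) mphi inv)//.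
  exact: measurableT_comp.
split => //; rewrite /Rintegral; congr fine.
pose m' : {measure set T -> \bar R} :=
  measure_function_pushforward__canonical__measure_function_Measure m mphi.
rewrite -(@eq_measure_integral _ _ _ setT m m' (EFin \o f)
  (fun A mA _ => inv A mA)).
by rewrite (integral_pushforward mphi (D := setT))//= preimage_setT.
Qed.

Lemma dominated_Rintegral d (T : measurableType d) (R : realType)
    (m : {measure set T -> \bar R}) (D : set T) (F : nat -> T -> R)
    (f g : T -> R) :
  measurable D -> (forall k, measurable_fun D (F k)) -> measurable_fun D f ->
  {ae m, forall x, D x -> F k x @[k --> \oo] --> f x} ->
  m.-integrable D (EFin \o g) ->
  {ae m, forall x k, D x -> `|F k x| <= g x} ->
  \int[m]_(x in D) F k x @[k --> \oo] --> \int[m]_(x in D) f x.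
Proof.
move=> mD mF mf Ff ig Fg.
have Ff' : {ae m, forall x, D x -> (F k x)%:E @[k --> \oo] --> (f x)%:E}%E.
  by apply: filterS Ff => x H Dx; exact: EFin_cvg (H Dx).
have Fg' : {ae m, forall x k, D x -> `|(F k x)%:E| <= (EFin \o g) x}%E.
  by apply: filterS Fg => x H k Dx; rewrite lee_fin; exact: H.
have [intf _ L] := @dominated_convergence _ _ _ m D mD
  (fun k x => (F k x)%:E) (EFin \o f) (EFin \o g)
  (fun k => (measurable_EFinP _ _).2 (mF k))
  ((measurable_EFinP _ _).2 mf) Ff' ig Fg'.
apply: fine_cvg; rewrite fineK; first exact: L.
exact: integrable_fin_num.
Qed.

Section square_integral.
Context d (T : measurableType d) (R : realType).
Variable m : {measure set T -> \bar R}.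
Implicit Types f g : T -> R.
Local Open Scope ereal_scope.

Definition L2sq f : \bar R := \int[m]_x ((f x) ^+ 2)%:E.

Lemma L2sq_ge0 f : 0 <= L2sq f.
Proof. by apply: integral_ge0 => x _; rewrite lee_fin sqr_ge0. Qed.

Lemma measurable_sqr f : measurable_fun setT f ->
  measurable_fun setT (fun x => ((f x) ^+ 2)%:E).
Proof. by move=> mf; apply/measurable_EFinP; exact: measurable_funX. Qed.

Lemma L2sq_scale c f : measurable_fun setT f ->
  L2sq (fun x => c * f x)%R = (c ^+ 2)%:E * L2sq f.
Proof.
move=> mf; rewrite /L2sq -ge0_integralZl_EFin//.
- by apply: eq_integral => x _; rewrite exprMn EFinM.
- by move=> x _; rewrite lee_fin sqr_ge0.
- exact: measurable_sqr.
- exact: sqr_ge0.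
Qed.

Lemma L2sq_sum_le k (a : 'I_k -> T -> R) :
  (forall j, measurable_fun setT (a j)) ->
  L2sq (fun x => \sum_(j < k) a j x)%R <= k%:R%:E * \sum_(j < k) L2sq (a j).
Proof.
move=> ma.
rewrite /L2sq -ge0_integral_sum//; last 2 first.
- by move=> j; exact: measurable_sqr.
- by move=> j x _; rewrite lee_fin sqr_ge0.
rewrite -ge0_integralZl_EFin//; last 2 first.
- by move=> x _; rewrite sume_ge0// => j _; rewrite lee_fin sqr_ge0.
- by apply: emeasurable_sum => j; exact: measurable_sqr.
apply: ge0_le_integral => //.
- by move=> x _; rewrite lee_fin sqr_ge0.
- by apply: measurable_sqr; exact: measurable_sum.
- apply: emeasurable_funM => //.
  by apply: emeasurable_sum => j; exact: measurable_sqr.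
by move=> x _; rewrite sumEFin -EFinM lee_fin sqr_sum_le.
Qed.

Lemma L2sq_add_le f g : measurable_fun setT f -> measurable_fun setT g ->
  L2sq (fun x => f x + g x)%R <= 2%:E * L2sq f + 2%:E * L2sq g.
Proof.
move=> mf mg; pose a (j : 'I_2) := if j == ord0 then f else g.
have -> : (fun x => f x + g x)%R = (fun x => \sum_(j < 2) a j x)%R.
  by apply/funext => x; rewrite !big_ord_recl big_ord0/= addr0.
apply: le_trans (L2sq_sum_le _) _; first by move=> j; rewrite /a; case: eqP.
by rewrite !big_ord_recl big_ord0/= adde0 ge0_muleDr ?L2sq_ge0.
Qed.

End square_integral.

Section difference_quotients.
Context (R : realType) (n : nat).
Local Notation mu := (lebesgue_rV R n).
Local Notation e i := (delta_mx ord0 i : 'rV[R]_n).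
Implicit Types (f g : 'rV[R]_n -> R) (x v h : 'rV[R]_n).

Lemma Cc_lipschitz f i : Cc f -> exists2 L, 0 <= L &
  forall x d, `|f (x + d *: e i) - f x| <= L * `|d|.
Proof.
move=> cf; have [L L0 fL] := Cc_le (Cc_partial i cf).
exists L => // x d; have [sf _] := cf.
have D (t : R) : is_derive t 1 (fun u : R => f (u *: e i + x))
    (partial i f (t *: e i + x)).
  by apply/is_derive_line; exact: elementary_smooth_is_partial.
have C (a b : R) : {within `[a, b], continuous (fun u : R => f (u *: e i + x))}.
  apply: continuous_subspaceT => t.
  exact: is_derive1_continuous (D t).
have E (t : R) : f (t *: e i + x) = f (x + t *: e i) by rewrite addrC.
have E0 : f (0 *: e i + x) = f x by rewrite scale0r add0r.
have [d0|d0] := leP 0 d.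
  have [c _] := MVT_segment d0 (fun t _ => D t) (C 0 d).
  by rewrite E0 E subr0 => ->; rewrite normrM ler_wpM2r.
have [c _] := MVT_segment (ltW d0) (fun t _ => D t) (C d 0).
rewrite E0 E sub0r distrC => ->.
by rewrite normrM normrN ler_wpM2r.
Qed.

(** The difference quotient with step [t / k.+1], normalized so that its limit
    is [t] times the partial derivative and [t = 0] needs no exception. *)
Definition quot f i (t : R) (k : nat) x : R :=
  k.+1%:R * (f (x + (t / k.+1%:R) *: e i) - f x).

(** The Lipschitz bound controls the quotients near the support, and all the
    steps have length at most [`|t|]; this dominates the whole sequence. *)
Lemma quot_le f i t : Cc f -> exists M r, 0 <= M /\
  forall k x, `|quot f i t k x| <= M * \1_(@cube R n r) x.
Proof.
move=> cf; have [L L0 fL] := Cc_lipschitz i cf; have [_ [r rf]] := cf.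
exists (L * `|t|), (r + `|t|); split=> [|k x]; first exact: mulr_ge0.
have k0 : 0 < k.+1%:R :> R by rewrite ltr0n.
rewrite indicE; case: (boolP (x \in cube (r + `|t|))) => [_|xr].
  rewrite mulr1 /quot normrM gtr0_norm// -ler_pdivlMl//.
  apply: le_trans (fL _ _) _.
  by rewrite normrM normfV (gtr0_norm k0) mulrA mulrC.
have H0 (y : 'rV[R]_n) : (forall i, `|y ord0 i - x ord0 i| <= `|t|) -> f y = 0.
  move=> yx; apply/eqP; apply: contraT => /rf; rewrite cubeE => yr.
  move/negP: xr; case; apply/mem_set; rewrite cubeE => j.
  by have := yx j; have := yr j; rewrite ler_norml; lra.
rewrite /quot !H0 ?subrr ?mulr0 ?normr0// => j; first by rewrite subrr normr0.
rewrite !mxE eqxx/= addrAC subrr add0r normrM.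
apply: le_trans (_ : `|t / k.+1%:R| * 1 <= _).
  by apply: ler_wpM2l => //; case: eqP => _; rewrite ?normr1 ?normr0.
rewrite mulr1 normrM normfV (gtr0_norm k0) ler_pdivrMr//.
by rewrite ler_peMr// ler1n.
Qed.

Lemma quot_cvg f i t x : Cc f ->
  quot f i t k x @[k --> \oo] --> t * partial i f x.
Proof.
move=> [sf _]; have [->|t0] := eqVneq t 0.
  rewrite mul0r (_ : (fun k => _) = cst 0); first exact: cvg_cst.
  by apply/funext => k; rewrite /quot !mul0r scale0r addr0 subrr mulr0.
have [D DE] := elementary_smooth_is_partial i x sf.
have : (fun u : R => u^-1 *: (f (u *: e i + x) - f x)) @ 0^' --> partial i f x.
  by rewrite -[X in _ --> X]DE; exact: D.
move=> /cvgr_dnbhsP/(_ (fun k => t / k.+1%:R)) H.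
have {}H : ((t / k.+1%:R)^-1 *: (f ((t / k.+1%:R) *: e i + x) - f x))
    @[k --> \oo] --> partial i f x.
  apply: H; split => [k|].
    by rewrite mulf_neq0// invr_eq0 pnatr_eq0.
  rewrite -[X in _ --> X](mulr0 t).
  by apply: cvgM; [exact: cvg_cst|exact: cvg_harmonic].
rewrite (_ : (fun k => _) =
    (fun k => t * ((t / k.+1%:R)^-1 *: (f ((t / k.+1%:R) *: e i + x) - f x)))).
  by apply: cvgM => //; exact: cvg_cst.
apply/funext => k; rewrite /quot /GRing.scale/= mulrA; congr (_ * (f _ - _)).
  by rewrite invfM invrK mulrA mulfV// mul1r.
by rewrite addrC.
Qed.

Lemma shift_measurable f h : measurable_fun setT f ->
  measurable_fun setT (fun x => f (x + h)).
Proof. by move=> mf; exact: (measurableT_comp mf (measurable_shift h)). Qed.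

Lemma quot_measurable f i t k : Cc f -> measurable_fun setT (quot f i t k).
Proof.
move=> /Cc_measurable mf.
by apply: measurable_funM => //; apply: measurable_funB => //; exact: shift_measurable.
Qed.

Lemma Rintegral_shift h f : mu.-integrable setT (EFin \o f) ->
  mu.-integrable setT (fun x => (f (x + h))%:E) /\
  \int[mu]_x f (x + h) = \int[mu]_x f x.
Proof.
by apply: Rintegral_invariant; [exact: measurable_shift|exact: lebesgue_shift].
Qed.

Lemma dominated_Rintegral_cube (F : nat -> 'rV[R]_n -> R) f (M r : R) :
  (forall k, measurable_fun setT (F k)) -> measurable_fun setT f ->
  (forall x, F k x @[k --> \oo] --> f x) ->
  (forall k x, `|F k x| <= M * \1_(@cube R n r) x) ->
  \int[mu]_x F k x @[k --> \oo] --> \int[mu]_x f x.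
Proof.
move=> mF mf Ff FM.
apply: (dominated_Rintegral measurableT mF mf _ (integrable_cube n M r)).
  by apply: aeW => x _; exact: Ff.
by apply: aeW => x k _; exact: FM.
Qed.

(** The difference quotients of [f] have integral zero by translation
    invariance and converge boundedly to the partial derivative. *)
Lemma integral_partial0 f i : Cc f -> \int[mu]_x partial i f x = 0.
Proof.
move=> cf; have [M [r [M0 Mr]]] := quot_le i 1 cf.
have cdf := Cc_partial i cf.
have L : \int[mu]_x quot f i 1 k x @[k --> \oo] --> \int[mu]_x partial i f x.
  apply: (dominated_Rintegral_cube (M := M) (r := r)) => //.
  - by move=> k; exact: quot_measurable.
  - exact: Cc_measurable.
  - by move=> x; rewrite -[X in _ --> X]mul1r; exact: quot_cvg.
have Z k : \int[mu]_x quot f i 1 k x = 0.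
  have [ish sh] := Rintegral_shift ((1 / k.+1%:R) *: e i) (Cc_integrable cf).
  rewrite /quot RintegralZl//.
    by rewrite RintegralB// ?sh ?subrr ?mulr0//; exact: Cc_integrable.
  exact: (integrableB measurableT ish (Cc_integrable cf)).
rewrite (_ : (fun k => _) = cst 0) in L; last by apply/funext.
by apply/esym/(cvg_unique _ _ L) => //; exact: cvg_cst.
Qed.

Lemma partialM f g i : elementary_smooth f -> elementary_smooth g ->
  partial i (fun x => f x * g x) =
  (fun x => f x * partial i g x + g x * partial i f x).
Proof.
move=> sf sg; apply/funext => x; rewrite /partial.
have df := elementary_smooth_is_partial i x sf.
have dg := elementary_smooth_is_partial i x sg.
by have [_] := is_deriveM df dg.
Qed.

Lemma integration_by_parts_Cc f g i : Cc f -> elementary_smooth g ->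
  \int[mu]_x (f x * partial i g x) = - \int[mu]_x (partial i f x * g x).
Proof.
move=> cf sg; have := integral_partial0 i (Cc_mul cf sg).
rewrite partialM//; last by case: cf.
have c1 := Cc_mul cf (elementary_smooth_partial i sg).
have c2 := Cc_mul (Cc_partial i cf) sg.
under eq_Rintegral do rewrite (mulrC (g _)).
rewrite RintegralD//; [|exact: Cc_integrable c1|exact: Cc_integrable c2].
by move/eqP; rewrite addr_eq0 => /eqP.
Qed.

Lemma L2sq_shift f h : measurable_fun setT f ->
  L2sq mu (fun x => f (x + h)) = L2sq mu f.
Proof.
move=> mf; rewrite /L2sq (@ge0_integral_shift _ _ h (fun x => (f x ^+ 2)%:E))//.
  exact: measurable_sqr.
by move=> x; rewrite lee_fin sqr_ge0.
Qed.

(** Telescoping over [k.+1] steps, Cauchy-Schwarz and translation invariance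
    bound the left side by the square integral of the difference quotient. *)
Lemma L2sq_shift_coord_le f i t : Cc f ->
  (L2sq mu (fun x => f (x + t *: e i) - f x)%R <=
  (t ^+ 2)%:E * L2sq mu (partial i f))%E.
Proof.
move=> cf; have [M [r [M0 Mr]]] := quot_le i t cf.
have cdf := Cc_partial i cf; have mf := Cc_measurable cf.
have q2 k x : `|quot f i t k x ^+ 2| <= M ^+ 2 * \1_(@cube R n r) x.
  have := Mr k x; rewrite normrX indicE; case: (x \in cube r) => /=.
    by rewrite !mulr1 => H; rewrite lerXn2r ?nnegrE.
  by rewrite !mulr0 normr_le0 => /eqP ->; rewrite normr0 expr0n.
have [_ _ L] := @dominated_convergence _ _ _ mu setT measurableT
  (fun k x => (quot f i t k x ^+ 2)%:E) (fun x => ((t * partial i f x) ^+ 2)%:E)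
  (fun x => (M ^+ 2 * \1_(@cube R n r) x)%:E)
  (fun k => measurable_sqr (quot_measurable i t k cf))
  (measurable_sqr (measurable_funM (@measurable_cst _ _ _ _ setT t) (Cc_measurable cdf)))
  (aeW _ (fun x _ => EFin_cvg
    (cvg_comp _ _ (@quot_cvg f i t x cf) (@exprn_continuous R 2 (t * partial i f x)))))
  (integrable_cube n (M ^+ 2) r) (aeW _ (fun x k _ => q2 k x)).
rewrite -L2sq_scale//; last exact: Cc_measurable.
apply: (cvge_to_ge L); apply: nearW => k.
pose d : R := t / k.+1%:R.
pose a (j : nat) x := f (x + (j.+1%:R * d) *: e i) - f (x + (j%:R * d) *: e i).
pose b x := f (x + d *: e i) - f x.
have mb : measurable_fun setT b.
  by apply: measurable_funB => //; exact: shift_measurable.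
have E x : f (x + t *: e i) - f x = \sum_(j < k.+1) a j x.
  rewrite -(big_mkord predT (fun j => a j x)) telescope_sumr//.
  by rewrite mul0r scale0r addr0 /d mulrCA mulfV ?mulr1.
under eq_fun do rewrite E.
have ab j : a j = fun x => b (x + (j%:R * d) *: e i).
  apply/funext => x.
  by rewrite /a /b -addrA -scalerDl -natr1 mulrDl mul1r.
apply: le_trans (L2sq_sum_le _ _) _.
  by move=> j; rewrite ab; exact: shift_measurable.
have -> : (\sum_(j < k.+1) L2sq mu (a j) = k.+1%:R%:E * L2sq mu b)%E.
  under eq_bigr do rewrite ab L2sq_shift//.
  by rewrite sume_cst_ge0// L2sq_ge0.
rewrite muleA -EFinM -expr2 -L2sq_scale//.
Qed.

Definition partial_shift h (k : nat) : 'rV[R]_n :=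
  \sum_(i < n | (i < k)%N) h ord0 i *: e i.

(** Moving one coordinate at a time reduces a shift to coordinate shifts. *)
Lemma L2sq_shift_le f h : Cc f ->
  (L2sq mu (fun x => f (x + h) - f x)%R <=
  n%:R%:E * \sum_(i < n) ((h ord0 i) ^+ 2)%:E * L2sq mu (partial i f))%E.
Proof.
move=> cf; have mf := Cc_measurable cf.
pose p := partial_shift h.
have p0 : p 0 = 0 by rewrite /p /partial_shift big_pred0.
have pn : p n = h.
  rewrite /p /partial_shift [RHS](matrix_sum_delta h) big_ord1.
  by apply: eq_bigl => i; rewrite ltn_ord.
have pS (i : 'I_n) : p i.+1 = h ord0 i *: e i + p i.
  rewrite /p /partial_shift (bigD1 i)//=; congr (_ + _).
  by apply: eq_bigl => j; rewrite ltnS ltn_neqAle andbC.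
pose a (j : nat) x := f (x + p j.+1) - f (x + p j).
have E x : f (x + h) - f x = \sum_(j < n) a j x.
  rewrite -(big_mkord predT (fun j => a j x)) telescope_sumr//.
  by rewrite p0 addr0 pn.
under eq_fun do rewrite E.
pose b (i : 'I_n) x := f (x + h ord0 i *: e i) - f x.
have ab (i : 'I_n) : a i = fun x => b i (x + p i).
  by apply/funext => x; rewrite /a /b pS addrCA addrC.
have mb i : measurable_fun setT (b i).
  by apply: measurable_funB => //; exact: shift_measurable.
apply: le_trans (L2sq_sum_le _ _) _.
  by move=> j; rewrite ab; exact: shift_measurable.
apply: lee_wpmul2l; first by rewrite lee_fin.
apply: lee_sum => i _; rewrite ab L2sq_shift//; exact: L2sq_shift_coord_le.
Qed.

End difference_quotients.

(** * Fundamental lemma of the calculus of variations *)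

Section fundamental_lemma.
Context (R : realType) (n : nat).
Local Notation mu := (lebesgue_rV R n).
Implicit Types (f g : 'rV[R]_n -> R) (x a b : 'rV[R]_n).

(** Smooth functions of [x], positive exactly on the box, that tend to its
    indicator function as [k] grows. The differences are written with the
    operations of [elementary_smooth]. *)
Definition bump a b (k : nat) x : R := \prod_(i < n)
  (flat 0 (k.+1%:R * (x ord0 i + - a ord0 i)) *
   flat 0 (k.+1%:R * (b ord0 i + (-1) * x ord0 i))).

Lemma flat_neq0_gt0 k (t : R) : flat k t != 0 -> 0 < t.
Proof. by rewrite /flat; case: ifPn => //; rewrite eqxx. Qed.

Lemma bump_support a b k x : bump a b k x != 0 -> box a b x.
Proof.
move=> /prodf_neq0 H i; have := H i isT; rewrite mulf_eq0 negb_or.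
move=> /andP[/flat_neq0_gt0 + /flat_neq0_gt0]; rewrite !pmulr_rgt0 ?ltr0n//; lra.
Qed.

Lemma box_cube a b : exists r, box a b `<=` @cube R n r.
Proof.
exists (1 + \sum_(i < n) (`|a ord0 i| + `|b ord0 i|)) => x abx.
rewrite cubeE => i; rewrite (bigD1 i)//=.
have : 0 <= \sum_(j < n | j != i) (`|a ord0 j| + `|b ord0 j|).
  by apply: sumr_ge0 => j _; rewrite addr_ge0.
have := abx i; have := ler_norm (b ord0 i); have := ler_norm (- a ord0 i).
by rewrite normrN; have := normr_ge0 (a ord0 i); have := normr_ge0 (b ord0 i);
  lra.
Qed.

Lemma bump_Cc a b k : Cc (bump a b k).
Proof.
split; last first.
  have [r abr] := box_cube a b; exists r => x /bump_support; exact: abr.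
apply: elementary_smooth_prod => i.
apply: es_mul; apply: es_flat; apply: es_mul; do ?exact: es_cst.
  by apply: es_add; [exact: es_coord|exact: es_cst].
by apply: es_add; [exact: es_cst|apply: es_mul; [exact: es_cst|exact: es_coord]].
Qed.

Lemma bump_bounds a b k x : 0 <= bump a b k x <= 1.
Proof.
rewrite /bump; elim/big_rec: _ => [|i y _ /andP[y0 y1]]; first by rewrite ler01 lexx.
rewrite !mulr_ge0 ?flat_ge0//= !mulr_ile1 ?mulr_ge0 ?flat_ge0 ?flat0_le1//.
Qed.

Lemma cvg_flat_scale (c : R) : 0 < c ->
  flat 0 (k.+1%:R * c) @[k --> \oo] --> (1 : R).
Proof.
move=> c0.
rewrite (_ : (fun k => _) = (fun k => expR (- (k.+1%:R^-1 * c^-1)))).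
  have L : - (k.+1%:R^-1 * c^-1) @[k --> \oo] --> - (0 * c^-1 : R).
    by apply: cvgN; apply: cvgM; [exact: cvg_harmonic|exact: cvg_cst].
  rewrite mul0r oppr0 in L.
  by rewrite -[X in _ --> X]expR0; exact: (cvg_comp _ _ L (@continuous_expR R 0)).
apply/funext => k; rewrite /flat mulr_gt0 ?ltr0n// expr0 mul1r. by rewrite invfM.
Qed.

Lemma cvg_prod1 (I : Type) (r : seq I) (F : I -> nat -> R) :
  (forall i, F i k @[k --> \oo] --> (1 : R)) ->
  \prod_(i <- r) F i k @[k --> \oo] --> (1 : R).
Proof.
move=> F1; elim: r => [|i r IH].
  by under eq_fun do rewrite big_nil; exact: cvg_cst.
have L := cvgM (F1 i) IH; rewrite mulr1 in L.
by under eq_fun do rewrite big_cons; exact: L.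
Qed.

Lemma bump_cvg a b x : bump a b k x @[k --> \oo] --> (\1_(box a b) x : R).
Proof.
rewrite indicE; case: (boolP (x \in box a b)) => [/set_mem abx|/negP xab].
  suff L : bump a b k x @[k --> \oo] --> (1 : R) by exact: L.
  apply: (@cvg_prod1 _ _ (fun i k => flat 0 (k.+1%:R * (x ord0 i + - a ord0 i)) *
    flat 0 (k.+1%:R * (b ord0 i + (-1) * x ord0 i)))) => i.
  have a0 : 0 < x ord0 i + - a ord0 i by have := abx i; lra.
  have b0 : 0 < b ord0 i + (-1) * x ord0 i by have := abx i; lra.
  have L := cvgM (cvg_flat_scale a0) (cvg_flat_scale b0).
  by rewrite mulr1 in L; exact: L.
rewrite (_ : (fun k => _) = cst 0); first exact: cvg_cst.
apply/funext => k /=; apply/eqP/negPn/negP => /bump_support abx.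
by apply: xab; exact/mem_set.
Qed.

Lemma Lfun2_integrable_fin f (A : set 'rV[R]_n) : measurable A ->
  (mu A < +oo)%E -> f \in Lfun mu 2%:E -> mu.-integrable A (EFin \o f).
Proof.
move=> mA Aoo f2; have mf := Lfun2_measurable f2.
have i1 := integrable_indic_lty mA Aoo.
have i2 := Lfun2_integrable_sqr f2.
have := integrableS measurableT mA (@subsetT _ _)
  (integrableD measurableT i1 i2).
apply: le_integrable => //.
  by apply/measurable_EFinP; exact: measurable_funTS.
move=> x Ax /=; rewrite lee_fin indicE mem_set//=.
rewrite [leRHS]ger0_norm; last by rewrite addr_ge0// sqr_ge0.
have := sqr_ge0 (`|f x| - 1); have := real_normK (num_real (f x)); nra.
Qed.

Lemma Lfun2_integrable_box f a b : f \in Lfun mu 2%:E ->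
  mu.-integrable (box a b) (EFin \o f).
Proof.
by apply: Lfun2_integrable_fin; [exact: measurable_box|exact: lebesgue_box_lty].
Qed.

(** The test functions [bump a b k] are bounded by one and tend to the indicator
    function of the box, so dominated convergence applies. *)
Lemma integral_box0 f a b : f \in Lfun mu 2%:E ->
  (forall phi, Cc phi -> \int[mu]_x (f x * phi x) = 0) ->
  (\int[mu]_(x in box a b) (f x)%:E = 0)%E.
Proof.
move=> f2 f0; have mf := Lfun2_measurable f2.
have mb := measurable_box a b.
have intf := Lfun2_integrable_box a b f2.
have ifb : mu.-integrable setT (fun x => (`|f x| * \1_(box a b) x)%:E).
  have := integrable_abse intf.
  move/(integrable_mkcond _ mb).1; apply: eq_integrable => // x _.
  rewrite patchE indicE /=; case: ifPn => _; first by rewrite mulr1.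
  by rewrite mulr0.
have mfb : measurable_fun setT (fun x => f x * \1_(box a b) x).
  by apply: measurable_funM => //.
have mfk k : measurable_fun setT (fun x => f x * bump a b k x).
  by apply: measurable_funM => //; exact: Cc_measurable (bump_Cc _ _ _).
have dom k x : `|f x * bump a b k x| <= `|f x| * \1_(box a b) x.
  rewrite normrM ler_wpM2l// indicE.
  have /andP[b0 b1] := bump_bounds a b k x; rewrite ger0_norm//.
  have [->|/bump_support abx] := eqVneq (bump a b k x) 0; first exact: ler0n.
  by rewrite mem_set.
have [_ _ L] := @dominated_convergence _ _ _ mu setT measurableT
  (fun k x => (f x * bump a b k x)%:E) (fun x => (f x * \1_(box a b) x)%:E)
  (fun x => (`|f x| * \1_(box a b) x)%:E)
  (fun k => (measurable_EFinP _ _).2 (mfk k))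
  ((measurable_EFinP _ _).2 mfb)
  (aeW _ (fun x _ => EFin_cvg (cvgM (@cvg_cst _ _ _ _ _) (@bump_cvg a b x))))
  ifb (aeW _ (fun x k _ => dom k x)).
have Z k : (\int[mu]_x (f x * bump a b k x)%:E = 0)%E.
  have ifk : mu.-integrable setT (fun x => (f x * bump a b k x)%:E).
    apply: (le_integrable measurableT _ _ ifb).
      exact/measurable_EFinP.
    by move=> x _; rewrite /= lee_fin [leRHS]ger0_norm// mulr_ge0.
  have := f0 _ (bump_Cc a b k); rewrite /Rintegral => H.
  by rewrite -[LHS]fineK ?H// integrable_fin_num.
have E : (\int[mu]_x (f x * \1_(box a b) x)%:E = 0)%E.
  apply/esym; apply: cvg_unique L; first exact: ereal_hausdorff.
  rewrite (_ : [sequence _]_n = cst 0%E); first exact: cvg_cst.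
  by apply/funext => k /=.
rewrite integral_mkcond -[RHS]E; apply: eq_integral => x _.
rewrite patchE indicE; case: ifPn => _; first by rewrite mulr1.
by rewrite mulr0.
Qed.

(** The integrals over boxes vanish, hence by the pi-lambda theorem those over
    all measurable subsets of a cube, and the function is zero there. *)
Lemma Lfun2_eq0 f : f \in Lfun mu 2%:E ->
  (forall phi, Cc phi -> \int[mu]_x (f x * phi x) = 0) ->
  {ae mu, forall x, f x = 0}.
Proof.
move=> f2 f0; have mf := Lfun2_measurable f2.
have H k : {ae mu, forall x, cube k%:R x -> (f x)%:E = 0%E}.
  have mc := @measurable_cube R n k%:R.
  have intf : mu.-integrable (cube k%:R) (EFin \o f).
    exact: Lfun2_integrable_box.
  apply: (@integral_ae_eq _ _ _ mu _ mc (cst 0%E) (EFin \o f)) => //.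
  move=> E Ec mE; rewrite [RHS]integral_cst// mul0e.
  have -> : E = E `&` cube k%:R by apply/esym/setIidPl.
  rewrite measurable_boxes in mE; move: {Ec} E mE.
  pose P (A : set 'rV[R]_n) :=
    (\int[mu]_(x in A `&` cube k%:R) (f x)%:E = 0)%E.
  apply: (@dynkin_induction _ _ _ P (measurable_boxes R n) (@boxesI R n)); rewrite /P.
  - by rewrite setTI; exact: integral_box0.
  - move=> A bA; have : boxes (A `&` cube k%:R).
      by apply: boxesI => //; eexists; eexists; reflexivity.
    by move=> [a [b ->]]; exact: integral_box0.
  - move=> A mA A0; have := @integral_setU _ _ _ mu (A `&` cube k%:R)
      (~` A `&` cube k%:R) (EFin \o f).
    rewrite -setIUl setUv setTI integral_box0// A0 add0e => <- //.
    + exact: measurableI.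
    + by apply: measurableI => //; exact: measurableC.
    + by apply: measurable_int intf.
    + apply/disj_setPS => x [[Ax _] [nAx _]]; exact: nAx.
  - move=> F mF tF F0; rewrite setI_bigcupl integral_bigcup//.
    + by rewrite eseries0.
    + apply/trivIsetP => i j _ _ ij.
      by rewrite setIACA; move/trivIsetP : tF => /(_ i j I I ij) ->; rewrite set0I.
    + by move=> i; exact: measurableI.
    + apply: (integrableS mc) intf.
        by rewrite -setI_bigcupl; apply: measurableI => //; exact: bigcupT_measurable.
      by move=> x [i _ []].
have : {ae mu, forall x, forall k : nat, cube k%:R x -> (f x)%:E = 0%E}.
  exact: ae_foralln.
apply: filterS => x Hx.
have : [set: 'rV[R]_n] x by []. rewrite -bigcup_cube => -[k _ xk].
by have [] := Hx k xk.
Qed.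

End fundamental_lemma.

(** * Weak derivatives and the energy space *)

Section weak_derivatives.
Context (R : realType) (n : nat).
Local Notation mu := (lebesgue_rV R n).
Implicit Types (u v f g phi : 'rV[R]_n -> R) (i : 'I_n) (U : set 'rV[R]_n).

Lemma Lfun2_mul_integrable f g : f \in Lfun mu 2%:E -> g \in Lfun mu 2%:E ->
  mu.-integrable setT (fun x => (f x * g x)%:E).
Proof. by move=> f2 g2; exact: (Lfun1_integrable _ _).1 (Lfun2_mul_Lfun1 f2 g2). Qed.

Lemma Lfun2_add f g : f \in Lfun mu 2%:E -> g \in Lfun mu 2%:E ->
  (fun x => f x + g x) \in Lfun mu 2%:E.
Proof.
move=> f2 g2; have mf := Lfun2_measurable f2; have mg := Lfun2_measurable g2.
apply: Lfun2_intro; first exact: measurable_funD.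
apply: le_lt_trans (L2sq_add_le mu mf mg) _.
by rewrite lte_add_pinfty// lte_mul_pinfty ?lee_fin// Lfun2_lty.
Qed.

Lemma Lfun2_scale c f : f \in Lfun mu 2%:E -> (fun x => c * f x) \in Lfun mu 2%:E.
Proof.
move=> f2; have mf := Lfun2_measurable f2.
apply: Lfun2_intro; first exact: measurable_funM.
have := L2sq_scale mu c mf; rewrite /L2sq => ->.
by rewrite lte_mul_pinfty ?lee_fin ?sqr_ge0// Lfun2_lty.
Qed.

Lemma Lfun2_sub f g : f \in Lfun mu 2%:E -> g \in Lfun mu 2%:E ->
  (fun x => f x - g x) \in Lfun mu 2%:E.
Proof.
move=> f2 g2; have := Lfun2_add f2 (Lfun2_scale (-1) g2).
by under eq_fun do rewrite mulN1r.
Qed.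

(** The difference of two weak derivatives is orthogonal to all test functions,
    so the choice made in [wpartial] does not matter. *)
Lemma weak_partial_unique i u g g' : weak_partial i u g -> weak_partial i u g' ->
  {ae mu, forall x, g x = g' x}.
Proof.
move=> [g2 ug] [g2' ug'].
have : {ae mu, forall x, g x - g' x = 0}.
  apply: Lfun2_eq0; first exact: Lfun2_sub.
  move=> phi cphi; have phi2 := Cc_Lfun2 cphi.
  have E : \int[mu]_x (g x * phi x) = \int[mu]_x (g' x * phi x).
    apply: oppr_inj.
    by rewrite -ug ?ug'//; exact: Cc_test_functionT.
  under eq_Rintegral do rewrite mulrBl.
  rewrite RintegralB//; [by rewrite E subrr|exact: Lfun2_mul_integrable..].
by apply: filterS => x /eqP; rewrite subr_eq0 => /eqP.
Qed.

Lemma wpartialP i u : H1 u -> weak_partial i u (wpartial i u).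
Proof. by move=> [_ /(_ i)[g ug]]; exact: (xgetPex _ (ex_intro _ g ug)). Qed.

Lemma wpartial_Lfun2 i u : H1 u -> wpartial i u \in Lfun mu 2%:E.
Proof. by move=> /(wpartialP i)[]. Qed.

Lemma wpartial_measurable i u : H1 u -> measurable_fun setT (wpartial i u).
Proof. by move=> /(wpartial_Lfun2 i); exact: Lfun2_measurable. Qed.

Lemma wpartialE i u g : H1 u -> weak_partial i u g ->
  {ae mu, forall x, wpartial i u x = g x}.
Proof. by move=> /(wpartialP i); exact: weak_partial_unique. Qed.

Lemma weak_partial_scale i c u g : u \in Lfun mu 2%:E -> weak_partial i u g ->
  weak_partial i (fun x => c * u x) (fun x => c * g x).
Proof.
move=> u2 [g2 ug]; split; first exact: Lfun2_scale.
move=> phi tphi; have cphi := test_function_Cc tphi.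
under eq_Rintegral do rewrite -mulrA.
under [in RHS]eq_Rintegral do rewrite -mulrA.
rewrite !RintegralZl//.
- by rewrite ug// mulrN.
- by apply: Lfun2_mul_integrable => //; exact: Cc_Lfun2.
- by apply: Lfun2_mul_integrable => //; exact: Cc_Lfun2 (Cc_partial i cphi).
Qed.

Lemma H1_scale c u : H1 u -> H1 (fun x => c * u x).
Proof.
move=> [u2 Hu]; split=> [|i]; first exact: Lfun2_scale.
have [g ug] := Hu i; exists (fun x => c * g x); exact: weak_partial_scale.
Qed.

Lemma wpartial_scale i c u : H1 u ->
  {ae mu, forall x, wpartial i (fun x => c * u x) x = c * wpartial i u x}.
Proof.
move=> Hu; apply: wpartialE; first exact: H1_scale.
by apply: weak_partial_scale; [case: Hu|exact: wpartialP].
Qed.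

Lemma weak_partial_Cc i f : Cc f -> weak_partial i f (partial i f).
Proof.
move=> cf; split; first exact: Cc_Lfun2 (Cc_partial i cf).
by move=> phi /test_function_Cc[sphi _]; exact: integration_by_parts_Cc.
Qed.

Lemma H1_Cc f : Cc f -> H1 f.
Proof.
move=> cf; split=> [|i]; first exact: Cc_Lfun2.
by exists (partial i f); exact: weak_partial_Cc.
Qed.

Lemma wpartial_Cc i f : Cc f -> {ae mu, forall x, wpartial i f x = partial i f x}.
Proof. by move=> cf; apply: wpartialE; [exact: H1_Cc|exact: weak_partial_Cc]. Qed.

Lemma ae_forall_ord (m : nat) (P : 'I_m -> 'rV[R]_n -> Prop) :
  (forall j, {ae mu, forall x, P j x}) -> {ae mu, forall x, forall j, P j x}.
Proof.
move=> H; have : {ae mu, forall x, forall k : nat, forall j : 'I_m, j = k :> nat -> P j x}.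
  apply: ae_foralln => k.
  have [km|km] := ltnP k m.
    have := H (Ordinal km); apply: filterS => x Hx j jk.
    by rewrite (_ : j = Ordinal km)//; exact: val_inj.
  apply: aeW => x j jk; exfalso.
  by have := ltn_ord j; rewrite jk ltnNge km.
by apply: filterS => x Hx j; exact: (Hx j).
Qed.

Section with_domain.
Variables (U : set 'rV[R]_n) (mU : measurable U).

Let integrand u phi x := ((u x - phi x) ^+ 2 +
  \sum_(i < n) (wpartial i u x - partial i phi x) ^+ 2)%:E.

Lemma measurable_restr_integrand u phi : H1 u -> Cc phi ->
  measurable_fun setT (integrand u phi).
Proof.
move=> Hu cphi; apply/measurable_EFinP; apply: measurable_funD.
  apply: measurable_funX; apply: measurable_funB; last exact: Cc_measurable.
  by apply: (Lfun2_measurable (m := mu)); case: Hu.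
apply: measurable_sum => i; apply: measurable_funX; apply: measurable_funB.
  exact: wpartial_measurable.
exact: Cc_measurable (Cc_partial i cphi).
Qed.

Lemma integrand_ge0 u phi x : (0 <= integrand u phi x)%E.
Proof.
by rewrite lee_fin addr_ge0 ?sqr_ge0// sumr_ge0// => i _; exact: sqr_ge0.
Qed.

Lemma X12D_Cc f : Cc f -> closure [set x | f x != 0] `<=` U -> X12D U f.
Proof.
move=> cf fU; split; first exact: H1_Cc.
- move=> e e0; exists f; first exact: Cc_test_function.
  rewrite (@ge0_ae_eq_integral _ _ _ mu U _ (cst 0%E)) ?integral0 ?lte_fin//.
  + by apply: measurable_funTS; apply: measurable_restr_integrand => //; exact: H1_Cc.
  + by move=> x _; exact: integrand_ge0.
  + have := ae_forall_ord (fun i => wpartial_Cc i cf).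
    apply: filterS => x Hx _ /=; congr (_%:E).
    by rewrite subrr expr0n add0r big1// => i _; rewrite Hx subrr expr0n.
- apply: aeW => x nUx; apply/eqP/negPn/negP => fx; apply: nUx; apply: fU.
  exact: subset_closure.
Qed.

Lemma X12D_scale c u : X12D U u -> X12D U (fun x => c * u x).
Proof.
move=> [Hu Ru u0]; split; first exact: H1_scale.
(* The summand [1] keeps the quotient meaningful for [c = 0]. *)
- move=> e e0; have c20 : 0 < c ^+ 2 + 1 by rewrite ltr_pwDr// sqr_ge0.
  have [phi tphi lt_phi] := Ru (e / (c ^+ 2 + 1)) (divr_gt0 e0 c20).
  have cphi := test_function_Cc tphi.
  have [sphi _] := cphi.
  have cc := Cc_scale c cphi.
  exists (fun x => c * phi x).
    apply: Cc_test_function => //; case: tphi => _ _; apply: subset_trans.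
    by apply: closureS => x /=; rewrite mulf_eq0 negb_or => /andP[].
  have PE i x : partial i (fun x => c * phi x) x = c * partial i phi x.
    have := partialM i (es_cst n c) sphi.
    move=> /(congr1 (fun h => h x)) ->; rewrite /= [X in _ + X](_ : _ = 0) ?addr0//.
    by rewrite /partial derive_cst mulr0.
  rewrite (@ge0_ae_eq_integral _ _ _ mu U _ (fun x => (c ^+ 2)%:E * integrand u phi x)%E)//.
  + rewrite ge0_integralZl_EFin ?sqr_ge0//.
    * pose I := (\int[mu]_(x in U) integrand u phi x)%E.
      have HI : (I < (e / (c ^+ 2 + 1))%:E)%E := lt_phi.
      have I0 : (0 <= I)%E by apply: integral_ge0 => x _; exact: integrand_ge0.
      have If : I \is a fin_num.
        by rewrite ge0_fin_numE//; apply: lt_trans HI _; rewrite ltry.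
      rewrite -/I; move: HI I0; rewrite -(fineK If) -EFinM !lte_fin lee_fin.
      by rewrite ltr_pdivlMr//; move: (fine I) => r; nra.
    * by move=> x _; exact: integrand_ge0.
    * by apply: measurable_funTS; exact: measurable_restr_integrand.
  + by apply: measurable_funTS; apply: measurable_restr_integrand => //; exact: H1_scale.
  + apply: emeasurable_funM => //.
    by apply: measurable_funTS; exact: measurable_restr_integrand.
  + by move=> x _; exact: integrand_ge0.
  + by move=> x _; rewrite mule_ge0 ?integrand_ge0// lee_fin sqr_ge0.
  + have := ae_forall_ord (fun i => wpartial_scale i c Hu).
    apply: filterS => x Hx _ /=; rewrite /integrand -EFinM; congr (_%:E).
    rewrite mulrDr -mulrBr exprMn; congr (_ + _); rewrite mulr_sumr.
    by apply: eq_bigr => i _; rewrite Hx PE -mulrBr exprMn.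
- by apply: filterS u0 => x ux nUx; rewrite ux// mulr0.
Qed.

(** The function and its approximations vanish outside [U], so the error is small
    in square mean on the whole space; this is what allows translations. *)
Lemma X12D_approx u (e : R) : X12D U u -> 0 < e ->
  exists phi, [/\ Cc phi, closure [set x | phi x != 0] `<=` U,
    (L2sq mu (fun x => u x - phi x)%R < e%:E)%E &
    (\int[mu]_(x in U)
       (\sum_(i < n) (wpartial i u x - partial i phi x) ^+ 2)%R%:E < e%:E)%E].
Proof.
move=> [Hu Ru u0] e0; have [phi tphi lt_phi] := Ru e e0.
have cphi := test_function_Cc tphi; have [_ _ phiU] := tphi.
have mI : measurable_fun U (integrand u phi).
  by apply: measurable_funTS; exact: measurable_restr_integrand.
have mud : measurable_fun setT (fun x => u x - phi x).
  apply: measurable_funB; last exact: Cc_measurable.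
  by apply: (Lfun2_measurable (m := mu)); case: Hu.
exists phi; split => //.
- apply: le_lt_trans lt_phi.
  pose w x := ((u x - phi x) ^+ 2)%:E.
  rewrite /L2sq (@ge0_ae_eq_integral _ _ _ mu setT _
    (w \_ U)%E)//.
  + rewrite -integral_mkcond; apply: ge0_le_integral => //.
    * by move=> x _; rewrite lee_fin sqr_ge0.
    * by apply: measurable_funTS; exact: measurable_sqr.
    * move=> x _; rewrite lee_fin lerDl sumr_ge0// => i _; exact: sqr_ge0.
  + exact: measurable_sqr.
  + apply: (measurable_restrictT w mU).1.
    by apply: measurable_funTS; exact: measurable_sqr.
  + by move=> x _; rewrite lee_fin sqr_ge0.
  + by move=> x _; rewrite patchE; case: ifP => // _; rewrite lee_fin sqr_ge0.
  + apply: filterS u0 => x ux _; rewrite patchE; case: ifPn => // /negP xU.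
    have nUx : (~` U) x by move=> Ux; apply: xU; exact/mem_set.
    rewrite ux// (_ : phi x = 0) ?subrr ?expr0n//.
    apply/eqP/negPn/negP => px; apply: nUx; apply: phiU; exact: subset_closure.
- apply: le_lt_trans lt_phi; apply: ge0_le_integral => //.
  + by move=> x _; rewrite lee_fin sumr_ge0// => i _; exact: sqr_ge0.
  + apply/measurable_EFinP; apply: measurable_funTS.
    apply: measurable_sum => i; apply: measurable_funX; apply: measurable_funB.
      exact: wpartial_measurable.
    exact: Cc_measurable (Cc_partial i cphi).
  + by move=> x _; rewrite lee_fin lerDr sqr_ge0.
Qed.

End with_domain.

End weak_derivatives.

(** * The singular kernel *)

Section kernel.
Context (R : realType) (n : nat).
Local Notation mu := (lebesgue_rV R n).
Implicit Types (x h : 'rV[R]_n).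

(** Comparison with a geometric series: cover the support of [g] by cubes of size
    [t j] on which [g <= c j], with [c j] times the volume at most [C * r ^+ j]. *)
Lemma integral_shells (g : 'rV[R]_n -> \bar R) (t c : nat -> R) (C r : R) :
  measurable_fun setT g -> (forall h, 0 <= g h)%E ->
  0 <= r < 1 -> (forall j, 0 <= c j) -> (forall j, 0 <= t j) ->
  (forall j, c j * (2 * t j) ^+ n <= C * r ^+ j) ->
  (forall h, g h = 0%E \/ exists j, cube (t j) h /\ (g h <= (c j)%:E)%E) ->
  (\int[mu]_h g h < +oo)%E.
Proof.
move=> mg g0 /andP[r0 r1] c0 t0 cC gle.
pose F (j : nat) h := ((c j) * \1_(cube (t j)) h)%:E.
have F0 j h : (0 <= F j h)%E by rewrite lee_fin mulr_ge0.
have mF j : measurable_fun setT (F j).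
  apply/measurable_EFinP; apply: measurable_funM => //.
  by apply: measurable_indic; exact: measurable_cube.
have mS : measurable_fun setT (fun h => \sum_(0 <= j <oo) F j h)%E.
  exact: ge0_emeasurable_sum.
apply: (@le_lt_trans _ _ (\int[mu]_h \sum_(0 <= j <oo) F j h)%E).
  apply: ge0_le_integral => // h _; have [->|[j [hj gj]]] := gle h.
    exact: nneseries_ge0.
  apply: le_trans gj _; apply: le_trans (nneseries_lim_ge j.+1 _) => //.
  rewrite big_nat_recr//= -[leLHS]add0e; apply: leeD; first exact: sume_ge0.
  by rewrite /F indicE mem_set//= mulr1.
rewrite integral_nneseries//.
have C0 : 0 <= C.
  by have := cC 0%N; rewrite expr0 mulr1; apply: le_trans;
    rewrite mulr_ge0// exprn_ge0// mulr_ge0.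
have IF j : (\int[mu]_h F j h <= (C * r ^+ j)%:E)%E.
  rewrite /F; under eq_integral do rewrite EFinM.
  rewrite ge0_integralZl_EFin//; last first.
    by apply/measurable_EFinP; apply: measurable_indic; exact: measurable_cube.
  rewrite integral_indic ?setIT//; last exact: measurable_cube.
  rewrite [X in (_ * X)%E](lebesgue_box _ _) -EFinM lee_fin; apply: le_trans (cC j).
  rewrite ler_wpM2l//.
  rewrite [leLHS](_ : _ = \prod_(i < n) (2 * t j)).
    by rewrite prodr_const card_ord.
  apply: eq_bigr => i _; rewrite !mxE opprK -mulr2n mulr_natl max_r//.
  by rewrite mulrn_wge0.
apply: (@le_lt_trans _ _ (C / (1 - r))%:E); last by rewrite ltry.
apply: lime_le.
  by apply: is_cvg_nneseries => j _ _; apply: integral_ge0 => h _; exact: F0.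
apply: nearW => m.
apply: (@le_trans _ _ (\sum_(0 <= j < m) (C * r ^+ j)%:E)%E).
  by apply: lee_sum => j _; exact: IF.
rewrite sumEFin lee_fin -mulr_sumr ler_wpM2l//.
have r1' : 0 < 1 - r by lra.
rewrite -[leRHS]div1r ler_pdivlMr//.
have -> : (\sum_(0 <= j < m) r ^+ j) * (1 - r) = 1 - r ^+ m.
  rewrite big_mkord; have := subrX1 r m; set S := \sum_(i < m) _ => H.
  by rewrite -[RHS]opprB H; ring.
by rewrite lerBlDr lerDl exprn_ge0.
Qed.

Lemma dyadic_shell (t : R) : 0 < t <= 1 ->
  exists j, 2^-1 ^+ j.+1 < t <= 2^-1 ^+ j.
Proof.
move=> /andP[t0 t1].
have ex : exists j, 2^-1 ^+ j.+1 < t.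
  have h1 : `|2^-1| < 1 :> R by rewrite ger0_norm//; lra.
  have := cvg_geometric 1 h1 => /cvgrPdist_lt/(_ t t0)[j _ /(_ j.+1)].
  rewrite /= leqnSn sub0r normrN mul1r ger0_norm ?exprn_ge0 ?invr_ge0//.
  by move=> /(_ isT) H; exists j.
case: (ex_minnP ex) => j jt jmin; exists j; rewrite jt/=.
case: j jt jmin => [|j] jt jmin; first by rewrite expr0.
by rewrite leNgt; apply/negP => /jmin; rewrite ltnn.
Qed.

Lemma enorm_coord x i : `|x ord0 i| <= enorm x.
Proof.
rewrite -sqrtr_sqr ler_wsqrtr// (bigD1 i)//= lerDl.
by apply: sumr_ge0 => j _; exact: sqr_ge0.
Qed.

Lemma enorm_ge0 x : 0 <= enorm x. Proof. exact: sqrtr_ge0. Qed.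

Lemma cube_enorm x t : enorm x < t -> cube t x.
Proof.
move=> xt; rewrite cubeE => i; rewrite -ltr_norml.
exact: le_lt_trans (enorm_coord x i) xt.
Qed.

Lemma measurable_enorm : measurable_fun setT (@enorm R n).
Proof.
apply: (@measurableT_comp _ _ _ _ _ _ (@Num.sqrt R)).
  by apply: continuous_measurable_fun; exact: sqrt_continuous.
by apply: measurable_sum => i; apply: measurable_funX; exact: measurable_rV_coord.
Qed.

Definition kern (a : R) h : R := (enorm h `^ a)^-1.

Lemma kern_ge0 a h : 0 <= kern a h.
Proof. by rewrite invr_ge0 powR_ge0. Qed.

Lemma measurable_invr : measurable_fun setT (fun x : R => x^-1).
Proof.
rewrite (_ : (fun x : R => x^-1) = (fun x : R => x * (x ^+ 2) `^ (-1))).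
  apply: measurable_funM => //.
  apply: (@measurableT_comp _ _ _ _ _ _ (fun x : R => x `^ (-1))).
    exact: measurable_powR.
  exact: measurable_funX.
apply/funext => x; rewrite powR_inv1 ?sqr_ge0//.
have [->|x0] := eqVneq x 0; first by rewrite invr0 mul0r.
by rewrite expr2 invfM mulrA mulfV// mul1r.
Qed.

Lemma measurable_kern a : measurable_fun setT (kern a).
Proof.
apply: (@measurableT_comp _ _ _ _ _ _ (fun x : R => x^-1)).
  exact: measurable_invr.
apply: (@measurableT_comp _ _ _ _ _ _ (fun x : R => x `^ a)).
  exact: measurable_powR.
exact: measurable_enorm.
Qed.

Lemma kern_le a h t : 0 <= a -> 0 < t <= enorm h -> kern a h <= (t `^ a)^-1.
Proof.
move=> a0 /andP[t0 th]; rewrite /kern lef_pV2 ?posrE ?powR_gt0//.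
  by rewrite ge0_ler_powR// ?nnegrE ?enorm_ge0// ltW.
exact: lt_le_trans th.
Qed.

Lemma exprn_powR (x a : R) j : 0 <= x -> (x ^+ j) `^ a = (x `^ a) ^+ j.
Proof.
move=> x0; elim: j => [|j IH]; first by rewrite !expr0 powR1.
by rewrite !exprS powRM ?exprn_ge0// IH.
Qed.

Let half_powR_lt1 (c : R) : 0 < c -> 2^-1 `^ c < 1.
Proof.
move=> c0; have := @gt0_ltr_powR _ _ c0 2^-1 1.
by rewrite powR1; apply; rewrite ?nnegrE ?invr_ge0 ?ler01// invf_lt1// ltr1n.
Qed.

Let two_powR_gt1 (c : R) : 0 < c -> 1 < 2 `^ c.
Proof.
move=> c0; have := @gt0_ltr_powR _ _ c0 1 2.
by rewrite powR1; apply; rewrite ?nnegrE ?ler01// ltr1n.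
Qed.

(** The kernel against which square integrals of translation differences are
    integrated: a difference with shift [h] is bounded in square mean by a
    multiple of the minimum of [1] and [enorm h ^+ 2]. *)
Definition gkern (s : R) h : R :=
  kern (n%:R + 2 * s) h * Num.min 1 (enorm h ^+ 2).

Lemma gkern_ge0 s h : 0 <= gkern s h.
Proof. by rewrite mulr_ge0 ?kern_ge0// le_min ler01 sqr_ge0. Qed.

Lemma measurable_gkern s : measurable_fun setT (gkern s).
Proof.
apply: measurable_funM; first exact: measurable_kern.
by apply: measurable_minr => //; apply: measurable_funX; exact: measurable_enorm.
Qed.

Let powRn (t s : R) : 0 < t -> t `^ (n%:R + 2 * s) = t ^+ n * t `^ (2 * s).
Proof.
move=> t0; rewrite powRD; last by rewrite (gt_eqF t0) implybT.
by rewrite powR_mulrn// ltW.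
Qed.

(** On dyadic shells the singularity at the origin contributes a geometric
    series with ratio [2^-1 `^ (2 - 2 * s)], summable because [s < 1], and the
    tail one with ratio [2 `^ (- 2 * s)], summable because [0 < s]. *)
Lemma integral_gkern_lty (s : R) : 0 < s < 1 ->
  (\int[mu]_h (gkern s h)%:E < +oo)%E.
Proof.
move=> /andP[s0 s1]; pose a : R := n%:R + 2 * s.
have a0 : 0 < a by rewrite ltr_wpDl// mulr_gt0.
pose near h := gkern s h * \1_[set h | enorm h <= 1] h.
pose far h := gkern s h * \1_(~` [set h | enorm h <= 1]) h.
have mA : measurable [set h : 'rV[R]_n | enorm h <= 1].
  rewrite -[X in measurable X]setTI.
  have := measurable_enorm measurableT (measurable_itv `]-oo, (1 : R)]).
  by congr (measurable (_ `&` _)); apply/seteqP; split => h; rewrite /= in_itv.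
have mg := measurable_gkern s.
have mnear : measurable_fun setT (EFin \o near).
  by apply/measurable_EFinP; apply: measurable_funM => //; exact: measurable_indic.
have mfar : measurable_fun setT (EFin \o far).
  apply/measurable_EFinP; apply: measurable_funM => //.
  by apply: measurable_indic; exact: measurableC.
have near0 h : (0 <= (EFin \o near) h)%E by rewrite lee_fin mulr_ge0 ?gkern_ge0.
have far0 h : (0 <= (EFin \o far) h)%E by rewrite lee_fin mulr_ge0 ?gkern_ge0.
have -> : (\int[mu]_h (gkern s h)%:E = \int[mu]_h ((EFin \o near) h + (EFin \o far) h))%E.
  apply: eq_integral => h _; rewrite /near /far /= -EFinD -mulrDr !indicE; congr (_%:E).
  by rewrite in_setC; case: (_ \in _); rewrite ?addr0 ?add0r mulr1.
rewrite ge0_integralD// lte_add_pinfty//.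
(* The shell of index [j] lies between the radii [t j / 2] and [t j]; the cube
   of size [2 * t j] contains it with room for the strict inequality. *)
- pose t j : R := 2^-1 ^+ j.
  have t0 j : 0 < t j by rewrite exprn_gt0// invr_gt0.
  apply: (@integral_shells _ (fun j => 2 * t j)
    (fun j => t j ^+ 2 * ((t j / 2) `^ a)^-1)
    (4 ^+ n * (2^-1 `^ a)^-1) (2^-1 `^ (2 - 2 * s))) => //.
  + by rewrite powR_ge0/= half_powR_lt1//; lra.
  + by move=> j; rewrite mulr_ge0 ?sqr_ge0// invr_ge0 powR_ge0.
  + by move=> j; rewrite mulr_ge0// ltW.
  + move=> j; rewrite le_eqVlt; apply/orP; left; apply/eqP.
    have tj := t0 j.
    rewrite powRM ?invr_ge0// ?(ltW tj)// powRn// -exprn_powR ?invr_ge0// -/(t j).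
    rewrite powRB; last by rewrite (gt_eqF tj) implybT.
    rewrite powR_mulrn ?(ltW tj)// mulrA -natrM -[(2 * 2)%N]/4%N exprMn.
    have := lt0r_neq0 (exprn_gt0 n tj); have := lt0r_neq0 (powR_gt0 (2 * s) tj).
    have h2 : 0 < 2^-1 :> R by rewrite invr_gt0.
    have := lt0r_neq0 (powR_gt0 a h2).
    move: (t j ^+ n) (t j `^ (2 * s)) (2^-1 `^ a) => A B D D0 B0 A0.
    by field; rewrite A0 B0 D0.
  + move=> h; rewrite /near/= indicE; case: (boolP (h \in _)) => [/set_mem/= h1|_]; last first.
      by left; rewrite mulr0.
    have := enorm_ge0 h; rewrite le_eqVlt => /predU1P[h0|h0].
      by left; rewrite /gkern -h0 expr0n /= (min_r ler01) mulr0 mul0r.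
    right; have [|j /andP[j1 j2]] := @dyadic_shell (enorm h); first by rewrite h0.
    have tj := t0 j.
    exists j; split.
      by apply: cube_enorm; rewrite -/(t j) in j2; lra.
    rewrite lee_fin mulr1 /gkern mulrC.
    apply: ler_pM; rewrite ?kern_ge0 ?le_min ?ler01 ?sqr_ge0//.
      rewrite ge_min; apply/orP; right.
      by rewrite lerXn2r ?nnegrE ?(ltW h0) ?(ltW tj).
    apply: kern_le; first exact: ltW.
    rewrite divr_gt0//=; apply/ltW; move: j1; rewrite exprS -/(t j); lra.
(* Here the shell lies between [t j] and [2 * t j], and [dyadic_shell] is applied
   to the inverse of the norm. *)
- pose t j : R := 2 ^+ j.
  have t0 j : 0 < t j by rewrite exprn_gt0.
  apply: (@integral_shells _ (fun j => 4 * t j) (fun j => (t j `^ a)^-1)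
    (8 ^+ n) ((2 `^ (2 * s))^-1)) => //.
  + rewrite invr_ge0 powR_ge0/= invf_lt1 ?powR_gt0//.
    by rewrite two_powR_gt1//; lra.
  + by move=> j; rewrite invr_ge0 powR_ge0.
  + by move=> j; rewrite mulr_ge0// ltW.
  + move=> j; rewrite le_eqVlt; apply/orP; left; apply/eqP.
    have tj := t0 j.
    rewrite powRn// exprVn -exprn_powR// -/(t j).
    rewrite mulrA -natrM -[(2 * 4)%N]/8%N exprMn.
    have := lt0r_neq0 (exprn_gt0 n tj); have := lt0r_neq0 (powR_gt0 (2 * s) tj).
    move: (t j ^+ n) (t j `^ (2 * s)) => A B B0 A0.
    by field; rewrite A0 B0.
  + move=> h; rewrite /far/= indicE in_setC.
    case: (boolP (h \in _)) => [_|/negP h1]; first by left; rewrite mulr0.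
    have {}h1 : 1 < enorm h.
      by rewrite ltNge; apply/negP => H; apply: h1; exact/mem_set.
    have h0 : 0 < enorm h by exact: lt_trans h1.
    right; have [|j /andP[j1 j2]] := @dyadic_shell (enorm h)^-1.
      by rewrite invr_gt0 h0/= invf_le1// ltW.
    have tj := t0 j.
    exists j; split.
      apply: cube_enorm; move: j1; rewrite exprVn ltf_pV2 ?posrE ?exprn_gt0//.
      by rewrite exprS -/(t j); lra.
    rewrite lee_fin mulr1 /gkern -[leRHS]mulr1.
    apply: ler_pM; rewrite ?kern_ge0 ?le_min ?ler01 ?sqr_ge0 ?ge_min ?lexx//.
    apply: kern_le; first exact: ltW.
    by rewrite tj/=; move: j2; rewrite exprVn lef_pV2 ?posrE ?exprn_gt0.
Qed.

End kernel.

(** * Embedding of H^1 into H^s *)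

Section gagliardo.
Context (R : realType) (n : nat) (s : R) (s01 : 0 < s < 1).
Local Notation mu := (lebesgue_rV R n).
Local Notation a := (n%:R + 2 * s).
Local Notation rV2 := ('rV[R]_n * 'rV[R]_n)%type.
Implicit Types (u v f phi : 'rV[R]_n -> R) (x h : 'rV[R]_n) (z : rV2).

Lemma measurable_rV_add : measurable_fun setT (fun z => z.1 + z.2).
Proof.
apply: measurable_fun_rVP => i; under eq_fun do rewrite mxE.
apply: measurable_funD.
  exact: (measurableT_comp (measurable_rV_coord i) measurable_fst).
exact: (measurableT_comp (measurable_rV_coord i) measurable_snd).
Qed.

Lemma measurable_rV_sub : measurable_fun setT (fun z => z.1 - z.2).
Proof.
apply: measurable_fun_rVP => i; under eq_fun do rewrite !mxE.
apply: measurable_funB.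
  exact: (measurableT_comp (measurable_rV_coord i) measurable_fst).
exact: (measurableT_comp (measurable_rV_coord i) measurable_snd).
Qed.

Lemma measurable_kern2 : measurable_fun setT (fun z => kern a (z.1 - z.2)).
Proof. exact: (measurableT_comp (@measurable_kern R n a) measurable_rV_sub). Qed.

Lemma measurable_diff2 v : measurable_fun setT v ->
  measurable_fun setT (fun z => v z.1 - v z.2).
Proof.
move=> mv; apply: measurable_funB.
  exact: (measurableT_comp mv measurable_fst).
exact: (measurableT_comp mv measurable_snd).
Qed.

(** The Gagliardo seminorm, squared. *)
Definition gag v : \bar R :=
  (\int[mu \x mu]_z ((v z.1 - v z.2) ^+ 2 * kern a (z.1 - z.2))%:E)%E.

Lemma measurable_gag_integrand v : measurable_fun setT v ->
  measurable_fun setT (fun z => ((v z.1 - v z.2) ^+ 2 * kern a (z.1 - z.2))%:E).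
Proof.
move=> mv; apply/measurable_EFinP; apply: measurable_funM.
  by apply: measurable_funX; exact: measurable_diff2.
exact: measurable_kern2.
Qed.

(** Tonelli and the change of variables [h = x - y]. *)
Lemma gag_shift v : measurable_fun setT v ->
  gag v = (\int[mu]_h ((kern a h)%:E * L2sq mu (fun x => v (x + h)%R - v x)%R))%E.
Proof.
move=> mv; rewrite /gag fubini_tonelli2; last 2 first.
- exact: measurable_gag_integrand.
- by move=> z; rewrite lee_fin mulr_ge0 ?sqr_ge0 ?kern_ge0.
rewrite /fubini_G /=.
have E y : (\int[mu]_x ((v x - v y) ^+ 2 * kern a (x - y))%:E =
    \int[mu]_h ((v (h + y)%R - v y) ^+ 2 * kern a h)%:E)%E.
  rewrite -(@ge0_integral_shift _ _ y
    (fun x => ((v x - v y) ^+ 2 * kern a (x - y))%:E)).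
  - by apply: eq_integral => h _; rewrite addrK.
  - apply/measurable_EFinP; apply: measurable_funM.
      by apply: measurable_funX; apply: measurable_funB.
    apply: (measurableT_comp (@measurable_kern R n a)).
    exact: (measurable_shift (- y)).
  - by move=> x; rewrite lee_fin mulr_ge0 ?sqr_ge0 ?kern_ge0.
under eq_integral do rewrite E.
pose F z := ((v (z.2 + z.1) - v z.1) ^+ 2 * kern a z.2)%:E.
have mF : measurable_fun setT F.
  apply/measurable_EFinP; apply: measurable_funM.
    apply: measurable_funX; apply: measurable_funB.
      apply: (measurableT_comp mv); under eq_fun do rewrite addrC.
      exact: measurable_rV_add.
    exact: (measurableT_comp mv measurable_fst).
  exact: (measurableT_comp (@measurable_kern R n a) measurable_snd).
have F0 z : (0 <= F z)%E by rewrite lee_fin mulr_ge0 ?sqr_ge0 ?kern_ge0.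
rewrite (fubini_tonelli F mF F0).
apply: eq_integral => h _; rewrite /F /L2sq /=.
rewrite -ge0_integralZl_EFin ?kern_ge0//.
- by apply: eq_integral => x _; rewrite -EFinM mulrC (addrC h).
- by move=> x _; rewrite lee_fin sqr_ge0.
- by apply: measurable_sqr; apply: measurable_funB => //; exact: shift_measurable.
Qed.

(** The squared norm of the gradient is at most [M], expressed through test
    functions because the estimates for translations are proved for these. *)
Definition H1_approximable v (M : R) := forall e : R, 0 < e ->
  exists phi, [/\ Cc phi, (L2sq mu (fun x => v x - phi x)%R <= e%:E)%E &
    (\sum_(i < n) L2sq mu (partial i phi) <= (M + e)%:E)%E].

Lemma coord_sqr_le_enorm h (i : 'I_n) : h ord0 i ^+ 2 <= enorm h ^+ 2.
Proof.
rewrite -real_normK ?num_real// lerXn2r ?nnegrE ?enorm_ge0//.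
exact: enorm_coord.
Qed.

Lemma L2sq_diff_le v h : measurable_fun setT v ->
  (L2sq mu (fun x => v (x + h)%R - v x)%R <= 4%:E * L2sq mu v)%E.
Proof.
move=> mv; have mvh := shift_measurable h mv.
have mNv : measurable_fun setT (fun x => -1 * v x) by apply: measurable_funM.
have -> : (fun x => v (x + h)%R - v x) = (fun x => v (x + h) + -1 * v x).
  by apply/funext => x; rewrite mulN1r.
apply: le_trans (L2sq_add_le mu mvh mNv) _.
rewrite L2sq_shift// L2sq_scale// sqrrN expr1n mul1e -ge0_muleDl ?lee_fin//.
by rewrite -EFinD -natrD.
Qed.

(** For test functions the bound is [L2sq_shift_le]; the error term is moved by the
    shift without changing its square integral, and tends to zero. *)
Lemma L2sq_diff_approx v M h : measurable_fun setT v -> 0 <= M ->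
  H1_approximable v M ->
  (L2sq mu (fun x => v (x + h)%R - v x)%R <=
    (2 * n%:R * enorm h ^+ 2 * M)%:E)%E.
Proof.
move=> mv M0 H; apply/lee_addgt0Pr => e e0.
pose c : R := 2 * n%:R * enorm h ^+ 2.
have c0 : 0 <= c by rewrite /c !mulr_ge0 ?sqr_ge0 ?ler0n ?enorm_ge0.
(* The error [e / (c + 8)] enters once with factor [c] and once with [2 * 4]. *)
have c8 : 0 < c + 8 by rewrite ltr_wpDl.
have [phi [cphi vphi dphi]] := H (e / (c + 8)) (divr_gt0 e0 c8).
have mphi := Cc_measurable cphi.
pose r x := v x - phi x.
have mr : measurable_fun setT r by apply: measurable_funB.
have -> : (fun x => v (x + h) - v x) =
    (fun x => (phi (x + h) - phi x) + (r (x + h) - r x)).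
  by apply/funext => x; rewrite /r; ring.
apply: le_trans (L2sq_add_le mu _ _) _.
- by apply: measurable_funB => //; exact: shift_measurable.
- by apply: measurable_funB => //; exact: shift_measurable.
have L1 : (L2sq mu (fun x => phi (x + h)%R - phi x)%R <=
    (n%:R * enorm h ^+ 2 * (M + e / (c + 8)))%:E)%E.
  apply: le_trans (L2sq_shift_le h cphi) _.
  rewrite -mulrA EFinM lee_wpmul2l ?lee_fin//.
  apply: (@le_trans _ _
    ((enorm h ^+ 2)%:E * \sum_(i < n) L2sq mu (partial i phi))%E).
    rewrite ge0_sume_distrr; last by move=> i _; exact: L2sq_ge0.
    apply: lee_sum => i _; rewrite lee_wpmul2r ?L2sq_ge0//.
    by rewrite lee_fin coord_sqr_le_enorm.
  by rewrite [leRHS]EFinM; apply: lee_wpmul2l; rewrite ?lee_fin ?sqr_ge0.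
have L2 : (L2sq mu (fun x => r (x + h)%R - r x)%R <= (4 * (e / (c + 8)))%:E)%E.
  apply: le_trans (L2sq_diff_le h mr) _.
  by rewrite EFinM lee_wpmul2l ?lee_fin.
apply: (@le_trans _ _ (2%:E * (n%:R * enorm h ^+ 2 * (M + e / (c + 8)))%:E +
    2%:E * (4 * (e / (c + 8)))%:E)%E).
  by apply: leeD; rewrite lee_wpmul2l ?lee_fin.
rewrite -!EFinM -!EFinD lee_fin le_eqVlt; apply/orP; left; apply/eqP.
rewrite -/c (_ : 2 * (n%:R * enorm h ^+ 2 * (M + e / (c + 8))) =
  c * (M + e / (c + 8))); last by rewrite /c; ring.
by field; rewrite gt_eqF.
Qed.

Definition gkern_mass : R := fine (\int[mu]_h (gkern s h)%:E)%E.

Lemma gkern_massE : (\int[mu]_h (gkern s h)%:E = gkern_mass%:E)%E.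
Proof.
rewrite /gkern_mass fineK// ge0_fin_numE; first exact: integral_gkern_lty.
by apply: integral_ge0 => h _; rewrite lee_fin gkern_ge0.
Qed.

Lemma gkern_mass_ge0 : 0 <= gkern_mass.
Proof.
by rewrite fine_ge0//; apply: integral_ge0 => h _; rewrite lee_fin gkern_ge0.
Qed.

(** The embedding of [H^1] into [H^s]: for short shifts the difference is
    controlled by the gradient, for long ones by the function itself. *)
Lemma gag_le v (M B : R) : measurable_fun setT v -> 0 <= M ->
  (L2sq mu v <= B%:E)%E -> H1_approximable v M ->
  (gag v <= (gkern_mass * (4 * B + 2 * n%:R * M))%:E)%E.
Proof.
move=> mv M0 vB H.
have B0 : 0 <= B by rewrite -lee_fin; apply: le_trans vB; exact: L2sq_ge0.
pose c : R := 4 * B + 2 * n%:R * M.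
have c0 : 0 <= c by rewrite /c addr_ge0 ?mulr_ge0 ?ler0n.
rewrite gag_shift// EFinM -gkern_massE.
have mgk : measurable_fun setT (fun h : 'rV[R]_n => (gkern s h)%:E).
  by apply/measurable_EFinP; exact: measurable_gkern.
rewrite -(ge0_integralZr _ measurableT mgk) ?lee_fin//; last first.
  by move=> h _; rewrite lee_fin gkern_ge0.
have mL : measurable_fun setT (fun h => L2sq mu (fun x => v (x + h)%R - v x)%R).
  pose F z := ((v (z.2 + z.1) - v z.2) ^+ 2)%:E.
  have mF : measurable_fun setT F.
    apply/measurable_EFinP; apply: measurable_funX; apply: measurable_funB.
      apply: (measurableT_comp mv); under eq_fun do rewrite addrC.
      exact: measurable_rV_add.
    exact: (measurableT_comp mv measurable_snd).
  exact: (@measurable_fun_fubini_tonelli_F _ _ _ _ _ mu F mF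
    (fun z => (sqr_ge0 _ : (0 <= F z)%E))).
apply: ge0_le_integral => //.
- by move=> h _; rewrite mule_ge0 ?lee_fin ?kern_ge0// L2sq_ge0.
- by apply: emeasurable_funM => //; apply/measurable_EFinP; exact: measurable_kern.
- by apply: emeasurable_funM => //; apply/measurable_EFinP; exact: measurable_gkern.
move=> h _; rewrite /gkern EFinM -muleA lee_wpmul2l ?lee_fin ?kern_ge0//.
rewrite -EFinM; case: (leP 1 (enorm h ^+ 2)) => h1.
  rewrite mul1r; apply: le_trans (L2sq_diff_le h mv) _.
  apply: (@le_trans _ _ (4%:E * B%:E)%E); first by rewrite lee_wpmul2l ?lee_fin.
  by rewrite -EFinM lee_fin lerDl !mulr_ge0.
apply: le_trans (L2sq_diff_approx h mv M0 H) _.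
rewrite lee_fin /c mulrDr; apply: ler_wpDl; first by rewrite mulr_ge0 ?sqr_ge0 ?mulr_ge0.
by rewrite le_eqVlt; apply/orP; left; apply/eqP; ring.
Qed.

End gagliardo.

(** * Approximation by test functions in the energy norm *)

Lemma ae_le_Rintegral d (T : measurableType d) (R : realType)
    (m : {measure set T -> \bar R}) (D : set T) (f g : T -> R) :
  measurable D -> m.-integrable D (EFin \o f) -> m.-integrable D (EFin \o g) ->
  {ae m, forall x, D x -> f x <= g x} ->
  \int[m]_(x in D) f x <= \int[m]_(x in D) g x.
Proof.
move=> mD intf intg fg; rewrite -subr_ge0 -RintegralB//.
rewrite /Rintegral fine_ge0//.
have mgf : measurable_fun D (fun x => (g x - f x)%:E).
  exact: (measurable_int _ (integrableB mD intg intf)).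
rewrite (ae_eq_integral (fun x => `|(g x - f x)%:E|%E))//.
- exact: integral_ge0.
- exact: measurableT_comp.
- by apply: filterS fg => x H Dx; rewrite gee0_abs// lee_fin subr_ge0 H.
Qed.

Lemma ae_eq_Rintegral d (T : measurableType d) (R : realType)
    (m : {measure set T -> \bar R}) (D : set T) (f g : T -> R) :
  measurable D -> measurable_fun D f -> measurable_fun D g ->
  {ae m, forall x, D x -> f x = g x} ->
  \int[m]_(x in D) f x = \int[m]_(x in D) g x.
Proof.
move=> mD mf mg fg; rewrite /Rintegral; congr fine.
apply: ae_eq_integral => //; do ?exact/measurable_EFinP.
by apply: filterS fg => x H Dx; rewrite H.
Qed.

Lemma integrable_ge0_lty d (T : measurableType d) (R : realType)
    (m : {measure set T -> \bar R}) (D : set T) (f : T -> R) :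
  measurable D -> measurable_fun D f -> (forall x, D x -> 0 <= f x) ->
  (\int[m]_(x in D) (f x)%:E < +oo)%E -> m.-integrable D (EFin \o f).
Proof.
move=> mD mf f0 foo; apply/integrableP; split; first exact/measurable_EFinP.
have -> : (\int[m]_(x in D) `|(EFin \o f) x| = \int[m]_(x in D) (f x)%:E)%E.
  by apply: eq_integral => x /set_mem Dx /=; rewrite ger0_norm ?f0.
exact: foo.
Qed.

Section energy.
Context (R : realType) (n : nat) (s : R) (s01 : 0 < s < 1).
Variables (U : set 'rV[R]_n) (mU : measurable U).
Local Notation mu := (lebesgue_rV R n).
Local Notation a := (n%:R + 2 * s).
Local Notation rV2 := ('rV[R]_n * 'rV[R]_n)%type.
Implicit Types (u v w f phi psi : 'rV[R]_n -> R) (x h : 'rV[R]_n) (z : rV2).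

Lemma partial_sub f g i : elementary_smooth f -> elementary_smooth g ->
  partial i (fun x => f x - g x) = (fun x => partial i f x - partial i g x).
Proof.
move=> sf sg; apply/funext => x; rewrite /partial.
have df := elementary_smooth_is_partial i x sf.
have dg := elementary_smooth_is_partial i x sg.
by have [_] := is_deriveB df dg.
Qed.

Lemma X12D_H1 u : X12D U u -> H1 u. Proof. by case. Qed.

Lemma X12D_Lfun2 u : X12D U u -> u \in Lfun mu 2%:E.
Proof. by case=> -[]. Qed.

Lemma X12D_measurable u : X12D U u -> measurable_fun setT u.
Proof. by move=> /X12D_Lfun2; exact: Lfun2_measurable. Qed.

Let grad_err u phi x := \sum_(i < n) (wpartial i u x - partial i phi x) ^+ 2.

Lemma measurable_grad_err u phi : H1 u -> Cc phi ->
  measurable_fun setT (grad_err u phi).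
Proof.
move=> Hu cphi; apply: measurable_sum => i; apply: measurable_funX.
apply: measurable_funB; first exact: wpartial_measurable.
exact: Cc_measurable (Cc_partial i cphi).
Qed.

Lemma grad_err_ge0 u phi x : 0 <= grad_err u phi x.
Proof. by apply: sumr_ge0 => i _; exact: sqr_ge0. Qed.

(** A better approximation [phi'] of [u] gives the approximation [phi' - phi] of
    [u - phi]. Its gradient vanishes off [U] and is compared there with the two
    gradient errors, of which the one of [phi'] is arbitrarily small. *)
Lemma H1_approximable_sub u phi (e : R) : X12D U u -> 0 < e -> Cc phi ->
  closure [set x | phi x != 0] `<=` U ->
  (\int[mu]_(x in U) (grad_err u phi x)%:E < e%:E)%E ->
  H1_approximable (fun x => u x - phi x) (2 * e).
Proof.
move=> Xu e0 cphi phiU gphi e' e'0.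
have e2 : 0 < e' / 2 by rewrite divr_gt0.
have [phi' [cphi' phiU' L' gphi']] := X12D_approx mU Xu e2.
exists (fun x => phi' x - phi x); split; first exact: Cc_sub.
  rewrite (_ : (fun x => _) = (fun x => u x - phi' x)).
    by apply: le_trans (ltW L') _; rewrite lee_fin ler_pdivrMr//; lra.
  by apply/funext => x; ring.
have [sphi _] := cphi; have [sphi' _] := cphi'.
have mp i : measurable_fun setT (partial i (fun x => phi' x - phi x)).
  by apply: Cc_measurable; apply: Cc_partial; exact: Cc_sub.
have mg := measurable_grad_err (X12D_H1 Xu) cphi.
have mg' := measurable_grad_err (X12D_H1 Xu) cphi'.
rewrite /L2sq -ge0_integral_sum//; last 2 first.
- by move=> i; exact: measurable_sqr.
- by move=> i x _; rewrite lee_fin sqr_ge0.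
pose S x := \sum_(i < n) (partial i (fun x => phi' x - phi x) x) ^+ 2.
have mS : measurable_fun setT (EFin \o S).
  by apply/measurable_EFinP; apply: measurable_sum => i; exact: measurable_funX.
have -> : (\int[mu]_x (\sum_(i < n)
    ((partial i (fun x => phi' x - phi x) x) ^+ 2)%:E) =
    \int[mu]_(x in U) (S x)%:E)%E.
  rewrite [RHS]integral_mkcond; apply: eq_integral => x _.
  rewrite sumEFin patchE; case: ifPn => // /negP xU.
  rewrite big1// => i _; apply/eqP; rewrite sqrf_eq0 partial_sub//.
  have off f : closure [set x | f x != 0] `<=` U -> partial i f x = 0.
    move=> fU; apply/eqP/negPn/negP => fx; apply: xU; apply/mem_set/fU.
    exact: partial_support fx.
  by rewrite !off// subrr.
apply: (@le_trans _ _ (\int[mu]_(x in U)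
    (2%:E * (grad_err u phi x)%:E + 2%:E * (grad_err u phi' x)%:E))%E).
  apply: ge0_le_integral => //.
  - by move=> x _; rewrite lee_fin sumr_ge0// => i _; exact: sqr_ge0.
  - exact: measurable_funTS.
  - apply: measurable_funTS; apply: emeasurable_funD; apply: emeasurable_funM => //;
    exact/measurable_EFinP.
  - move=> x _; rewrite -!EFinM -EFinD lee_fin /S /grad_err !mulr_sumr -big_split/=.
    apply: ler_sum => i _; rewrite partial_sub//.
    have := sqr_ge0 ((wpartial i u x - partial i phi x) +
      (wpartial i u x - partial i phi' x)).
    by nra.
have mg1 : measurable_fun U (fun x => (grad_err u phi x)%:E).
  by apply/measurable_EFinP; exact: measurable_funTS.
have mg1' : measurable_fun U (fun x => (grad_err u phi' x)%:E).
  by apply/measurable_EFinP; exact: measurable_funTS.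
rewrite ge0_integralD//; last 4 first.
- by move=> x _; rewrite -EFinM lee_fin mulr_ge0 ?grad_err_ge0.
- exact: emeasurable_funM.
- by move=> x _; rewrite -EFinM lee_fin mulr_ge0 ?grad_err_ge0.
- exact: emeasurable_funM.
rewrite !ge0_integralZl_EFin//; last 2 first.
- by move=> x _; rewrite lee_fin grad_err_ge0.
- by move=> x _; rewrite lee_fin grad_err_ge0.
apply: (@le_trans _ _ (2%:E * e%:E + 2%:E * (e' / 2)%:E)%E).
  by apply: leeD; rewrite lee_wpmul2l ?lee_fin// ltW.
by rewrite -!EFinM -EFinD lee_fin; lra.
Qed.

(** The constant of [gag_le] for [B = e] and [M = 2 * e], divided by [e]. *)
Definition embed_const : R := gkern_mass n s * (4 + 4 * n%:R).

Lemma embed_const_ge0 : 0 <= embed_const.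
Proof. by rewrite mulr_ge0 ?gkern_mass_ge0// addr_ge0// mulr_ge0. Qed.

(** By the embedding, the approximations provided by membership in the energy
    space are also close in the nonlocal part of the energy, which involves
    differences with points outside [U]. *)
Lemma X12D_approx_gag u (e : R) : X12D U u -> 0 < e ->
  exists phi, [/\ Cc phi, closure [set x | phi x != 0] `<=` U,
    (L2sq mu (fun x => u x - phi x)%R <= e%:E)%E,
    (\int[mu]_(x in U) (grad_err u phi x)%:E <= e%:E)%E &
    (gag s (fun x => u x - phi x)%R <= (embed_const * e)%:E)%E].
Proof.
move=> Xu e0; have [phi [cphi phiU L g]] := X12D_approx mU Xu e0.
exists phi; split => //; [exact: ltW|exact: ltW|].
apply: le_trans (gag_le s01 _ _ (ltW L) (H1_approximable_sub Xu e0 cphi phiU g)) _.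
- apply: measurable_funB; last exact: Cc_measurable.
  exact: X12D_measurable Xu.
- by rewrite mulr_ge0// ltW.
rewrite lee_fin /embed_const le_eqVlt; apply/orP; left; apply/eqP; ring.
Qed.

Lemma Cc_gag_lty phi : Cc phi -> (gag s phi < +oo)%E.
Proof.
move=> cphi; have phi2 := Lfun2_lty (Cc_Lfun2 cphi).
have phi0 := L2sq_ge0 mu phi.
have fphi : L2sq mu phi \is a fin_num by rewrite ge0_fin_numE.
pose M := \sum_(i < n) fine (L2sq mu (partial i phi)).
have M0 : 0 <= M by apply: sumr_ge0 => i _; rewrite fine_ge0// L2sq_ge0.
have gl := @gag_le _ _ s s01 phi M (fine (L2sq mu phi)) (Cc_measurable cphi) M0.
apply: le_lt_trans (gl _ _) _; last by rewrite ltry.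
  by rewrite fineK.
move=> e e0; exists phi; split => //.
  rewrite /L2sq; under eq_integral do rewrite subrr expr0n.
  by rewrite integral0 lee_fin ltW.
rewrite /M EFinD -sumEFin.
have -> : (\sum_(i < n) L2sq mu (partial i phi) =
    \sum_(i < n) (fine (L2sq mu (partial i phi)))%:E)%E.
  apply: eq_bigr => i _; rewrite fineK// ge0_fin_numE ?L2sq_ge0//.
  exact: Lfun2_lty (Cc_Lfun2 (Cc_partial i cphi)).
by rewrite leeDl// lee_fin ltW.
Qed.

Lemma gag_add_le f g : measurable_fun setT f -> measurable_fun setT g ->
  (gag s (fun x => f x + g x)%R <= 2%:E * gag s f + 2%:E * gag s g)%E.
Proof.
move=> mf mg; have mfg : measurable_fun setT (fun x => f x + g x).
  exact: measurable_funD.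
have m1 := measurable_gag_integrand s mf; have m2 := measurable_gag_integrand s mg.
have p0 (f0 : 'rV[R]_n -> R) z : (0 <= ((f0 z.1 - f0 z.2) ^+ 2 * kern a (z.1 - z.2))%:E)%E.
  by rewrite lee_fin mulr_ge0 ?sqr_ge0 ?kern_ge0.
rewrite /gag.
rewrite -(ge0_integralZl_EFin _ measurableT (fun z _ => p0 f z) m1 (ler0n R 2)).
rewrite -(ge0_integralZl_EFin _ measurableT (fun z _ => p0 g z) m2 (ler0n R 2)).
rewrite -ge0_integralD//.
- apply: ge0_le_integral => //.
  + by move=> z _; exact: (p0 (fun x => f x + g x)).
  + exact: (measurable_gag_integrand s mfg).
  + by apply: emeasurable_funD; exact: emeasurable_funM.
  move=> z _; rewrite -!EFinM -EFinD lee_fin.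
  rewrite !mulrA -mulrDl ler_wpM2r ?kern_ge0//.
  by have := sqr_ge0 ((f z.1 - f z.2) - (g z.1 - g z.2)); nra.
- by move=> z _; rewrite mule_ge0.
- exact: emeasurable_funM.
- by move=> z _; rewrite mule_ge0.
- exact: emeasurable_funM.
Qed.

(** The nonlocal energy is finite for one approximation and for its error. *)
Lemma X12D_gag_lty u : X12D U u -> (gag s u < +oo)%E.
Proof.
move=> Xu; have [phi [cphi phiU L g G]] := X12D_approx_gag Xu ltr01.
have mphi := Cc_measurable cphi.
have mup : measurable_fun setT (fun x => u x - phi x).
  by apply: measurable_funB => //; exact: X12D_measurable Xu.
have := gag_add_le mup mphi.
rewrite (_ : (fun x => u x - phi x + phi x) = u); last first.
  by apply/funext => x; rewrite subrK.
move=> H; apply: le_lt_trans H _; rewrite lte_add_pinfty//.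
  by rewrite lte_mul_pinfty ?lee_fin//; apply: le_lt_trans G _; rewrite ltry.
by rewrite lte_mul_pinfty ?lee_fin//; exact: Cc_gag_lty.
Qed.

End energy.

(** * Smooth absolute value and the gain *)

Lemma Rintegral_lin3 d (T : measurableType d) (R : realType)
    (m : {measure set T -> \bar R}) (D : set T) (f g h : T -> R) (b c : R) :
  measurable D -> m.-integrable D (EFin \o f) -> m.-integrable D (EFin \o g) ->
  m.-integrable D (EFin \o h) ->
  m.-integrable D (fun x => (f x + b * g x + c * h x)%:E) /\
  \int[m]_(x in D) (f x + b * g x + c * h x) =
  \int[m]_(x in D) f x + b * \int[m]_(x in D) g x + c * \int[m]_(x in D) h x.
Proof.
move=> mD intf intg inth.
have ibg : m.-integrable D (EFin \o (fun x => b * g x)).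
  by have := integrableZl mD b intg.
have ich : m.-integrable D (EFin \o (fun x => c * h x)).
  by have := integrableZl mD c inth.
have ifg : m.-integrable D (EFin \o (fun x => f x + b * g x)).
  exact: (integrableD mD intf ibg).
split; first exact: (integrableD mD ifg ich).
by rewrite RintegralD// RintegralD// !RintegralZl.
Qed.

Section smooth_absolute_value.
Context (R : realType) (n : nat).
Implicit Types (phi : 'rV[R]_n -> R).

(** A smooth contraction vanishing at zero and close to the absolute value: it
    maps test functions to test functions, which the absolute value does not. *)
Definition sabs (e t : R) : R := (t ^+ 2 + e ^+ 2) `^ 2^-1 - e.

Lemma sabs_lip (e a b : R) : 0 < e -> `|sabs e a - sabs e b| <= `|a - b|.
Proof.
move=> e0; rewrite /sabs opprB addrA subrK.
have p t : 0 < t ^+ 2 + e ^+ 2 by rewrite ltr_wpDl ?sqr_ge0// exprn_gt0.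
rewrite !powR12_sqrt ?(ltW (p _))//.
set A := Num.sqrt _; set B := Num.sqrt _.
have A0 : 0 < A by rewrite sqrtr_gt0 p.
have B0 : 0 < B by rewrite sqrtr_gt0 p.
have A2 : A ^+ 2 = a ^+ 2 + e ^+ 2 by rewrite sqr_sqrtr// ltW.
have B2 : B ^+ 2 = b ^+ 2 + e ^+ 2 by rewrite sqr_sqrtr// ltW.
have aA : `|a| <= A by rewrite -sqrtr_sqr ler_wsqrtr// lerDl sqr_ge0.
have bB : `|b| <= B by rewrite -sqrtr_sqr ler_wsqrtr// lerDl sqr_ge0.
have AB : 0 < A + B by rewrite addr_gt0.
rewrite -(ler_pM2r AB) -{1}(gtr0_norm AB) -normrM.
have -> : (A - B) * (A + B) = (a - b) * (a + b).
  by rewrite -!subr_sqr A2 B2; ring.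
rewrite normrM ler_wpM2l//; apply: le_trans (ler_normD _ _) _.
exact: lerD.
Qed.

Lemma sabs0 (e : R) : 0 < e -> sabs e 0 = 0.
Proof.
move=> e0; rewrite /sabs expr0n add0r powR12_sqrt ?sqr_ge0// sqrtr_sqr.
by rewrite gtr0_norm// subrr.
Qed.

Lemma sabs_near (e t : R) : 0 < e -> `|sabs e t - `|t| | <= e.
Proof.
move=> e0; rewrite /sabs.
have p : 0 <= t ^+ 2 + e ^+ 2 by rewrite addr_ge0 ?sqr_ge0.
rewrite powR12_sqrt//; set A := Num.sqrt _.
have A0 : 0 <= A by rewrite sqrtr_ge0.
have tA : `|t| <= A by rewrite -sqrtr_sqr ler_wsqrtr// lerDl sqr_ge0.
have At : A <= `|t| + e.
  rewrite -[leRHS]ger0_norm ?addr_ge0 ?(ltW e0)// -sqrtr_sqr ler_wsqrtr//.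
  rewrite sqrrD real_normK ?num_real// -addrA lerD2l lerDr.
  by rewrite mulrn_wge0// mulr_ge0// ltW.
by rewrite ler_norml; lra.
Qed.

Definition sabs_fun e phi := fun x : 'rV[R]_n => sabs e (phi x).

Lemma sabs_fun_support e phi : 0 < e ->
  [set x | sabs_fun e phi x != 0] `<=` [set x | phi x != 0].
Proof.
by move=> e0 x /=; apply: contra_neq => px; rewrite /sabs_fun px sabs0.
Qed.

Lemma sabs_fun_Cc e phi : 0 < e -> Cc phi -> Cc (sabs_fun e phi).
Proof.
move=> e0 [sphi [r rphi]]; split; last first.
  by exists r => x /(sabs_fun_support e0) px; exact: rphi.
apply: (@es_add R n (fun x => (phi x ^+ 2 + e ^+ 2) `^ 2^-1) (fun=> - e)).
  apply: es_powR => [|x].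
    by apply: es_add; [exact: es_mul|exact: es_cst].
  by rewrite ltr_wpDl ?sqr_ge0// exprn_gt0.
exact: es_cst.
Qed.

(** A contraction does not increase difference quotients, and the bound passes
    to their limits. *)
Lemma sabs_fun_partial_le e phi i x : 0 < e -> Cc phi ->
  `|partial i (sabs_fun e phi) x| <= `|partial i phi x|.
Proof.
move=> e0 cphi.
have L f : Cc f -> `|quot f i 1 k x| @[k --> \oo] --> `|partial i f x|.
  by move=> cf; rewrite -[partial i f x]mul1r; apply: cvg_norm; exact: quot_cvg.
apply: (ler_cvg_to (L _ (sabs_fun_Cc e0 cphi)) (L _ cphi)).
apply: nearW => k.
by rewrite /quot !normrM ler_wpM2l// sabs_lip.
Qed.

End smooth_absolute_value.

Section forms.
Context (R : realType) (n : nat) (s : R) (s01 : 0 < s < 1).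
Variables (Omega U : set 'rV[R]_n).
Hypotheses (mO : measurable Omega) (mU : measurable U).
Local Notation mu := (lebesgue_rV R n).
Local Notation mu2 := (mu \x mu)%E.
Local Notation a := (n%:R + 2 * s).
Local Notation rV2 := ('rV[R]_n * 'rV[R]_n)%type.
Local Notation Q := (Q_set Omega).
Implicit Types (u v w f phi psi : 'rV[R]_n -> R) (x h : 'rV[R]_n) (z : rV2).

Lemma measurable_Q : measurable Q.
Proof. by apply: measurableC; apply: measurableX; exact: measurableC. Qed.

Lemma integrable_grad u v : H1 u -> H1 v ->
  mu.-integrable Omega (EFin \o (fun x => \sum_(i < n) wpartial i u x * wpartial i v x)).
Proof.
move=> Hu Hv; apply: (integrableS measurableT) => //.
have : mu.-integrable setT (fun x => \sum_(i < n) (wpartial i u x * wpartial i v x)%:E)%E.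
  apply: integrable_sum => // i _.
  by apply: Lfun2_mul_integrable; exact: wpartial_Lfun2.
by apply: eq_integrable => // x _ /=; exact: sumEFin.
Qed.

Lemma integrable_gag u : measurable_fun setT u -> (gag s u < +oo)%E ->
  mu2.-integrable setT (fun z => ((u z.1 - u z.2) ^+ 2 * kern a (z.1 - z.2))%:E).
Proof.
move=> mX gu.
apply: (@integrable_ge0_lty _ _ _ _ _
  (fun z => (u z.1 - u z.2) ^+ 2 * kern a (z.1 - z.2))) => //.
- by apply/measurable_EFinP; exact: measurable_gag_integrand.
- by move=> z _; rewrite mulr_ge0 ?sqr_ge0 ?kern_ge0.
Qed.

(** The product of two differences is at most the sum of their squares. *)
Lemma integrable_nl u v : X12D U u -> X12D U v ->
  mu2.-integrable Q (EFin \o (fun z => (u z.1 - u z.2) * (v z.1 - v z.2) /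
     enorm (z.1 - z.2) `^ a)).
Proof.
move=> Xu Xv; apply: (integrableS measurableT) => //; first exact: measurable_Q.
have iu := integrable_gag (X12D_measurable Xu) (X12D_gag_lty s01 mU Xu).
have iv := integrable_gag (X12D_measurable Xv) (X12D_gag_lty s01 mU Xv).
apply: (le_integrable measurableT _ _ (integrableD measurableT iu iv)).
  apply/measurable_EFinP; apply: measurable_funM; last exact: measurable_kern2.
  apply: measurable_funM; apply: measurable_diff2.
    exact: X12D_measurable Xu.
  exact: X12D_measurable Xv.
move=> z _ /=; rewrite lee_fin -mulrDl normrM [leRHS]normrM.
rewrite ler_wpM2r// normrM [leRHS]ger0_norm ?addr_ge0 ?sqr_ge0//.
rewrite -(real_normK (num_real (u z.1 - u z.2))).
rewrite -(real_normK (num_real (v z.1 - v z.2))).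
move: `|u z.1 - u z.2| `|v z.1 - v z.2| (normr_ge0 (u z.1 - u z.2))
  (normr_ge0 (v z.1 - v z.2)) => A B A0 B0.
by have := sqr_ge0 (A - B); nra.
Qed.

Local Notation grad_form u v :=
  (\int[mu]_(x in Omega) (\sum_(i < n) wpartial i u x * wpartial i v x)).
Local Notation nl_form u v :=
  (\int[mu2]_(z in Q) ((u z.1 - u z.2) * (v z.1 - v z.2) /
     enorm (z.1 - z.2) `^ a)).

Lemma inner_ge0 u : 0 <= inner Omega s u u.
Proof.
rewrite /inner addr_ge0//; apply: Rintegral_ge0.
  by move=> x _; apply: sumr_ge0 => i _; rewrite -expr2 sqr_ge0.
by move=> z _; rewrite -expr2 mulr_ge0 ?sqr_ge0// kern_ge0.
Qed.

Lemma eta_norm_sqr u : eta_norm Omega s u ^+ 2 = inner Omega s u u.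
Proof. by rewrite /eta_norm sqr_sqrtr// inner_ge0. Qed.

(** The integrand, up to the kernel, of the nonlocal part of
    [inner phi phi + k ^+ 2 * inner u u - 2 * k * inner u psi]. For
    [psi = `|phi|] it is non-negative and vanishes exactly when [phi] does not
    change sign between the two points and [`|phi| - k * u] takes equal values. *)
Definition gain (k : R) u phi psi z : R :=
  (phi z.1 - phi z.2) ^+ 2 + k ^+ 2 * (u z.1 - u z.2) ^+ 2 -
  2 * k * ((u z.1 - u z.2) * (psi z.1 - psi z.2)).

(** The gradient part is non-negative and can be dropped: complete the square
    and use that [psi] has the smaller gradient. *)
Lemma integral_gain_le (k : R) u phi psi : 0 <= k ->
  X12D U u -> X12D U phi -> X12D U psi ->
  {ae mu, forall x, forall i, `|wpartial i psi x| <= `|wpartial i phi x|} ->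
  mu2.-integrable Q (fun z => (gain k u phi psi z * kern a (z.1 - z.2))%:E) /\
  \int[mu2]_(z in Q) (gain k u phi psi z * kern a (z.1 - z.2)) <=
  inner Omega s phi phi + k ^+ 2 * inner Omega s u u -
    2 * k * inner Omega s u psi.
Proof.
move=> k0 Xu Xphi Xpsi pp.
have [iN EN] := Rintegral_lin3 (k ^+ 2) (- (2 * k)) measurable_Q
  (integrable_nl Xphi Xphi) (integrable_nl Xu Xu) (integrable_nl Xu Xpsi).
have [iG EG] := Rintegral_lin3 (k ^+ 2) (- (2 * k)) mO
  (integrable_grad (X12D_H1 Xphi) (X12D_H1 Xphi))
  (integrable_grad (X12D_H1 Xu) (X12D_H1 Xu))
  (integrable_grad (X12D_H1 Xu) (X12D_H1 Xpsi)).
have E z : gain k u phi psi z * kern a (z.1 - z.2) =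
    (phi z.1 - phi z.2) * (phi z.1 - phi z.2) / enorm (z.1 - z.2) `^ a +
    k ^+ 2 * ((u z.1 - u z.2) * (u z.1 - u z.2) / enorm (z.1 - z.2) `^ a) +
    - (2 * k) * ((u z.1 - u z.2) * (psi z.1 - psi z.2) / enorm (z.1 - z.2) `^ a).
  by rewrite /gain /kern; ring.
split; first by under eq_fun do rewrite E.
under eq_Rintegral do rewrite E.
rewrite EN /inner; set N1 := nl_form _ _; set N2 := nl_form _ _; set N3 := nl_form _ _.
have : 0 <= grad_form phi phi + k ^+ 2 * grad_form u u - 2 * k * grad_form u psi.
  have Z : \int[mu]_(x in Omega) (0 : R) = 0 by rewrite /Rintegral integral0.
  rewrite -mulNr -EG -[X in X <= _]Z.
  apply: ae_le_Rintegral => //; first exact: integrable0.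
  apply: filterS pp => x px _.
  rewrite !mulr_sumr -!big_split/=; apply: sumr_ge0 => i _.
  have := px i; rewrite -ler_sqr ?nnegrE// !real_normK ?num_real// -subr_ge0.
  move: (wpartial i u x) (wpartial i psi x) (wpartial i phi x) => A B C BC.
  rewrite (_ : _ + _ = (k * A - B) ^+ 2 + (C ^+ 2 - B ^+ 2)); last by ring.
  by rewrite addr_ge0 ?sqr_ge0.
set G1 := grad_form _ _; set G2 := grad_form _ _; set G3 := grad_form _ _.
by clear; clearbody G1 G2 G3 N1 N2 N3; move=> H; lra.
Qed.

End forms.

(** * Energies and right-hand sides along the approximation *)

Lemma ae_le_integrable d (T : measurableType d) (R : realType)
    (m : {measure set T -> \bar R}) (D : set T) (f g : T -> R) :
  measurable D -> measurable_fun D f -> m.-integrable D (EFin \o g) ->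
  {ae m, forall x, D x -> `|f x| <= g x} -> m.-integrable D (EFin \o f).
Proof.
move=> mD mf /integrableP[mg goo] fg; apply/integrableP; split.
  exact/measurable_EFinP.
apply: le_lt_trans goo; apply: ae_ge0_le_integral => //.
- by do 2 apply: measurableT_comp => //.
- exact: measurableT_comp.
- by apply: filterS fg => x H Dx; rewrite /= lee_fin (le_trans (H Dx))// ler_norm.
Qed.

Lemma Rintegral_le_fin d (T : measurableType d) (R : realType)
    (m : {measure set T -> \bar R}) (D : set T) (f : T -> R) (r : R) :
  (forall x, D x -> 0 <= f x) -> (\int[m]_(x in D) (f x)%:E <= r%:E)%E ->
  \int[m]_(x in D) f x <= r.
Proof.
move=> f0 fr; rewrite /Rintegral -lee_fin fineK//.
rewrite ge0_fin_numE; first by apply: le_lt_trans fr _; rewrite ltry.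
by apply: integral_ge0 => x Dx; rewrite lee_fin f0.
Qed.

Section approximation_step.
Context (R : realType) (n : nat) (s : R) (s01 : 0 < s < 1).
Variables (Omega U : set 'rV[R]_n).
Hypotheses (mO : measurable Omega) (mU : measurable U) (OU : Omega `<=` U).
Hypothesis Ofin : (lebesgue_rV R n Omega < +oo)%E.
Local Notation mu := (lebesgue_rV R n).
Local Notation mu2 := (mu \x mu)%E.
Local Notation a := (n%:R + 2 * s).
Local Notation rV2 := ('rV[R]_n * 'rV[R]_n)%type.
Local Notation Q := (Q_set Omega).
Local Notation c := (embed_const n s).
Implicit Types (u v w f phi psi : 'rV[R]_n -> R) (x h : 'rV[R]_n) (z : rV2).

Lemma young_sqr (d A B : R) : 0 < d ->
  A ^+ 2 <= B ^+ 2 + d * B ^+ 2 + (1 + d^-1) * (B - A) ^+ 2.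
Proof.
move=> d0; rewrite -subr_ge0.
rewrite [X in 0 <= X](_ : _ = d^-1 * (d * B + (B - A)) ^+ 2); last by field; rewrite gt_eqF.
by rewrite mulr_ge0 ?sqr_ge0// invr_ge0 ltW.
Qed.

Let err_const (d k : R) : 0 < d <= 1 -> 0 <= k ->
  (1 + d^-1) * (k * d ^+ 2) <= 2 * k * d.
Proof.
move=> /andP[d0 d1] k0.
rewrite [leLHS](_ : _ = k * d * (d + 1)); last by field; rewrite gt_eqF.
by rewrite (mulrC 2) -!mulrA ler_wpM2l// mulrC ler_wpM2r ?(ltW d0)//; lra.
Qed.

(** Both parts of the energy of [phi] are estimated by Young's inequality with
    parameter [d]: the factor [1 + d^-1] in front of the squared error is
    compensated by an error of order [d ^+ 2]. *)
Lemma inner_Cc_le u phi (d : R) : X12D U u -> Cc phi ->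
  closure [set x | phi x != 0] `<=` U -> 0 < d <= 1 ->
  (\int[mu]_(x in U)
    (\sum_(i < n) (wpartial i u x - partial i phi x) ^+ 2)%R%:E <= (d ^+ 2)%:E)%E ->
  (gag s (fun x => u x - phi x)%R <= (c * d ^+ 2)%:E)%E ->
  inner Omega s phi phi <= (1 + d) * inner Omega s u u + 2 * (1 + c) * d.
Proof.
move=> Xu cphi phiU d01 Gerr gerr; have /andP[d0 d1] := d01.
have Xphi := X12D_Cc mU cphi phiU.
have [Hu Hphi] := (X12D_H1 Xu, X12D_H1 Xphi).
have dV0 : 0 <= 1 + d^-1 by rewrite addr_ge0// invr_ge0 ltW.
pose ge x := \sum_(i < n) (wpartial i u x - partial i phi x) ^+ 2.
have mge : measurable_fun setT ge := measurable_grad_err Hu cphi.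
have ge0 x : 0 <= ge x by apply: sumr_ge0 => i _; exact: sqr_ge0.
have GO : (\int[mu]_(x in Omega) (ge x)%:E <= (d ^+ 2)%:E)%E.
  apply: le_trans Gerr; apply: ge0_subset_integral => //.
    by apply/measurable_EFinP; exact: measurable_funTS.
  by move=> x _; rewrite lee_fin ge0.
have ige : mu.-integrable Omega (EFin \o ge).
  apply: integrable_ge0_lty => //; first exact: measurable_funTS.
  by apply: le_lt_trans GO _; rewrite ltry.
have mup : measurable_fun setT (fun x => u x - phi x).
  by apply: measurable_funB; [exact: X12D_measurable Xu|exact: Cc_measurable].
pose ne z := ((u z.1 - phi z.1) - (u z.2 - phi z.2)) ^+ 2 * kern a (z.1 - z.2).
have ne0 z : 0 <= ne z by rewrite mulr_ge0 ?sqr_ge0 ?kern_ge0.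
have ine : mu2.-integrable Q (EFin \o ne).
  apply: (integrableS measurableT) => //; first exact: measurable_Q.
  by apply: (integrable_gag mup); apply: le_lt_trans gerr _; rewrite ltry.
have NQ : (\int[mu2]_(z in Q) (ne z)%:E <= (c * d ^+ 2)%:E)%E.
  apply: le_trans gerr; apply: ge0_subset_integral => //.
  - exact: measurable_Q.
  - exact: (measurable_gag_integrand s mup).
  - by move=> z _; rewrite lee_fin ne0.
have [iG EG] := Rintegral_lin3 d (1 + d^-1) mO
  (integrable_grad mO Hu Hu) (integrable_grad mO Hu Hu) ige.
have [iN EN] := Rintegral_lin3 d (1 + d^-1) (measurable_Q mO)
  (integrable_nl s01 mO mU Xu Xu) (integrable_nl s01 mO mU Xu Xu) ine.
have LG : \int[mu]_(x in Omega) (\sum_(i < n) wpartial i phi x * wpartial i phi x)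
    <= (1 + d) * \int[mu]_(x in Omega) (\sum_(i < n) wpartial i u x * wpartial i u x)
     + 2 * d.
  apply: le_trans (ae_le_Rintegral mO (integrable_grad mO Hphi Hphi) iG _) _ => //.
    have := ae_forall_ord (fun i => wpartial_Cc i cphi).
    apply: filterS => x px _; rewrite !mulr_sumr -!big_split/=.
    by apply: ler_sum => i _; rewrite px -!expr2; exact: young_sqr.
  rewrite EG [in leRHS]mulrDl mul1r lerD2l.
  apply: le_trans (_ : (1 + d^-1) * (1 * d ^+ 2) <= _).
    by rewrite ler_wpM2l// mul1r; exact: Rintegral_le_fin.
  by apply: le_trans (err_const d01 ler01) _; rewrite mulr1.
have LN : \int[mu2]_(z in Q) ((phi z.1 - phi z.2) * (phi z.1 - phi z.2) /
     enorm (z.1 - z.2) `^ a)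
    <= (1 + d) * \int[mu2]_(z in Q) ((u z.1 - u z.2) * (u z.1 - u z.2) /
     enorm (z.1 - z.2) `^ a) + 2 * c * d.
  apply: le_trans (le_Rintegral (measurable_Q mO)
    (integrable_nl s01 mO mU Xphi Xphi) iN _) _.
    move=> z _; pose B := u z.1 - u z.2; pose A := phi z.1 - phi z.2.
    rewrite [leRHS](_ : _ = (B ^+ 2 + d * B ^+ 2 + (1 + d^-1) * (B - A) ^+ 2) *
      kern a (z.1 - z.2)); last first.
      rewrite /ne /A /B /kern; move: (d^-1) (_ `^ _)^-1 => dV k.
      by clear; ring.
    rewrite [leLHS](_ : _ = A ^+ 2 * kern a (z.1 - z.2)); last by rewrite expr2.
    by rewrite ler_wpM2r ?kern_ge0//; exact: young_sqr.
  rewrite EN [in leRHS]mulrDl mul1r lerD2l.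
  apply: le_trans (_ : (1 + d^-1) * (c * d ^+ 2) <= _).
    by rewrite ler_wpM2l//; exact: (Rintegral_le_fin (fun z _ => ne0 z) NQ).
  by apply: err_const => //; exact: embed_const_ge0.
apply: le_trans (lerD LG LN) _.
by rewrite /inner le_eqVlt; apply/orP; left; apply/eqP; clear; ring.
Qed.

Let abs_le_sqr (d A : R) : 0 < d -> A <= d^-1 * A ^+ 2 + d.
Proof.
move=> d0; rewrite -subr_ge0.
rewrite [X in 0 <= X](_ : _ = d^-1 * ((A - d / 2) ^+ 2 + 3 / 4 * d ^+ 2)).
  by rewrite mulr_ge0 ?addr_ge0 ?sqr_ge0 ?invr_ge0 ?mulr_ge0 ?sqr_ge0// ltW.
by field; rewrite gt_eqF.
Qed.

Let chain (P F W D E d : R) : - d <= P - F -> W - F <= D -> D <= E + d ->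
  W - P <= E + 2 * d.
Proof. lra. Qed.

(** The pointwise difference is at most [`|w - phi|] plus [d]; its first part is
    bounded by [d^-1 * (w - phi) ^+ 2 + d], which integrates to order [d]. *)
Lemma approx_integral_le w phi f (d B : R) : X12D U w -> Cc phi ->
  measurable_fun setT f -> 0 <= B -> 0 < d ->
  {ae mu, forall x, Omega x -> 0 <= f x <= B} ->
  (L2sq mu (fun x => w x - phi x)%R <= (d ^+ 2)%:E)%E ->
  \int[mu]_(x in Omega) (`|w x| * f x) <=
  \int[mu]_(x in Omega) (sabs_fun d phi x * f x) +
    B * (d * (1 + 2 * fine (mu Omega))).
Proof.
move=> Xw cphi mf B0 d0 f0B werr.
have mw := X12D_measurable Xw; have mphi := Cc_measurable cphi.
have cpsi := sabs_fun_Cc d0 cphi.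
have iw := Lfun2_integrable_fin mO Ofin (X12D_Lfun2 Xw).
have ipsi := Lfun2_integrable_fin mO Ofin (Cc_Lfun2 cpsi).
have bnd g : measurable_fun setT g -> mu.-integrable Omega (EFin \o g) ->
    mu.-integrable Omega (EFin \o (fun x => g x * f x)).
  move=> mg ig; apply: (@ae_le_integrable _ _ _ _ _ _ (fun x => B * `|g x|)) => //.
  - by apply: measurable_funTS; exact: measurable_funM.
  - by have := integrableZl mO B (integrable_norm ig).
  - apply: filterS f0B => x H Ox; have /andP[f0 fB] := H Ox.
    by rewrite normrM mulrC (ger0_norm f0) ler_wpM2r.
have iwf := bnd _ (measurableT_comp (@normr_measurable R setT) mw) (integrable_norm iw).
have ipsif := bnd _ (Cc_measurable cpsi) ipsi.
have i1 : mu.-integrable Omega (EFin \o (cst 1 : 'rV[R]_n -> R)) by exact: integrable_cst1.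
pose e2 x := (w x - phi x) ^+ 2.
have ie2 : mu.-integrable Omega (EFin \o e2).
  apply: (integrableS measurableT) => //.
  by apply: Lfun2_integrable_sqr; apply: Lfun2_sub;
    [exact: X12D_Lfun2 Xw|exact: Cc_Lfun2].
have [iL EL] := Rintegral_lin3 (B * d^-1) (2 * B * d) mO ipsif ie2 i1.
apply: le_trans (ae_le_Rintegral mO iwf iL _) _.
  apply: filterS f0B => x H Ox; have /andP[f0 fB] := H Ox.
  rewrite mulr1 -addrA -lerBlDl -mulrBl.
  apply: le_trans (_ : (d^-1 * e2 x + 2 * d) * f x <= _); last first.
    rewrite (_ : B * d^-1 * e2 x + 2 * B * d = (d^-1 * e2 x + 2 * d) * B).
      by rewrite ler_wpM2l// /e2 addr_ge0// mulr_ge0 ?sqr_ge0 ?invr_ge0// ltW.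
    by ring.
  rewrite ler_wpM2r//.
  have H1 := sabs_near (phi x) d0.
  have H2 : `|w x| - `|phi x| <= `|w x - phi x| by exact: lerB_dist.
  have H3 : `|w x - phi x| <= d^-1 * e2 x + d.
    by rewrite /e2 -(real_normK (num_real (w x - phi x))); exact: abs_le_sqr.
  move: H1; rewrite ler_norml /sabs_fun => /andP[H1 _].
  exact: chain H1 H2 H3.
rewrite EL -addrA lerD2l.
have L1 : \int[mu]_(x in Omega) e2 x <= d ^+ 2.
  apply: Rintegral_le_fin; first by move=> x _; exact: sqr_ge0.
  apply: le_trans werr; apply: ge0_subset_integral => //.
    by apply: measurable_sqr; exact: measurable_funB.
  by move=> x _; rewrite lee_fin sqr_ge0.
have -> : \int[mu]_(x in Omega) (cst 1 x : R) = fine (mu Omega).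
  by rewrite Rintegral_cst// mul1r.
apply: le_trans (_ : B * d^-1 * d ^+ 2 + 2 * B * d * fine (mu Omega) <= _).
  by rewrite lerD2r ler_wpM2l// mulr_ge0// invr_ge0 ltW.
rewrite le_eqVlt; apply/orP; left; apply/eqP.
by field; rewrite gt_eqF.
Qed.

End approximation_step.

(** * Almost everywhere arguments *)

Section ae_product.
Context d1 d2 (T1 : measurableType d1) (T2 : measurableType d2) (R : realType).
Variable m1 : {sigma_finite_measure set T1 -> \bar R}.
Variable m2 : {sigma_finite_measure set T2 -> \bar R}.

Lemma ae_prod (P : T1 -> Prop) (P' : T2 -> Prop) :
  {ae m1, forall x, P x} -> {ae m2, forall y, P' y} ->
  {ae (m1 \x m2)%E, forall z, P z.1 /\ P' z.2}.
Proof.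
move=> [N [mN N0 PN]] [N' [mN' N0' PN']].
exists ((N `*` setT) `|` (setT `*` N')); split.
- by apply: measurableU; apply: measurableX.
- rewrite null_set_setU//; first exact: measurableX.
  + exact: measurableX.
  + apply: etrans (product_measure1E m1 m2 mN measurableT) _.
    by rewrite [X in (X * _)%E]N0 mul0e.
  + apply: etrans (product_measure1E m1 m2 measurableT mN') _.
    by rewrite [X in (_ * X)%E]N0' mule0.
- move=> [x y] /= nP; have [Px|nPx] := pselect (P x).
    have nPy : ~ P' y by move=> Py; exact: nP.
    by right; split => //; exact: PN'.
  by left; split => //; exact: PN.
Qed.

(** By Tonelli almost all sections of a null set are null sets. *)
Lemma ae_sections (P : T1 * T2 -> Prop) :
  {ae (m1 \x m2)%E, forall z, P z} ->
  {ae m1, forall x, {ae m2, forall y, P (x, y)}}.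
Proof.
move=> [N [mN N0 PN]].
have mf : measurable_fun setT (m2 \o xsection N) by exact: measurable_fun_xsection.
have [_] := ae_eq_integral_abs m1 measurableT mf.
have [H _] := ae_eq_integral_abs m1 measurableT mf.
move=> _; have /H : (\int[m1]_x `|(m2 \o xsection N) x| = 0)%E.
  by rewrite -[RHS]N0; apply: eq_integral => x _; rewrite gee0_abs//= measure_ge0.
apply: filterS => x /(_ I) /= Nx.
exists (xsection N x); split => //; first exact: measurable_xsection.
by move=> y /= nP; rewrite /xsection/= inE; exact: PN.
Qed.

End ae_product.

Lemma ae_exists d (T : measurableType d) (R : realType)
    (m : {measure set T -> \bar R}) (D : set T) (P : T -> Prop) :
  {ae m, forall x, P x} -> measurable D -> (0 < m D)%E -> exists x, D x /\ P x.
Proof.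
move=> [N [mN N0 PN]] mD D0; apply: contrapT => H.
have DN : D `<=` N.
  by move=> x Dx; apply: PN => /= Px; apply: H; exists x.
have := lt_le_trans D0 (le_measure m (mem_set mD) (mem_set mN) DN).
by rewrite [X in (_ < X)%E]N0 ltxx.
Qed.

(** Fatou's lemma bounds the integral of the limit function by [l <= 0], and a
    non-negative function with such an integral vanishes almost everywhere. *)
Lemma fatou_ae0 d (T : measurableType d) (R : realType)
    (m : {measure set T -> \bar R}) (D : set T) (F : nat -> T -> R) (f : T -> R)
    (r : nat -> R) (l : R) :
  measurable D -> (forall k, m.-integrable D (EFin \o F k)) ->
  (forall k x, D x -> 0 <= F k x) ->
  {ae m, forall x, D x -> F k x @[k --> \oo] --> f x} ->
  (forall k, \int[m]_(x in D) F k x <= r k) ->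
  r k @[k --> \oo] --> l -> l <= 0 ->
  {ae m, forall x, D x -> f x = 0}.
Proof.
move=> mD iF F0 Ff Fr rl l0.
have mF k : measurable_fun D (EFin \o F k) := measurable_int _ (iF k).
pose g x := limn_einf (fun k => (F k x)%:E).
have mg : measurable_fun D g.
  apply: (emeasurable_fun_cvg
    (fun k x => einfs (fun j => (F j x)%:E) k)) => [k|x Dx].
    exact: (measurable_fun_einfs mF).
  by rewrite /g limn_einf_lim; exact: is_cvg_einfs.
have g0 x : D x -> (0 <= g x)%E.
  move=> Dx; rewrite /g limn_einf_lim; apply: lime_ge; first exact: is_cvg_einfs.
  apply: nearW => k; apply: le_ereal_inf_tmp => _ [j /= kj <-].
  by rewrite lee_fin F0.
have gI : (\int[m]_(x in D) g x <= 0)%E.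
  apply: le_trans (fatou m mD mF (fun k x Dx => F0 k x Dx)) _.
  apply: (@le_trans _ _ (limn_einf (fun k => (r k)%:E))).
    rewrite !limn_einf_lim; apply: lee_lim; do ?exact: is_cvg_einfs.
    apply: nearW => k; apply: le_ereal_inf_tmp => _ [j /= kj <-].
    apply: le_trans (_ : (\int[m]_(x in D) (F j x)%:E <= _)%E).
      by apply: ereal_inf_lbound; exists j.
    by rewrite -(fineK (integrable_fin_num mD (iF j))) lee_fin; exact: Fr.
  by have [-> _] := cvg_limn_einf_sup (EFin_cvg rl); rewrite lee_fin.
have [+ _] := ae_eq_integral_abs m mD mg.
have -> : (\int[m]_(x in D) `|g x| = 0)%E.
  apply/eqP; rewrite eq_le; apply/andP; split; last exact: integral_ge0.
  apply: le_trans gI; rewrite le_eqVlt; apply/orP; left; apply/eqP.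
  by apply: eq_integral => x /set_mem Dx; rewrite gee0_abs ?g0.
move=> /(_ erefl) g00.
apply: filterS2 g00 Ff => x gx Fx Dx.
have := gx Dx; rewrite /g /=.
by have [-> _] := cvg_limn_einf_sup (EFin_cvg (Fx Dx)) => -[].
Qed.

(** The squared errors are summable in the mean, hence almost everywhere. *)
Lemma ae_cvg_L2sq d (T : measurableType d) (R : realType)
    (m : {measure set T -> \bar R}) (w : T -> R) (phi : nat -> T -> R) :
  (forall k, measurable_fun setT (fun x => w x - phi k x)) ->
  (forall k, L2sq m (fun x => w x - phi k x)%R <= (2^-1 ^+ k)%:E)%E ->
  {ae m, forall x, phi k x @[k --> \oo] --> w x}.
Proof.
move=> mw wphi.
pose a k x := ((w x - phi k x) ^+ 2)%:E.
have a0 k x : (0 <= a k x)%E by rewrite lee_fin sqr_ge0.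
have ma k : measurable_fun setT (a k) by exact: measurable_sqr.
have mS : measurable_fun setT (fun x => \sum_(0 <= k <oo) a k x)%E.
  exact: ge0_emeasurable_sum.
have S0 x : (0 <= \sum_(0 <= k <oo) a k x)%E by exact: nneseries_ge0.
have Soo : (\int[m]_x (\sum_(0 <= k <oo) a k x) < +oo)%E.
  rewrite integral_nneseries//.
  apply: (@le_lt_trans _ _ (2%:E)); last by rewrite ltry.
  apply: lime_le.
    by apply: is_cvg_nneseries => k _ _; exact: integral_ge0.
  apply: nearW => j; apply: (@le_trans _ _ (\sum_(0 <= k < j) (2^-1 ^+ k)%:E)%E).
    by apply: lee_sum => k _; exact: wphi.
  rewrite sumEFin lee_fin big_mkord.
  have := subrX1 (2^-1 : R) j; set S := \sum_(i < j) _ => H.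
  have : 0 <= 2^-1 ^+ j :> R by rewrite exprn_ge0 ?invr_ge0.
  by move: (2^-1 ^+ j) H => t H t0; lra.
have iS : m.-integrable setT (fun x => \sum_(0 <= k <oo) a k x)%E.
  apply/integrableP; split => //.
  by under eq_integral do rewrite gee0_abs//.
have := integrable_ae measurableT iS.
apply: filterS => x /(_ I) Sx.
have Sxoo : (\sum_(0 <= k <oo) a k x < +oo)%E by rewrite -ge0_fin_numE.
have L := nneseries_tail_cvg Sxoo (fun k _ => a0 k x).
have La : (a k x @[k --> \oo] --> 0)%E.
  apply: (squeeze_cvge _ (cvg_cst _) L); apply: nearW => k.
  rewrite a0/=; apply: le_trans (nneseries_lim_ge k.+1 _) => //.
  by rewrite big_nat1.
have Lr : (w x - phi k x) ^+ 2 @[k --> \oo] --> 0.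
  exact: (fine_cvg La).
apply/cvgrPdist_lt => e e0; have e20 : 0 < e ^+ 2 by rewrite exprn_gt0.
move/cvgrPdist_lt: Lr => /(_ _ e20); apply: filterS => k.
rewrite sub0r normrN normrX ltr_pXn2r// ?nnegrE// ltW//.
Qed.

Section rigidity.
Context (R : realType) (n : nat).
Local Notation mu := (lebesgue_rV R n).
Local Notation mu2 := (mu \x mu)%E.
Variables (Omega U : set 'rV[R]_n).
Hypotheses (mO : measurable Omega) (mU : measurable U).
Hypotheses (O0 : (0 < mu Omega)%E) (Uc0 : (0 < mu (~` U))%E).
Implicit Types (g w : 'rV[R]_n -> R).

(** Comparing with a single point of [Omega] shows that the function is constant
    on the whole space, and its value is seen outside [U]. *)
Lemma ae_constant_zero g :
  {ae mu2, forall z, Q_set Omega z -> g z.1 = g z.2} ->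
  {ae mu, forall x, (~` U) x -> g x = 0} -> ae_zero g.
Proof.
move=> /ae_sections/ae_exists/(_ mO O0)[x0 [Ox0 gx0]] gU.
have E : {ae mu, forall y, g y = g x0}.
  by apply: filterS gx0 => y Hy; apply/esym; apply: Hy => -[].
have : {ae mu, forall y, g y = g x0 /\ ((~` U) y -> g y = 0)}.
  by apply: filterS2 E gU => y Ey gy; split.
move=> /ae_exists/(_ (measurableC mU) Uc0)[y [Uy [gy gy0]]].
by apply: filterS E => x ->; rewrite -gy gy0.
Qed.

(** The sign is that of the value at a single point of [Omega]. *)
Lemma ae_constant_sign w :
  {ae mu2, forall z, Q_set Omega z -> 0 <= w z.1 * w z.2} ->
  {ae mu, forall x, Omega x -> w x != 0} ->
  {ae mu, forall x, w x = `|w x|} \/ {ae mu, forall x, w x = - `|w x|}.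
Proof.
move=> /ae_sections H1 H2.
have : {ae mu, forall x, {ae mu, forall y, Q_set Omega (x, y) ->
    0 <= w (x, y).1 * w (x, y).2} /\ (Omega x -> w x != 0)}.
  by apply: filterS2 H1 H2 => x H1x H2x; split.
move=> /ae_exists/(_ mO O0)[x0 [Ox0 [wx0 /(_ Ox0) wn0]]].
have E : {ae mu, forall y, 0 <= w x0 * w y}.
  by apply: filterS wx0 => y Hy; apply: Hy => -[].
have [w0|w0] := ltP 0 (w x0); [left|right]; apply: filterS E => y.
  by rewrite pmulr_rge0// => wy; rewrite ger0_norm.
have {}w0 : w x0 < 0 by rewrite lt_neqAle wn0.
by rewrite nmulr_rge0// => wy; rewrite ler0_norm// opprK.
Qed.

End rigidity.

(** * The measures of the sets involved *)
Section domain.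
Context (R : realType) (n : nat).
Local Notation mu := (lebesgue_rV R n).
Variables (Omega NN : set 'rV[R]_n).
Hypotheses (oO : open Omega) (oN : open NN).

Lemma measurable_U_set : measurable (U_set Omega NN).
Proof.
apply: measurableU.
  by apply: measurableU; exact: open_measurable_rV.
apply: measurableI.
  apply: measurableD.
    by apply: closed_measurable_rV; exact: closed_closure.
  by apply: open_measurable_rV; exact: open_interior.
by apply: closed_measurable_rV; exact: closed_closure.
Qed.

Lemma Omega_sub_U_set : Omega `<=` U_set Omega NN.
Proof. by move=> x Ox; left; left. Qed.

Hypothesis bnd : bounded_set (Omega `|` NN).

Lemma U_set_cube : exists r, U_set Omega NN `<=` cube r.
Proof.
have [r rO] := bounded_cube bnd; exists (r + 1) => x Ux; apply: ccube_cube.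
rewrite [X in X x](closure_id _).1; last exact: closed_ccube.
have sub : Omega `|` NN `<=` ccube r by apply: subset_trans rO (@cube_ccube _ _ _).
case: Ux => [Ux|[[Ux _] _]]; first by apply: subset_closure; exact: sub.
by apply: closureS Ux => y Oy; apply: sub; left.
Qed.

Lemma Omega_lty : (mu Omega < +oo)%E.
Proof.
have [r rU] := U_set_cube.
apply: le_lt_trans (lebesgue_box_lty (const_mx (- r)) (const_mx r)).
apply: le_measure; rewrite ?inE; [exact: open_measurable_rV|exact: measurable_box|].
by move=> x /Omega_sub_U_set/rU.
Qed.

Lemma lebesgue_box_gt0 (a b : 'rV[R]_n) : (forall i, a ord0 i < b ord0 i) ->
  (0 < mu (box a b))%E.
Proof.
move=> ab; rewrite lebesgue_box lte_fin; apply: prodr_gt0 => i _.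
by rewrite lt_max subr_gt0 ab orbT.
Qed.

Lemma Omega_gt0 : Omega !=set0 -> (0 < mu Omega)%E.
Proof.
move=> [x Ox]; have /nbhs_ballP[e /= e0 eO] := open_nbhs_nbhs (conj oO Ox).
apply: lt_le_trans (_ : mu (box (x - const_mx e)%R (x + const_mx e)%R) <= _)%E.
  by apply: lebesgue_box_gt0 => i; rewrite !mxE; lra.
apply: le_measure; rewrite ?inE; [exact: measurable_box|exact: open_measurable_rV|].
move=> y yb; apply: eO; rewrite ballE// => i.
by have := yb i; rewrite !mxE ltr_norml; lra.
Qed.

Lemma U_setC_gt0 : (0 < n)%N -> (0 < mu (~` U_set Omega NN))%E.
Proof.
move=> n0; have [r rU] := U_set_cube.
apply: lt_le_trans (_ : mu (box (const_mx r) (const_mx (r + 1)%R)) <= _)%E.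
  by apply: lebesgue_box_gt0 => i; rewrite !mxE; lra.
apply: le_measure; rewrite ?inE; first exact: measurable_box.
  by apply: measurableC; exact: measurable_U_set.
move=> y yb /rU; rewrite cubeE => yr.
by have := yb (Ordinal n0); have := yr (Ordinal n0); rewrite !mxE; lra.
Qed.

End domain.

(** * The sharp constant *)

Lemma Rintegral_gt0 d (T : measurableType d) (R : realType)
    (m : {measure set T -> \bar R}) (D : set T) (f : T -> R) :
  measurable D -> (0 < m D)%E -> m.-integrable D (EFin \o f) ->
  (forall x, 0 <= f x) -> {ae m, forall x, D x -> 0 < f x} ->
  0 < \int[m]_(x in D) f x.
Proof.
move=> mD D0 intf f0 fpos.
rewrite lt_neqAle Rintegral_ge0// andbT eq_sym; apply/negP => /eqP I0.
have mf := measurable_int _ intf.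
have [+ _] := ae_eq_integral_abs m mD mf.
have -> : (\int[m]_(x in D) `|(EFin \o f) x| = 0)%E.
  rewrite (eq_integral (EFin \o f)); last by move=> x _ /=; rewrite ger0_norm.
  by rewrite -[LHS]fineK ?integrable_fin_num// [X in X%:E]I0.
move=> /(_ erefl) f00.
have : {ae m, forall x, (D x -> 0 < f x) /\ (D x -> (f x)%:E = 0%E)}.
  by apply: filterS2 fpos f00 => x H1 H2; split.
move=> /ae_exists/(_ mD D0)[x [Dx [/(_ Dx) + /(_ Dx)[fx0]]]].
by rewrite fx0 ltxx.
Qed.

Section real_inequalities.
Context (R : realType).
Implicit Types x y : R.

Lemma powR_le1_sqr (p x : R) : 0 < p <= 2 -> 0 <= x -> x `^ p <= 1 + x ^+ 2.
Proof.
move=> /andP[p0 p2] x0; have [x1|x1] := leP x 1.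
  apply: le_trans (_ : 1 <= _); last by rewrite lerDl sqr_ge0.
  have := ge0_ler_powR (ltW p0) (x0 : x \in Num.nneg) (ler01 : (1 : R) \in Num.nneg) x1.
  by rewrite powR1.
apply: le_trans (_ : x ^+ 2 <= _); last by rewrite lerDr.
by rewrite -powR_mulrn// ler_powR// ltW.
Qed.

(** Young's inequality for [a `^ p] and [b `^ q], with exponents [p^-1] and
    [q^-1]. *)
Lemma weighted_amgm (p q a b : R) : 0 < p -> 0 < q -> p + q = 1 ->
  0 <= a -> 0 <= b -> a `^ p * b `^ q <= p * a + q * b.
Proof.
move=> p0 q0 pq a0 b0.
have := @conjugate_powR R (a `^ p) (b `^ q) p^-1 q^-1 (powR_ge0 _ _)
  (powR_ge0 _ _).
rewrite !invr_gt0 !invrK -!powRrM !mulfV ?gt_eqF// !powRr1// => /(_ p0 q0 pq).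
by rewrite (mulrC p) (mulrC q).
Qed.

(** The graph of the concave function [fun t => t `^ p] lies below its tangent at
    [k * y]; both sides are multiplied by [k `^ q], which covers [k = 0]. *)
Lemma tangent_powR (p q k W y : R) : 0 < p -> 0 < q -> p + q = 1 ->
  0 <= k -> 0 <= W -> 0 < y ->
  k `^ q * W `^ p <= p * (W * (y `^ q)^-1) + q * (k * y `^ p).
Proof.
move=> p0 q0 pq k0 W0 y0.
have yq0 : 0 < y `^ q by rewrite powR_gt0.
have := @weighted_amgm p q (W * (y `^ q)^-1) (k * y `^ p) p0 q0 pq.
rewrite !powRM ?invr_ge0 ?powR_ge0//.
rewrite !mulr_ge0 ?invr_ge0 ?powR_ge0// => /(_ isT isT).
apply: le_trans; rewrite le_eqVlt; apply/orP; left; apply/eqP.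
have -> : (y `^ q)^-1 `^ p = (y `^ (q * p))^-1.
  by rewrite -powRN -powRrM mulNr powRN.
rewrite -powRrM (mulrC p q).
have : y `^ (q * p) != 0 by rewrite gt_eqF// powR_gt0.
by move: (y `^ (q * p)) => Y Y0; field.
Qed.

End real_inequalities.

Section sharp_constant.
Context (R : realType) (n : nat) (s q : R).
Hypotheses (s01 : 0 < s < 1) (q01 : 0 < q < 1).
Variables (Omega U : set 'rV[R]_n).
Hypotheses (mO : measurable Omega) (mU : measurable U).
Hypotheses (Ofin : (lebesgue_rV R n Omega < +oo)%E).
Local Notation mu := (lebesgue_rV R n).
Local Notation mu2 := (mu \x mu)%E.
Local Notation a := (n%:R + 2 * s).
Local Notation p := (1 - q).
Implicit Types (u v w : 'rV[R]_n -> R).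

Definition power_mass v : R := \int[mu]_(x in Omega) (`|v x| `^ p).

Let p0 : 0 < p. Proof. by case/andP: q01 => ? ?; lra. Qed.

Lemma power_mass_ge0 v : 0 <= power_mass v.
Proof. by apply: Rintegral_ge0 => x _; exact: powR_ge0. Qed.

Lemma measurable_pow v : measurable_fun setT v ->
  measurable_fun setT (fun x => `|v x| `^ p).
Proof.
move=> mv; apply: (measurableT_comp (@measurable_powR R p)).
exact: measurableT_comp.
Qed.

Lemma integrable_one_sqr v : v \in Lfun mu 2%:E ->
  mu.-integrable Omega (EFin \o (fun x => 1 + v x ^+ 2)).
Proof.
move=> v2.
have i1 : mu.-integrable Omega (EFin \o (cst 1 : 'rV[R]_n -> R)) by exact: integrable_cst1.
have i2 := integrableS measurableT mO (@subsetT _ _) (Lfun2_integrable_sqr v2).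
exact: (integrableD mO i1 i2).
Qed.

Lemma integrable_pow v : v \in Lfun mu 2%:E ->
  mu.-integrable Omega (EFin \o (fun x => `|v x| `^ p)).
Proof.
move=> v2; have mv := Lfun2_measurable v2.
apply: (@ae_le_integrable _ _ _ _ _ _ (fun x => 1 + v x ^+ 2)) => //.
- by apply: measurable_funTS; exact: measurable_pow.
- exact: integrable_one_sqr.
- apply: aeW => x _; rewrite ger0_norm ?powR_ge0//.
  rewrite -(real_normK (num_real (v x))); apply: powR_le1_sqr => //.
  by case/andP: q01 => ? ?; lra.
Qed.

Lemma inner_scale t u : X12D U u ->
  inner Omega s (fun x => t * u x) (fun x => t * u x) =
  t ^+ 2 * inner Omega s u u.
Proof.
move=> Xu; have Hu := X12D_H1 Xu; have Htu := H1_scale t Hu.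
rewrite /inner mulrDr; congr (_ + _).
  rewrite -RintegralZl//; last exact: integrable_grad.
  apply: ae_eq_Rintegral => //.
  - by apply/measurable_EFinP; exact: measurable_int (integrable_grad mO Htu Htu).
  - apply: measurable_funM => //.
    by apply/measurable_EFinP; exact: measurable_int (integrable_grad mO Hu Hu).
  - have := ae_forall_ord (fun i => wpartial_scale i t Hu).
    apply: filterS => x ux _; rewrite mulr_sumr.
    by apply: eq_bigr => i _; rewrite ux; ring.
rewrite -RintegralZl//; last 2 first.
- exact: measurable_Q.
- exact: (integrable_nl s01 mO mU Xu Xu).
apply: eq_Rintegral => z _; rewrite -!mulrBr !mulrA; congr (_ / _); ring.
Qed.

Lemma power_mass_scale t v : v \in Lfun mu 2%:E ->
  power_mass (fun x => t * v x) = `|t| `^ p * power_mass v.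
Proof.
move=> v2; rewrite /power_mass -RintegralZl//; last exact: integrable_pow.
by apply: eq_Rintegral => x _; rewrite normrM powRM.
Qed.

Lemma ae_zero_power_mass v : measurable_fun setT v -> ae_zero v ->
  power_mass v = 0.
Proof.
move=> mv v0.
have Z : \int[mu]_(x in Omega) (0 : R) = 0 by rewrite /Rintegral integral0.
rewrite /power_mass -[RHS]Z; apply: ae_eq_Rintegral => //.
  by apply: measurable_funTS; exact: measurable_pow.
by apply: filterS v0 => x -> _; rewrite normr0 powR0// gt_eqF.
Qed.

(** Both sides of the inequality are homogeneous of degree two, so it suffices
    to test it on functions normalized by [power_mass v = 1]. *)
Lemma sharp_constantP (C : R) :
  (forall v, X12D U v ->
    eta_norm Omega s v ^+ 2 >= C * power_mass v `^ (2 / p)) <->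
  (C%:E <= Re_const Omega U s q)%E.
Proof.
split=> [H|H v Xv].
  apply: le_ereal_inf_tmp => _ [v [Xv _ v1] <-].
  by rewrite lee_fin; have := H v Xv; rewrite /power_mass v1 powR1 mulr1.
have := power_mass_ge0 v; rewrite le_eqVlt => /predU1P[I0|I0].
  by rewrite -I0 powR0 ?mulr0 ?sqr_ge0// gt_eqF// divr_gt0.
set I := power_mass v in I0 *.
have T0 : 0 < I `^ p^-1 by rewrite powR_gt0.
pose t := (I `^ p^-1)^-1; have t0 : 0 < t by rewrite invr_gt0.
have tp : `|t| `^ p = I^-1.
  rewrite gtr0_norm// /t -powRN -powRrM mulNr mulVf ?gt_eqF// powRN powRr1//.
  exact: ltW.
have v2 := X12D_Lfun2 Xv.
have m1 : power_mass (fun x => t * v x) = 1.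
  by rewrite power_mass_scale// tp mulVf// gt_eqF.
have Xtv := X12D_scale mU t Xv.
have : (C%:E <= (eta_norm Omega s (fun x => t * v x)%R ^+ 2)%:E)%E.
  apply: le_trans H _; apply: ereal_inf_lbound.
  exists (fun x => t * v x) => //; split => //.
  move=> /(ae_zero_power_mass (X12D_measurable Xtv)).
  by rewrite m1 => /eqP; rewrite oner_eq0.
rewrite lee_fin !eta_norm_sqr inner_scale// => Ct.
have -> : I `^ (2 / p) = t ^- 2.
  rewrite /t exprVn invrK -powR_mulrn ?powR_ge0// -powRrM.
  by rewrite mulrC.
by rewrite ler_pdivrMr ?exprn_gt0// mulrC.
Qed.

End sharp_constant.

(** * Equality case *)

Section steps.
Context (R : realType).

(** The accuracy of the [k]-th approximation. It is summable and still tends to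
    zero when multiplied by [k.+1], which bounds the right-hand side of the
    [k]-th regularized problem. *)
Definition step (k : nat) : R := 2^-1 ^+ k / k.+1%:R.

Let half01 k : 0 <= (2^-1 : R) ^+ k <= 1.
Proof. by rewrite exprn_ge0 ?invr_ge0// exprn_ile1 ?invr_ge0// invf_le1 ?ler1n. Qed.

Lemma step_gt0 k : 0 < step k.
Proof. by rewrite divr_gt0// exprn_gt0// invr_gt0. Qed.

Lemma step_le k : step k <= 2^-1 ^+ k.
Proof. by rewrite ler_piMr ?exprn_ge0 ?invr_ge0// invf_le1 ?ltr0n// ler1n. Qed.

Lemma step_le1 k : step k <= 1.
Proof. by apply: le_trans (step_le k) _; have /andP[] := half01 k. Qed.

Lemma step_eq k : k.+1%:R * step k = 2^-1 ^+ k.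
Proof. by rewrite mulrCA mulfV ?mulr1// pnatr_eq0. Qed.

Lemma half_cvg : (2^-1 : R) ^+ k @[k --> \oo] --> (0 : R).
Proof.
have h : `|2^-1 : R| < 1 by rewrite ger0_norm ?invr_ge0// invf_lt1// ltr1n.
have := cvg_geometric 1 h.
by rewrite (_ : geometric 1 2^-1 = (fun k => 2^-1 ^+ k))//; apply/funext => k /=; rewrite mul1r.
Qed.

Lemma step_cvg : step k @[k --> \oo] --> (0 : R).
Proof.
apply: (squeeze_cvgr _ (cvg_cst 0) half_cvg); apply: nearW => k.
by rewrite (ltW (step_gt0 k)) step_le.
Qed.

(** Because [p + q = 1], the term in parentheses tends to [K * J]; so in the
    limit [K ^+ 2 * J] is added once and subtracted twice. *)
Lemma gain_bound_cvg (Iu B : nat -> R) (E K J p q c M : R) :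
  p + q = 1 -> p != 0 ->
  Iu k @[k --> \oo] --> J -> B k @[k --> \oo] --> J ->
  (1 + step k) * E + 2 * (1 + c) * step k + K ^+ 2 * Iu k -
    2 * K * (p^-1 * (K * J - q * (K * B k)) - 2^-1 ^+ k * M) @[k --> \oo] -->
  E - K ^+ 2 * J.
Proof.
move=> pq p0 IJ BJ.
have -> : E - K ^+ 2 * J = (1 + 0) * E + 2 * (1 + c) * 0 + K ^+ 2 * J -
    2 * K * (p^-1 * (K * J - q * (K * J)) - 0 * M).
  have -> : K * J - q * (K * J) = p * (K * J).
    by rewrite (_ : p = 1 - q); [ring|rewrite -pq addrK].
  by rewrite [p^-1 * _]mulrA mulVf// mul1r; ring.
have cc (x : R) : (fun _ : nat => x) @ \oo --> x by exact: cvg_cst.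
have L4 : K * J - q * (K * B k) @[k --> \oo] --> K * J - q * (K * J).
  by apply: cvgB => //; apply: cvgM => //; exact: cvgM.
have L5 : p^-1 * (K * J - q * (K * B k)) - 2^-1 ^+ k * M @[k --> \oo] -->
    p^-1 * (K * J - q * (K * J)) - 0 * M.
  by apply: cvgB; apply: cvgM => //; exact: half_cvg.
have L1 : (1 + step k) * E + 2 * (1 + c) * step k + K ^+ 2 * Iu k @[k --> \oo] -->
    (1 + 0) * E + 2 * (1 + c) * 0 + K ^+ 2 * J.
  apply: cvgD; last exact: cvgM.
  by apply: cvgD; apply: cvgM => //; first apply: cvgD => //; exact: step_cvg.
by apply: cvgB => //; apply: cvgM.
Qed.

End steps.

Lemma powR_ratio (R : realType) (p x y : R) : 0 <= x -> 0 < y ->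
  x `^ (2 / p) = ((x / y) `^ p^-1) ^+ 2 * y `^ (2 / p).
Proof.
move=> x0 y0; have y0' := ltW y0.
rewrite -powR_mulrn ?powR_ge0// -powRrM (mulrC p^-1) -powRM ?divr_ge0//.
by rewrite divfK// gt_eqF.
Qed.

Lemma one_sqr_shift_le (R : realType) (x y e : R) : 0 <= x <= y -> 0 <= e <= 1 ->
  1 + (x + e) ^+ 2 <= 2 * (1 + y ^+ 2) + 1.
Proof.
move=> /andP[x0 xy] /andP[e0 e1]; have xy2 : x ^+ 2 <= y ^+ 2.
  by rewrite ler_pXn2r ?nnegrE// (le_trans x0).
by have := sqr_ge0 (x - e); nra.
Qed.

Section gain_properties.
Context (R : realType) (n : nat).
Implicit Types (k x y : R) (u phi psi : 'rV[R]_n -> R) (z : 'rV[R]_n * 'rV[R]_n).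

Let gainE k u phi psi z : gain k u phi psi z =
  (k * (u z.1 - u z.2) - (psi z.1 - psi z.2)) ^+ 2 +
  ((phi z.1 - phi z.2) ^+ 2 - (psi z.1 - psi z.2) ^+ 2).
Proof.
rewrite /gain; move: (phi z.1 - phi z.2) (psi z.1 - psi z.2) (u z.1 - u z.2).
by move=> P S D; ring.
Qed.

Let gap phi psi z : `|psi z.1 - psi z.2| <= `|phi z.1 - phi z.2| ->
  0 <= (phi z.1 - phi z.2) ^+ 2 - (psi z.1 - psi z.2) ^+ 2.
Proof. by rewrite -ler_sqr ?nnegrE// !real_normK ?num_real// subr_ge0. Qed.

Lemma gain_ge0 k u phi psi z : `|psi z.1 - psi z.2| <= `|phi z.1 - phi z.2| ->
  0 <= gain k u phi psi z.
Proof. by move=> /gap H; rewrite gainE addr_ge0 ?sqr_ge0. Qed.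

Lemma gain_eq0 k u phi psi z : `|psi z.1 - psi z.2| <= `|phi z.1 - phi z.2| ->
  gain k u phi psi z = 0 ->
  (phi z.1 - phi z.2) ^+ 2 = (psi z.1 - psi z.2) ^+ 2 /\
  k * (u z.1 - u z.2) = psi z.1 - psi z.2.
Proof.
move=> /gap H; rewrite gainE => /eqP; rewrite paddr_eq0 ?sqr_ge0//.
by rewrite sqrf_eq0 !subr_eq0 => /andP[/eqP -> /eqP ->].
Qed.

Lemma gain_cvg k (u phi psi : nat -> 'rV[R]_n -> R) u' phi' psi' z :
  u j z.1 @[j --> \oo] --> u' z.1 -> u j z.2 @[j --> \oo] --> u' z.2 ->
  phi j z.1 @[j --> \oo] --> phi' z.1 -> phi j z.2 @[j --> \oo] --> phi' z.2 ->
  psi j z.1 @[j --> \oo] --> psi' z.1 -> psi j z.2 @[j --> \oo] --> psi' z.2 ->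
  gain k (u j) (phi j) (psi j) z @[j --> \oo] --> gain k u' phi' psi' z.
Proof.
move=> u1 u2 p1 p2 s1 s2.
have cc x : (fun _ : nat => x) @ \oo --> x by exact: cvg_cst.
have sq (v : nat -> R) (l : R) : v @ \oo --> l -> v j ^+ 2 @[j --> \oo] --> l ^+ 2.
  by move=> vl; exact: cvgM.
apply: cvgB; last by apply: cvgM => //; apply: cvgM; exact: cvgB.
apply: cvgD; first by apply: sq; exact: cvgB.
by apply: cvgM => //; apply: sq; exact: cvgB.
Qed.

Lemma mulrB_swap k x y a b : k * (x - y) = a - b -> a - k * x = b - k * y.
Proof. by lra. Qed.

Lemma mul_ge0_of_sqrB x y : (x - y) ^+ 2 = (`|x| - `|y|) ^+ 2 -> 0 <= x * y.
Proof.
rewrite !sqrrB !real_normK ?num_real// => H.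
suff -> : x * y = `|x| * `|y| by rewrite mulr_ge0.
by lra.
Qed.

End gain_properties.

Lemma kern_eq0 (R : realType) (n : nat) (a : R) (h : 'rV[R]_n) :
  kern a h = 0 -> h = 0.
Proof.
move=> /eqP; rewrite /kern invr_eq0 powR_eq0 => /andP[/eqP h0 _].
by apply/rowP => i; rewrite mxE; apply/eqP; rewrite -normr_le0 -h0 enorm_coord.
Qed.

Section equality_case.
Context (R : realType) (n : nat) (s q : R).
Hypotheses (s01 : 0 < s < 1) (q01 : 0 < q < 1).
Variables (Omega U : set 'rV[R]_n).
Hypotheses (mO : measurable Omega) (mU : measurable U) (OU : Omega `<=` U).
Local Notation mu := (lebesgue_rV R n).
Local Notation mu2 := (mu \x mu)%E.
Hypotheses (Ofin : (mu Omega < +oo)%E) (O0 : (0 < mu Omega)%E).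
Hypothesis (Uc0 : (0 < mu (~` U))%E).
Local Notation a := (n%:R + 2 * s).
Local Notation p := (1 - q).
Local Notation Q := (Q_set Omega).
Local Notation c := (embed_const n s).
Local Notation I v := (power_mass q Omega v).
Implicit Types (u v w : 'rV[R]_n -> R).

Let q0 : 0 < q. Proof. by case/andP: q01. Qed.
Let q1 : q < 1. Proof. by case/andP: q01. Qed.
Let p0 : 0 < p. Proof. by rewrite subr_gt0. Qed.
Let p02 : 0 < p <= 2.
Proof. by rewrite p0/= lerBlDr (@le_trans _ _ 2) ?ler1n// lerDl ltW. Qed.
Let pq : p + q = 1. Proof. by rewrite subrK. Qed.

Variables (u : nat -> 'rV[R]_n -> R) (uhat : 'rV[R]_n -> R).
Hypothesis u_sol : forall k, regularized_solution Omega U s q k.+1 (u k).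
Hypothesis u_mono : forall k, {ae mu, forall x, u k x <= u k.+1 x}.
Hypothesis u_lim : {ae mu, forall x, u k x @[k --> \oo] --> uhat x}.
Hypothesis Xuhat : X12D U uhat.
Hypothesis uhat_pos : ae_pos_on Omega uhat.

Let e (k : nat) : R := k.+1%:R^-1.
Let f k x := ((u k x + e k) `^ q)^-1.

Let e0 k : 0 < e k. Proof. by rewrite invr_gt0. Qed.
Let e1 k : e k <= 1. Proof. by rewrite invf_le1 ?ltr0n// ler1n. Qed.
Let Xu k : X12D U (u k). Proof. by case: (u_sol k). Qed.
Let u_pos k : ae_pos_on Omega (u k). Proof. by case: (u_sol k). Qed.
Let mu_ k : measurable_fun setT (u k). Proof. exact: X12D_measurable (Xu k). Qed.
Let muhat : measurable_fun setT uhat. Proof. exact: X12D_measurable Xuhat. Qed.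

Let u_eq k phi : X12D U phi ->
  inner Omega s (u k) phi = \int[mu]_(x in Omega) (phi x * f k x).
Proof. by case: (u_sol k) => _ _ _; apply. Qed.

Let mf k : measurable_fun setT (f k).
Proof.
apply: (measurableT_comp (@measurable_invr R)).
apply: (measurableT_comp (@measurable_powR R q)).
exact: measurable_funD.
Qed.

Let f_bnd k : {ae mu, forall x, Omega x -> 0 <= f k x <= k.+1%:R}.
Proof.
apply: filterS (u_pos k) => x ux /ux {}ux.
rewrite invr_ge0 powR_ge0/= -[leRHS]invrK -/(e k).
rewrite lef_pV2 ?posrE ?powR_gt0 ?addr_gt0//.
(* Since [e k <= 1] and [q <= 1], the power [e k `^ q] is at least [e k]. *)
apply: (@le_trans _ _ (e k `^ q)).
  rewrite -[leLHS]powRr1 ?(ltW (e0 k))//.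
  by rewrite ger_powR ?e0 ?e1// ltW.
apply: ge0_ler_powR; rewrite ?nnegrE ?(ltW q0) ?(ltW (e0 k)) ?addr_ge0 ?(ltW ux)//.
  exact: ltW.
by rewrite lerDr ltW.
Qed.

Let u_le : {ae mu, forall x k, u k x <= uhat x}.
Proof.
apply: filterS2 (ae_foralln u_mono) u_lim => x ux xl k.
have nd : nondecreasing_seq (fun k => u k x) by exact/nondecreasing_seqP.
have cv : cvgn (fun k => u k x) by apply/cvg_ex; exists (uhat x).
by have := nondecreasing_cvgn_le nd cv k; rewrite (cvg_lim _ xl).
Qed.

Let all_pos : {ae mu, forall x k, Omega x -> 0 < u k x}.
Proof. exact: ae_foralln. Qed.

Let A_cvg : I (u k) @[k --> \oo] --> I uhat.
Proof.
apply: (dominated_Rintegral (g := fun x => 1 + uhat x ^+ 2) mO).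
- by move=> k; apply: measurable_funTS; exact: measurable_pow.
- by apply: measurable_funTS; exact: measurable_pow.
- apply: filterS2 u_lim uhat_pos => x xl xp Ox.
  have x0 := xp Ox.
  apply: (@cvg_comp _ _ _ _ (fun t : R => t `^ p) _ (nbhs `|uhat x|)).
    exact: cvg_norm.
  rewrite gtr0_norm//.
  exact: (is_derive1_continuous (is_derive1_powR p x0)).
- by apply: integrable_one_sqr => //; exact: X12D_Lfun2 Xuhat.
- apply: filterS2 u_le all_pos => x ul up k Ox.
  have uk := up k Ox.
  rewrite ger0_norm ?powR_ge0// gtr0_norm//.
  apply: le_trans (powR_le1_sqr p02 (ltW uk)) _.
  by rewrite lerD2l ler_pXn2r ?nnegrE ?(ltW uk)// (le_trans (ltW uk) (ul k)).
Qed.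

Let B k := \int[mu]_(x in Omega) ((u k x + e k) `^ p).

Let mB k : measurable_fun setT (fun x => (u k x + e k) `^ p).
Proof.
apply: (measurableT_comp (@measurable_powR R p)); exact: measurable_funD.
Qed.

Let dom x := 2 * (1 + uhat x ^+ 2) + 1.

Let idom : mu.-integrable Omega (EFin \o dom).
Proof.
have i1 := integrable_one_sqr mO Ofin (X12D_Lfun2 Xuhat).
have i2 : mu.-integrable Omega (EFin \o (cst 1 : 'rV[R]_n -> R)) by exact: integrable_cst1.
exact: (integrableD mO (integrableZl mO 2 i1) i2).
Qed.

Let B_dom : {ae mu, forall x k, Omega x -> `|(u k x + e k) `^ p| <= dom x}.
Proof.
apply: filterS2 u_le all_pos => x ul up k Ox.
have uk := up k Ox; have ek := e0 k; have ek1 := e1 k; have ulk := ul k.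
rewrite ger0_norm ?powR_ge0//.
have ue : 0 <= u k x + e k by rewrite addr_ge0 ?ltW.
apply: le_trans (powR_le1_sqr p02 ue) _.
by apply: one_sqr_shift_le; rewrite ?(ltW uk) ?(ltW ek).
Qed.

Let iB k : mu.-integrable Omega (EFin \o (fun x => (u k x + e k) `^ p)).
Proof.
apply: (ae_le_integrable mO _ idom); first exact: measurable_funTS.
by apply: filterS B_dom => x H Ox; exact: H.
Qed.

Let B_cvg : B k @[k --> \oo] --> I uhat.
Proof.
rewrite (_ : I uhat = \int[mu]_(x in Omega) (uhat x `^ p)); last first.
  apply: ae_eq_Rintegral => //.
  - by apply: measurable_funTS; exact: measurable_pow.
  - apply: measurable_funTS.
    exact: (measurableT_comp (@measurable_powR R p) muhat).
  - by apply: filterS uhat_pos => x xp Ox; rewrite gtr0_norm// xp.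
apply: (dominated_Rintegral mO _ _ _ idom B_dom).
- by move=> k; exact: measurable_funTS.
- apply: measurable_funTS.
  exact: (measurableT_comp (@measurable_powR R p) muhat).
- apply: filterS2 u_lim uhat_pos => x xl xp Ox.
  have x0 := xp Ox.
  have L : u k x + e k @[k --> \oo] --> uhat x.
    by rewrite -[uhat x]addr0; apply: cvgD => //; exact: cvg_harmonic.
  exact: (cvg_comp _ _ L (is_derive1_continuous (is_derive1_powR p x0))).
Qed.

Let J := I uhat.

Lemma limit_mass_gt0 : 0 < J.
Proof.
apply: Rintegral_gt0 => //.
- by apply: integrable_pow => //; exact: X12D_Lfun2 Xuhat.
- by apply: filterS uhat_pos => x xp /xp x0; rewrite powR_gt0// normr_gt0 gt_eqF.
Qed.

(** Testing the regularized equation with its own solution, and dropping [e k]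
    in the denominator. *)
Let u_energy k : inner Omega s (u k) (u k) <= I (u k).
Proof.
rewrite u_eq//; have iu := integrable_pow q01 mO Ofin (X12D_Lfun2 (Xu k)).
have le_ : {ae mu, forall x, Omega x -> `|u k x * f k x| <= `|u k x| `^ p}.
  apply: filterS2 (u_pos k) (f_bnd k) => x up fb Ox.
  have x0 := up Ox; have /andP[f0 _] := fb Ox.
  rewrite normrM (ger0_norm f0) gtr0_norm// powRB; last first.
    by rewrite (gt_eqF x0) implybT.
  rewrite powRr1 ?(ltW x0)// ler_wpM2l ?(ltW x0)//.
  rewrite /f lef_pV2 ?posrE ?powR_gt0 ?addr_gt0//.
  by apply: ge0_ler_powR; rewrite ?nnegrE ?addr_ge0 ?(ltW q0) ?(ltW x0) ?(ltW (e0 k))// lerDl ltW.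
apply: ae_le_Rintegral => //.
  apply: (ae_le_integrable mO _ iu le_).
  by apply: measurable_funTS; exact: measurable_funM.
by apply: filterS le_ => x H Ox; apply: le_trans (ler_norm _) (H Ox).
Qed.

(** The inequality is tested on the regularized solutions, whose energies are
    at most their power masses; both sides converge. Working with the sequence
    avoids the energy of the limit, for which no equation with [uhat] itself as
    test function is at hand. *)
Let C_le (C : R) : (forall v, X12D U v ->
    C * I v `^ (2 / p) <= inner Omega s v v) ->
  C * J `^ (2 / p) <= J.
Proof.
move=> ineq.
have L : C * I (u k) `^ (2 / p) @[k --> \oo] --> C * J `^ (2 / p).
  apply: cvgM; first exact: cvg_cst.
  exact: (cvg_comp _ _ A_cvg (is_derive1_continuous (is_derive1_powR _ limit_mass_gt0))).
apply: (ler_cvg_to L A_cvg); apply: nearW => k.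
exact: le_trans (ineq _ (Xu k)) (u_energy k).
Qed.

(** The pointwise inequality [tangent_powR] at [y = u k x + e k], integrated. *)
Lemma tangent_integral (K : R) w k : 0 <= K -> X12D U w ->
  K `^ q * I w <= p * \int[mu]_(x in Omega) (`|w x| * f k x) + q * (K * B k).
Proof.
move=> K0 Xw; have w2 := X12D_Lfun2 Xw; have mw := X12D_measurable Xw.
have iw := integrable_pow q01 mO Ofin w2.
have iwf : mu.-integrable Omega (EFin \o (fun x => `|w x| * f k x)).
  apply: (@ae_le_integrable _ _ _ _ _ _ (fun x => k.+1%:R * `|w x|)) => //.
  - by apply: measurable_funTS; apply: measurable_funM => //; exact: measurableT_comp.
  - have := integrable_norm (Lfun2_integrable_fin mO Ofin w2).
    by move/(integrableZl mO k.+1%:R).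
  - apply: filterS (f_bnd k) => x H Ox; have /andP[f0 fb] := H Ox.
    by rewrite normrM normr_id (ger0_norm f0) mulrC ler_wpM2r.
have i0 : mu.-integrable Omega (EFin \o (fun _ : 'rV[R]_n => 0 : R)) by exact: integrable0.
have [iL EL] := Rintegral_lin3 p (q * K) mO i0 iwf (iB k).
have Z : \int[mu]_(x in Omega) (0 : R) = 0 by rewrite /Rintegral integral0.
rewrite Z add0r in EL.
rewrite [q * _]mulrA -EL -RintegralZl//.
apply: ae_le_Rintegral => //; first by have := integrableZl mO (K `^ q) iw.
apply: filterS (u_pos k) => x up Ox.
rewrite add0r -[q * K * _]mulrA.
by apply: tangent_powR => //; rewrite addr_gt0// up.
Qed.

Section minimizer.
Variables (C : R) (w : 'rV[R]_n -> R).
Hypothesis ineq : forall v, X12D U v -> C * I v `^ (2 / p) <= inner Omega s v v.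
Hypothesis Xw : X12D U w.
Hypothesis w_le : inner Omega s w w <= C * I w `^ (2 / p).

(** The factor for which [K * uhat] has the same power mass as [w]. *)
Let K := (I w / J) `^ p^-1.
Lemma mass_ratio_ge0 : 0 <= K. Proof. exact: powR_ge0. Qed.
Lemma mass_ratio_pow : K `^ p = I w / J.
Proof.
by rewrite /K -powRrM mulVf ?gt_eqF// powRr1// divr_ge0 ?power_mass_ge0// ltW.
Qed.

Lemma mass_ratio_eq : K `^ q * I w = K * J.
Proof.
have -> : I w = K `^ p * J by rewrite mass_ratio_pow divfK// (gt_eqF limit_mass_gt0).
rewrite mulrA -powRD; last by rewrite addrC pq oner_eq0.
by rewrite addrC pq powRr1// mass_ratio_ge0.
Qed.

(** By homogeneity [w] has [K ^+ 2] times the energy that the sharp case of the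
    inequality would give to [uhat], which is at most [J]. *)
Lemma minimizer_energy_le : inner Omega s w w <= K ^+ 2 * J.
Proof.
apply: le_trans w_le _.
rewrite (powR_ratio p (power_mass_ge0 q Omega w) limit_mass_gt0) -/K mulrCA.
by rewrite ler_wpM2l ?sqr_ge0//; exact: C_le ineq.
Qed.

Local Notation d := (@step R).

Let approx k : exists phi, [/\ Cc phi, closure [set x | phi x != 0] `<=` U,
    (L2sq mu (fun x => w x - phi x)%R <= (d k ^+ 2)%:E)%E,
    (\int[mu]_(x in U) (\sum_(i < n) (wpartial i w x - partial i phi x) ^+ 2)%R%:E
       <= (d k ^+ 2)%:E)%E &
    (gag s (fun x => w x - phi x)%R <= (c * d k ^+ 2)%:E)%E].
Proof. exact: (X12D_approx_gag s01 mU Xw (exprn_gt0 2 (step_gt0 R k))). Qed.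

Let phi k := projT1 (cid (approx k)).
Let phi_prop k := projT2 (cid (approx k)).
Let psi k := sabs_fun (d k) (phi k).

(** The upper bound for the integrated gain of the [k]-th approximation. It
    collects the estimates for the energies of [phi k] and [u k] and, through
    the regularized equation, for [inner (u k) (psi k)]. *)
Let rhs k := (1 + d k) * inner Omega s w w + 2 * (1 + c) * d k +
  K ^+ 2 * I (u k) -
  2 * K * (p^-1 * (K * J - q * (K * B k)) - 2^-1 ^+ k * (1 + 2 * fine (mu Omega))).

Let cphi k : Cc (phi k). Proof. by case: (phi_prop k). Qed.
Let cpsi k : Cc (psi k). Proof. exact: sabs_fun_Cc (step_gt0 R k) (cphi k). Qed.
Let Xphi k : X12D U (phi k).
Proof. by case: (phi_prop k) => ? ? _ _ _; exact: (X12D_Cc mU). Qed.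
Let Xpsi k : X12D U (psi k).
Proof.
case: (phi_prop k) => _ pU _ _ _; apply: (X12D_Cc mU (cpsi k)).
by apply: subset_trans pU; apply: closureS;
exact: sabs_fun_support (step_gt0 R k).
Qed.

Let grad_le k : {ae mu, forall x, forall i,
  `|wpartial i (psi k) x| <= `|wpartial i (phi k) x|}.
Proof.
have H1 := ae_forall_ord (fun i => wpartial_Cc i (cphi k)).
have H2 := ae_forall_ord (fun i => wpartial_Cc i (cpsi k)).
apply: filterS2 H1 H2 => x h1 h2 i; rewrite h1 h2.
exact: sabs_fun_partial_le (step_gt0 R k) (cphi k).
Qed.

Let gain_int k := integral_gain_le s01 mO mU mass_ratio_ge0 (Xu k) (Xphi k) (Xpsi k) (grad_le k).

Let gain_le k :
  \int[mu2]_(z in Q) (gain K (u k) (phi k) (psi k) z * kern a (z.1 - z.2)) <= rhs k.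
Proof.
apply: le_trans (gain_int k).2 _.
have [_ pU H1 H2 H3] := phi_prop k.
have d01 : 0 < d k <= 1 by rewrite step_gt0 step_le1.
have L1 := inner_Cc_le s01 mO mU OU Xw (cphi k) pU d01 H2 H3.
have L2 := u_energy k.
have L3 : p^-1 * (K * J - q * (K * B k)) - 2^-1 ^+ k * (1 + 2 * fine (mu Omega)) <=
    inner Omega s (u k) (psi k).
  rewrite (u_eq k (Xpsi k)).
  have := approx_integral_le mO Ofin Xw (cphi k) (mf k) (ler0n R k.+1) (step_gt0 R k)
    (f_bnd k) H1.
  rewrite mulrA step_eq -lerBlDr; apply: le_trans; rewrite lerD2r.
  (* The tangent inequality, divided by [p]. *)
  rewrite ler_pdivrMl// lerBlDr -mass_ratio_eq.
  exact: (tangent_integral k mass_ratio_ge0 Xw).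
have L4 : K ^+ 2 * inner Omega s (u k) (u k) <= K ^+ 2 * I (u k).
  by rewrite ler_wpM2l ?sqr_ge0.
have L5 : 2 * K * (p^-1 * (K * J - q * (K * B k)) -
    2^-1 ^+ k * (1 + 2 * fine (mu Omega))) <= 2 * K * inner Omega s (u k) (psi k).
  by rewrite ler_wpM2l// mulr_ge0// mass_ratio_ge0.
by rewrite /rhs; apply: lerB => //; apply: lerD.
Qed.

Let rhs_cvg : rhs k @[k --> \oo] --> inner Omega s w w - K ^+ 2 * J.
Proof.
exact: (@gain_bound_cvg R (fun k => I (u k)) B _ K J p q c
  (1 + 2 * fine (mu Omega)) pq (lt0r_neq0 p0) A_cvg B_cvg).
Qed.

Let psi_lip k z : `|psi k z.1 - psi k z.2| <= `|phi k z.1 - phi k z.2|.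
Proof. exact: sabs_lip (step_gt0 R k). Qed.

Let phi_cvg : {ae mu, forall x, phi k x @[k --> \oo] --> w x}.
Proof.
apply: (ae_cvg_L2sq (m := mu)) => k.
  apply: measurable_funB; first exact: X12D_measurable Xw.
  exact: Cc_measurable.
have [_ _ H _ _] := phi_prop k; apply: le_trans H _; rewrite lee_fin.
apply: le_trans (step_le R k).
by rewrite expr2 ler_piMr ?step_le1 ?(ltW (step_gt0 R k)).
Qed.

Let psi_cvg x : phi k x @[k --> \oo] --> w x ->
  psi k x @[k --> \oo] --> `|w x|.
Proof.
move=> px.
have L : `|phi k x| @[k --> \oo] --> `|w x| by exact: cvg_norm.
rewrite -[`|w x|]add0r.
rewrite (_ : (fun k => psi k x) = (fun k => (psi k x - `|phi k x|) + `|phi k x|)); last first.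
  by apply/funext => k; rewrite subrK.
apply: cvgD => //; apply/norm_cvg0P.
apply: (squeeze_cvgr _ (cvg_cst 0) (@step_cvg R)); apply: nearW => k.
by rewrite normr_ge0/= (sabs_near _ (step_gt0 R k)).
Qed.

(** The bound [rhs] tends to a non-positive limit, so Fatou's lemma makes the
    gain of the limit functions vanish. *)
Let gain0 : {ae mu2, forall z, Q z ->
  gain K uhat w (fun x => `|w x|) z * kern a (z.1 - z.2) = 0}.
Proof.
apply: (@fatou_ae0 _ _ _ mu2 Q
  (fun k z => gain K (u k) (phi k) (psi k) z * kern a (z.1 - z.2)) _ rhs
  (inner Omega s w w - K ^+ 2 * J)).
- exact: measurable_Q.
- by move=> k; exact: (gain_int k).1.
- by move=> k z _; exact: mulr_ge0 (gain_ge0 _ _ (psi_lip k z)) (kern_ge0 _ _).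
- have E : {ae mu, forall x, u k x @[k --> \oo] --> uhat x /\
      phi k x @[k --> \oo] --> w x}.
    by apply: filterS2 u_lim phi_cvg => x; split.
  have := ae_prod E E; apply: filterS => z [[u1 p1] [u2 p2]] _.
  apply: cvgM; last exact: cvg_cst.
  exact: gain_cvg u1 u2 p1 p2 (psi_cvg p1) (psi_cvg p2).
- exact: gain_le.
- exact: rhs_cvg.
- by rewrite subr_le0; exact: minimizer_energy_le.
Qed.

Let diffs_eq0 : {ae mu2, forall z, Q z ->
  (w z.1 - w z.2) ^+ 2 = (`|w z.1| - `|w z.2|) ^+ 2 /\
  K * (uhat z.1 - uhat z.2) = `|w z.1| - `|w z.2|}.
Proof.
(* The inverse of zero being zero, the kernel vanishes on the diagonal and only
   there; both equalities are trivial for equal points. *)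
apply: filterS gain0 => z /[apply] /eqP; rewrite mulf_eq0 => /orP[/eqP|/eqP/kern_eq0/eqP].
  by apply: gain_eq0; exact: ler_dist_dist.
by rewrite subr_eq0 => /eqP ->; rewrite !subrr mulr0.
Qed.

(** The function [`|w| - K * uhat] is constant and vanishes outside [U], hence
    is zero; then [w] vanishes nowhere in [Omega] and cannot change sign. *)
Lemma minimizer_multiple : ~ ae_zero w -> exists2 k : R, 0 < k &
  {ae mu, forall x, w x = k * uhat x} \/ {ae mu, forall x, w x = - (k * uhat x)}.
Proof.
move=> w0; have [_ _ wU] := Xw; have [_ _ hU] := Xuhat.
have Kpos : 0 < K.
  rewrite lt_neqAle mass_ratio_ge0 andbT eq_sym; apply/negP => /eqP Keq; apply: w0.
  apply: (ae_constant_zero mO mU O0 Uc0) => //.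
  apply: filterS diffs_eq0 => z H /H[wz].
  rewrite Keq mul0r => Kz; move: wz; rewrite -Kz expr0n => /eqP.
  by rewrite sqrf_eq0 subr_eq0 => /eqP.
have absw : {ae mu, forall x, `|w x| = K * uhat x}.
  have : ae_zero (fun x => `|w x| - K * uhat x).
    apply: (ae_constant_zero mO mU O0 Uc0).
      apply: filterS diffs_eq0 => z H /H[_]; exact: mulrB_swap.
    apply: filterS2 wU hU => x wx ux nUx.
    by rewrite wx// ux// normr0 mulr0 subrr.
  by apply: filterS => x /eqP; rewrite subr_eq0 => /eqP.
exists K => //.
have [H|H] : {ae mu, forall x, w x = `|w x|} \/ {ae mu, forall x, w x = - `|w x|}.
  apply: (ae_constant_sign mO O0).
    apply: filterS diffs_eq0 => z H /H[H1 _].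
    exact: mul_ge0_of_sqrB.
  apply: filterS2 absw uhat_pos => x ax ux /ux xp.
  by rewrite -normr_gt0 ax mulr_gt0.
- by left; apply: filterS2 H absw => x wx <-.
- by right; apply: filterS2 H absw => x wx <-.
Qed.

End minimizer.

End equality_case.

Theorem theorem3p13 (R : realType) (N : nat) (s q C : R)
    (Omega DD NN : set 'rV[R]_N) (uhat : 'rV[R]_N -> R)
    (N_gt2 : (2 < N)%N) (s01 : 0 < s < 1) (q01 : 0 < q < 1)
    (Omega_neq0 : Omega !=set0) (Omega_open : open Omega)
    (DD_open : open DD) (NN_open : open NN)
    (DD_NN_disjoint : DD `&` NN = set0)
    (DD_NN_cover : DD `|` NN = ~` closure Omega)
    (bounded_domain : bounded_set (Omega `|` NN))
    (smooth_domain : smooth_boundary (Omega `|` NN))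
    (uhat_limit : regularized_limit Omega (U_set Omega NN) s q uhat)
    (uhat_X : X12D (U_set Omega NN) uhat)
    (uhat_weak : weak_solution Omega s q uhat) :
  let U := U_set Omega NN in
  let power_integral (v : 'rV[R]_N -> R) :=
    (\int[lebesgue_rV R N]_(x in Omega) (`|v x| `^ (1 - q)))
      `^ (2 / (1 - q)) in
  let inequality := forall v, X12D U v ->
    eta_norm Omega s v ^+ 2 >= C * power_integral v in
  (inequality <-> (C%:E <= Re_const Omega U s q)%E) /\
  (inequality ->
   forall w, X12D U w -> ~ ae_zero w ->
     eta_norm Omega s w ^+ 2 = C * power_integral w ->
     exists2 k : R, 0 < k &
       {ae lebesgue_rV R N, forall x, w x = k * uhat x} \/
       {ae lebesgue_rV R N, forall x, w x = - (k * uhat x)}).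
Proof.
move=> U power_integral inequality.
have mO := open_measurable_rV Omega_open.
have mU : measurable U := measurable_U_set Omega_open NN_open.
have Ofin := Omega_lty Omega_open bounded_domain.
split; first exact: (sharp_constantP s01 q01 mO mU Ofin).
move=> ineq w Xw w0 w_eq.
have [un [un_sol un_mono un_lim]] := uhat_limit.
have OU : Omega `<=` U := @Omega_sub_U_set _ _ Omega NN.
have O0 := Omega_gt0 Omega_open Omega_neq0.
have Uc0 : (0 < lebesgue_rV R N (~` U))%E.
  exact: U_setC_gt0 Omega_open NN_open bounded_domain (ltn_trans (ltn0Sn 1) N_gt2).
(* The regularized problems are indexed from one. *)
apply: (minimizer_multiple s01 q01 mO mU OU Ofin O0 Uc0
  (u := fun k => un k.+1) (C := C) _ _ _ uhat_X uhat_weak.1 _ Xw _ w0).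
- by move=> k; exact: un_sol.
- by move=> k; exact: un_mono.
- by apply: filterS un_lim => x; rewrite -cvg_shiftS.
- by move=> v Xv; rewrite -eta_norm_sqr//; exact: ineq.
- by rewrite -eta_norm_sqr// w_eq.
Qed.
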